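(* Let $m\ge 1$ and let $T_1,\dots,T_m:[0,1]\to[0,1]$ be $C^1$ maps with $T_i'(x)>0$ for all $x\in[0,1]$, such that $T_i((0,1))\cap T_j((0,1))=\emptyset$ for $i\neq j$, and such that $\operatorname{diam}(T_{i_1}\circ\cdots\circ T_{i_n}([0,1]))\to 0$ as $n\to\infty$, uniformly over all sequences $(i_1,i_2,\dots)\in\{1,\dots,m\}^{\mathbb N}$. Let $f:\Sigma\to\mathbb{R}$ be continuous. Then for every $\alpha\in[\alpha_{\min},\alpha_{\max}]$, \[ \dim \Pi(X_\alpha\cap\tilde\Sigma)=\sup_{\mu\in\mathcal{M}_\sigma(\Sigma)}\left\{\frac{h_\sigma(\mu)}{\lambda(\mu)}:\int f\,d\mu=\alpha\text{ and }\lambda(\mu)>0\right\}. \]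
   Context: $\Sigma=\{1,\dots,m\}^{\mathbb N}$ is the one-sided full shift with the product topology and shift map $\sigma$. The projection $\Pi:\Sigma\to[0,1]$ is $\Pi(\omega)=\lim_{n\to\infty}T_{\omega_1}\circ\cdots\circ T_{\omega_n}(0)$. Define $g:\Sigma\to\mathbb R$ by $g(\omega)=-\log T'_{\omega_1}(\Pi(\sigma\omega))$. For $F:\Sigma\to\mathbb R$ write $A_nF(\omega)=\frac1n\sum_{i=0}^{n-1}F(\sigma^i\omega)$. Let $X_\alpha=\{\omega\in\Sigma:\lim_{n\to\infty}A_nf(\omega)=\alpha\}$ and $\tilde\Sigma=\{\omega\in\Sigma:\liminf_{n\to\infty}A_ng(\omega)>0\}$. $\mathcal M_\sigma(\Sigma)$ denotes the $\sigma$-invariant Borel probability measures on $\Sigma$ and $\mathcal E_\sigma(\Sigma)$ the ergodic ones; $h_\sigma(\mu)$ is the measure-theoretic entropy of $\mu$ and $\lambda(\mu)=\int g\,d\mu$ its Lyapunov exponent. $\alpha_{\min}=\inf_{\mu\in\mathcal E_\sigma(\Sigma)}\int f\,d\mu$ and $\alpha_{\max}=\sup_{\mu\in\mathcal E_\sigma(\Sigma)}\int f\,d\mu$. $\dim$ denotes Hausdorff dimension. *)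

(* Defs.v *)
From HB Require Import structures.
From mathcomp Require Import all_boot all_order all_algebra.
From mathcomp Require Import all_classical all_reals all_analysis.

Set Implicit Arguments.
Unset Strict Implicit.
Unset Printing Implicit Defensive.

Import Order.TTheory GRing.Theory Num.Theory.
Import numFieldNormedType.Exports.
Local Open Scope classical_set_scope.
Local Open Scope ring_scope.

(* The full shift on the alphabet 'I_n.+1 = {0,...,n}, i.e. m = n+1 >= 1 symbols. *)
Definition Sigma (n : nat) := nat -> 'I_n.+1.
HB.instance Definition _ n := gen_eqMixin (Sigma n).
HB.instance Definition _ n := gen_choiceMixin (Sigma n).
HB.instance Definition _ n := isPointed.Build (Sigma n) (fun _ => ord0).

Definition cylinder n k (w : 'I_k -> 'I_n.+1) : set (Sigma n) :=
  [set om | forall i : 'I_k, om i = w i].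
Definition cylinders n : set (set (Sigma n)) :=
  [set C | exists k (w : 'I_k -> 'I_n.+1), C = cylinder w].
(* Sigma with its Borel sigma-algebra (generated by the cylinders, which form
   a countable base of clopen sets for the product topology). *)
Definition SigmaM n := g_sigma_algebraType (@cylinders n).

Definition shift n (om : Sigma n) : Sigma n := fun k => om k.+1.
Definition shiftn n (i : nat) (om : Sigma n) : Sigma n := fun k => om (k + i)%N.
Definition sprefix n (om : Sigma n) (k : nat) : seq 'I_n.+1 := map om (iota 0 k).

Definition cont_Sigma n (R : realType) (f : Sigma n -> R) :=
  forall om (e : R), 0 < e -> exists N : nat,
    forall om', (forall i, (i < N)%N -> om' i = om i) -> `|f om' - f om| < e.

Section Defs.
Variable R : realType.

Definition I01 : set R := [set x | 0 <= x <= 1].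
Definition I01o : set R := [set x | 0 < x < 1].

(* D is the (one-sided at the endpoints) derivative of F on [0,1], and is continuous *)
Definition C1_on01 (F D : R -> R) :=
  {within I01, continuous D} /\
  forall x, I01 x ->
    (fun y => (F y - F x) / (y - x)) @ within (I01 `\ x) (nbhs x) --> D x.

Definition compw n (T : 'I_n.+1 -> R -> R) (w : seq 'I_n.+1) : R -> R :=
  foldr (fun i g => T i \o g) id w.

Definition projPi n (T : 'I_n.+1 -> R -> R) (om : Sigma n) : R :=
  lim ((fun k => compw T (sprefix om k) 0) @ \oo).

Definition geom n (T T' : 'I_n.+1 -> R -> R) (om : Sigma n) : R :=
  - ln (T' (om 0%N) (projPi T (shift om))).

Definition birk n (F : Sigma n -> R) (k : nat) (om : Sigma n) : R :=
  k%:R^-1 * \sum_(i < k) F (shiftn i om).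

Definition level_set n (f : Sigma n -> R) (alpha : R) : set (Sigma n) :=
  [set om | (fun k => birk f k om) @ \oo --> alpha].

Definition tildeSigma n (T T' : 'I_n.+1 -> R -> R) : set (Sigma n) :=
  [set om | (0 < limn_einf (fun k => (birk (geom T T') k om)%:E))%E].

Definition shift_invariant n (mu : probability (SigmaM n) R) :=
  forall A : set (SigmaM n), measurable A -> mu (@shift n @^-1` A) = mu A.

Definition shift_ergodic n (mu : probability (SigmaM n) R) :=
  shift_invariant mu /\
  forall A : set (SigmaM n), measurable A -> @shift n @^-1` A = A ->
    mu A = 0%E \/ mu A = 1%E.

Definition is_partition n k (P : 'I_k -> set (SigmaM n)) :=
  (forall i, measurable (P i)) /\
  (forall i j, i != j -> P i `&` P j = set0) /\
  (forall om, exists i, P i om).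

Definition xlnx (x : R) : R := - (x * ln x).

Definition join_atom n k (P : 'I_k -> set (SigmaM n)) N (a : {ffun 'I_N -> 'I_k})
  : set (SigmaM n) := [set om | forall t : 'I_N, P (a t) (shiftn t om)].

Definition part_entropy n (mu : probability (SigmaM n) R) k
  (P : 'I_k -> set (SigmaM n)) N : R :=
  \sum_(a : {ffun 'I_N -> 'I_k}) xlnx (fine (mu (join_atom P a))).

Definition ks_entropy n (mu : probability (SigmaM n) R) : \bar R :=
  ereal_sup [set z | exists k (P : 'I_k -> set (SigmaM n)),
     is_partition P /\
     z = (lim ((fun N => part_entropy mu P N / N%:R) @ \oo))%:E].

Definition lyap n (T T' : 'I_n.+1 -> R -> R) (mu : probability (SigmaM n) R)
  : \bar R := (\int[mu]_x (geom T T' x)%:E)%E.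

Definition alpha_min n (f : Sigma n -> R) : \bar R :=
  ereal_inf [set (\int[mu]_x (f x)%:E)%E | mu in [set mu | @shift_ergodic n mu]].
Definition alpha_max n (f : Sigma n -> R) : \bar R :=
  ereal_sup [set (\int[mu]_x (f x)%:E)%E | mu in [set mu | @shift_ergodic n mu]].

(* diameter of a subset of R (0 for the empty set) *)
Definition diamE (A : set R) : \bar R :=
  ereal_sup ([set 0%E] `|` [set z | exists x y, A x /\ A y /\ z = `|x - y|%:E]).

Definition hausdorff_pre (s d : R) (E : set R) : \bar R :=
  ereal_inf [set (\sum_(0 <= k <oo) ((fine (diamE (U k))) `^ s)%:E)%E
            | U in [set U : nat -> set R |
                     E `<=` \bigcup_k U k /\ forall k, (diamE (U k) <= d%:E)%E]].

Definition hausdorff_meas (s : R) (E : set R) : \bar R :=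
  ereal_sup [set hausdorff_pre s d E | d in [set d : R | 0 < d]].

Definition hdim (E : set R) : \bar R :=
  ereal_inf [set s%:E | s in [set s : R | 0 < s /\ hausdorff_meas s E = 0%E]].

End Defs.
Arguments I01 {R}.
Arguments I01o {R}.

(* Main.v *)
Require Import Defs.
From HB Require Import structures.
From mathcomp Require Import all_boot all_order all_algebra.
From mathcomp Require Import all_classical all_reals all_analysis.
From mathcomp Require Import measurable_realfun ring lra zify.
Import Order.TTheory GRing.Theory Num.Theory.
Import numFieldNormedType.Exports.
Local Open Scope classical_set_scope.
Local Open Scope ring_scope.

Set Implicit Arguments.
Unset Strict Implicit.
Unset Printing Implicit Defensive.

(* The Hausdorff dimension is compared with a pressure. For a word w of length k
   the interval T_w([0,1]) has length exp(- S_k g + o(k)), since the oscillation of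
   log T' on T_v([0,1]) tends to 0 as |v| grows (S_k is the Birkhoff sum).

   Upper bound. Let s exceed the supremum, eta > 0, and let Z_k(eps) be the words of
   length k with |S_k f - k alpha| <= k eps and S_k g >= k eta. If the sums of
   exp(- s S_k g) over Z_k(eps) did not decay exponentially for any eps, weight the
   words by exp(- s S_k g), average over the orbits of the periodic points they
   define, and pass to an ultralimit: Gibbs' inequality for products of block
   weights gives an invariant measure with integral alpha, exponent >= eta and
   entropy >= s times the exponent, a contradiction. So the intervals of words in
   Z_k(eps) are efficient covers, and countably many such families exhaust the set.

   Lower bound. For an invariant mu, the entropy of any partition is at most the
   growth rate of the entropy of cylinders (Fano). The weak law of large numbers for
   independent blocks with the distribution of the k-words under mu produces, for
   mu ergodic or not, about exp(l h) words of a length l on which the averages of f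
   and g are close to their means. Concatenating such words with slowly improving
   precision gives a Moran set inside the level set; the uniform measure on it and
   the fact that a set of diameter r meets at most two of the intervals longer
   than r of one generation give the mass distribution principle. *)

(** * Words and cylinders *)

(** The maps need not contract uniformly: [geom] may vanish or be negative at some points. The bound
    S_k g >= k eta is what survives the limit and keeps the exponent of the limit measure positive,
    hence the measure admissible in the supremum; this is why the set is cut into pieces with a
    fixed eta.

    Entropy does not pass to limits directly. Gibbs' inequality bounds it by a sum of - P(w) ln r(w)
    with test weights r held fixed, which is linear in the cylinder weights P. The limit is taken in
    P first, and r is set close to the limit weights afterwards.

    In the lower bound the source of independent blocks is not mu, but its entropy per letter and
    its means of f and g are close to those of mu, and the weak law holds for it whether or not mu
    is ergodic; no ergodic decomposition occurs. A covering set has a diameter between the scales of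
    two consecutive generations, so these scales must agree up to a small factor in the exponent.
    This forces the lengths of the concatenated words to grow slower than their index, and is
    obtained by repeating one set of words many times before a more precise set is used. *)

Section Words.
Variable n : nat.
Implicit Types (om : Sigma n) (w : seq 'I_n.+1).

Definition cyl w : set (Sigma n) := [set om | sprefix om (size w) = w].

(** A reference point of the cylinder of [w]: Birkhoff sums of a word are evaluated there, up to the
    oscillation on the cylinder. *)
Definition ext w : Sigma n := fun i => nth ord0 w i.

Lemma size_sprefix om k : size (sprefix om k) = k.
Proof. by rewrite size_map size_iota. Qed.

Lemma nth_sprefix om k i x : (i < k)%N -> nth x (sprefix om k) i = om i.
Proof.
by move=> ik; rewrite (nth_map 0%N) ?size_iota// nth_iota.
Qed.

Lemma sprefixP om om' k :
  (forall i, (i < k)%N -> om i = om' i) <-> sprefix om k = sprefix om' k.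
Proof.
split=> [h|h i ik].
  apply: (@eq_from_nth _ ord0); rewrite !size_sprefix// => i ik.
  by rewrite !nth_sprefix// h.
by rewrite -(nth_sprefix om ord0 ik) h nth_sprefix.
Qed.

Lemma sprefix_add om k l :
  sprefix om (k + l) = sprefix om k ++ sprefix (shiftn k om) l.
Proof.
rewrite /sprefix iotaD map_cat; congr (_ ++ _).
by rewrite add0n -[k in iota k]addn0 iotaDl -map_comp; apply: eq_map => i /=;
  rewrite /shiftn addnC.
Qed.

Lemma sprefixS om k : sprefix om k.+1 = rcons (sprefix om k) (om k).
Proof. by rewrite -[in LHS](addn1 k) sprefix_add cats1. Qed.

Lemma take_sprefix om k l : (l <= k)%N -> take l (sprefix om k) = sprefix om l.
Proof.
by move=> lk; rewrite -(subnKC lk) sprefix_add take_size_cat// size_sprefix.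
Qed.

Lemma drop_sprefix om k l :
  drop k (sprefix om (k + l)) = sprefix (shiftn k om) l.
Proof. by rewrite sprefix_add drop_size_cat// size_sprefix. Qed.

Lemma sprefix_le om om' k l : (l <= k)%N ->
  sprefix om k = sprefix om' k -> sprefix om l = sprefix om' l.
Proof. by move=> lk h; rewrite -(take_sprefix om lk) h take_sprefix. Qed.

Lemma sprefix_shiftn om om' k l : sprefix om (k + l) = sprefix om' (k + l) ->
  sprefix (shiftn k om) l = sprefix (shiftn k om') l.
Proof. by rewrite -!drop_sprefix => ->. Qed.

Lemma sprefix_ext w : sprefix (ext w) (size w) = w.
Proof.
by apply: (@eq_from_nth _ ord0); rewrite ?size_sprefix// => i ik; rewrite nth_sprefix.
Qed.

Lemma shiftnD om k l : shiftn k (shiftn l om) = shiftn (k + l) om.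
Proof. by apply/funext => i; rewrite /shiftn addnA. Qed.

Lemma shiftn0 om : shiftn 0 om = om.
Proof. by apply/funext => i; rewrite /shiftn addn0. Qed.

Lemma shift_shiftn om : Defs.shift om = shiftn 1 om.
Proof. by apply/funext => i; rewrite /shiftn /Defs.shift addn1. Qed.

Lemma cyl_cylinder w : cyl w = cylinder (fun i : 'I_(size w) => tnth (in_tuple w) i).
Proof.
apply/seteqP; split=> om /=.
  by move=> h i; rewrite (tnth_nth ord0) /= -{2}h nth_sprefix.
move=> h; apply: (@eq_from_nth _ ord0); rewrite ?size_sprefix// => i ik.
by rewrite nth_sprefix// (h (Ordinal ik)) (tnth_nth ord0).
Qed.

Lemma cylinder_cyl k (v : 'I_k -> 'I_n.+1) : cylinder v = cyl (codom v).
Proof.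
apply/seteqP; split=> om /=.
  rewrite /cylinder /cyl /= size_codom card_ord => h.
  apply: (@eq_from_nth _ ord0); rewrite ?size_sprefix ?size_codom ?card_ord// => i ik.
  rewrite nth_sprefix// (h (Ordinal ik)) codomE (nth_map (Ordinal ik)) ?size_enum_ord//.
  by congr v; apply: val_inj; rewrite /= nth_enum_ord.
rewrite /cyl /= size_codom card_ord => h i.
rewrite -(nth_sprefix om ord0 (ltn_ord i)) h codomE (nth_map i) ?size_enum_ord//.
by congr v; apply: val_inj; rewrite /= nth_enum_ord.
Qed.

Lemma measurable_cyl w : measurable (cyl w : set (SigmaM n)).
Proof.
apply: sub_sigma_algebra; rewrite cyl_cylinder.
by exists (size w), (fun i => tnth (in_tuple w) i).
Qed.

Lemma cyl_sprefix om k : cyl (sprefix om k) om.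
Proof. by rewrite /cyl /= size_sprefix. Qed.

(** The tuple form of a prefix takes values in a finite type, so that it is a finite-valued random
    variable and sums over words are finite sums. *)
Definition pword om k : k.-tuple 'I_n.+1 := [tuple om i | i < k].
Arguments pword : simpl never.

Lemma pwordE om k : pword om k = sprefix om k :> seq _.
Proof.
apply: (@eq_from_nth _ ord0); rewrite ?size_sprefix ?size_tuple// => i ik.
by rewrite nth_sprefix// -[i]/(val (Ordinal ik)) -tnth_nth tnth_mktuple.
Qed.

Lemma sprefix_ext_tuple k (w : k.-tuple 'I_n.+1) : sprefix (ext w) k = w.
Proof. by have := sprefix_ext w; rewrite size_tuple. Qed.

Lemma cyl_pword k (w : k.-tuple 'I_n.+1) : cyl w = [set om | pword om k = w].
Proof.
apply/seteqP; split=> om /=.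
  by rewrite /cyl /= size_tuple => h; apply/val_inj; rewrite /= pwordE.
move=> <-; change (sprefix om (size (pword om k)) = pword om k).
by rewrite size_tuple pwordE.
Qed.

Lemma measurable_shiftn k : measurable_fun setT (@shiftn n k : SigmaM n -> SigmaM n).
Proof.
apply: (@measurability _ _ (SigmaM n) (SigmaM n) setT _ (@cylinders n)) => //.
move=> _ [_ [l [w ->]] <-]; rewrite setTI cylinder_cyl.
move: (codom w) => v.
have -> : @shiftn n k @^-1` cyl v =
  \bigcup_(u in [set: k.-tuple 'I_n.+1]) cyl (u ++ v).
  apply/seteqP; split=> om.
    rewrite /cyl /= => h; exists (pword om k) => //.
    change (sprefix om (size (pword om k ++ v)) = pword om k ++ v).
    by rewrite size_cat size_tuple sprefix_add h pwordE.
  move=> [u _]; rewrite /cyl /= size_cat size_tuple sprefix_add => /eqP.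
  by rewrite eqseq_cat ?size_sprefix ?size_tuple// => /andP[_ /eqP].
by apply: countable_bigcupT_measurable => [|u]; [exact: countableP|exact: measurable_cyl].
Qed.

End Words.

(** * Probabilities and uniform continuity *)

Section Pr.
Context d (T : measurableType d) (R : realType) (mu : probability T R).
Implicit Types D E : set T.

Definition pr D : R := fine (mu D).

Lemma prE D : measurable D -> mu D = (pr D)%:E.
Proof. by move=> mD; rewrite /pr fineK// fin_num_measure. Qed.

Lemma pr_ge0 D : 0 <= pr D.
Proof. exact: fine_ge0. Qed.

Lemma pr0 : pr set0 = 0.
Proof. by rewrite /pr measure0. Qed.

Lemma prT : pr setT = 1.
Proof. by rewrite /pr probability_setT. Qed.

Lemma le_pr D E : measurable D -> measurable E -> D `<=` E -> pr D <= pr E.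
Proof.
move=> mD mE DE; rewrite -lee_fin -!prE//.
by apply: le_measure => //; rewrite inE.
Qed.

Lemma pr_le1 D : measurable D -> pr D <= 1.
Proof. by move=> mD; rewrite -prT le_pr. Qed.

Lemma pr_setU D E : measurable D -> measurable E -> D `&` E = set0 ->
  pr (D `|` E) = pr D + pr E.
Proof.
move=> mD mE DE; apply: EFin_inj; rewrite -prE ?EFinD -?prE//; last exact: measurableU.
exact: measureU.
Qed.

Lemma le_pr_setU D E : measurable D -> measurable E ->
  pr (D `|` E) <= pr D + pr E.
Proof.
move=> mD mE; rewrite -lee_fin EFinD -!prE//; last exact: measurableU.
exact: measureU2.
Qed.

Lemma pr_setC D : measurable D -> pr (~` D) = 1 - pr D.
Proof.
move=> mD; rewrite -prT -(setUv D) pr_setU ?setICr//; last exact: measurableC.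
by rewrite addrC addKr.
Qed.

Lemma le_pr_bigsetU (I : Type) (r : seq I) (P : pred I) (E : I -> set T) :
  (forall i, measurable (E i)) ->
  pr (\big[setU/set0]_(i <- r | P i) E i) <= \sum_(i <- r | P i) pr (E i).
Proof.
move=> mE; elim: r => [|i r IH]; first by rewrite !big_nil pr0.
rewrite !big_cons; case: (P i) => //.
apply: le_trans (le_pr_setU _ _) _ => //; last by rewrite lerD2l.
by apply: bigsetU_measurable.
Qed.

Section FiniteValued.
Variables (I : finType) (X : T -> I).
Hypothesis mX : forall i, measurable [set x | X x = i].

Lemma measurable_fin_preimage (P : pred I) : measurable [set x | P (X x)].
Proof.
have -> : [set x | P (X x)] = \bigcup_(i in [set i | P i]) [set x | X x = i].
  by apply/seteqP; split => [x Px|x [i /= Pi xi]]; [exists (X x)|rewrite xi].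
by apply: fin_bigcup_measurable.
Qed.

Lemma pr_sum D : measurable D -> pr D = \sum_i pr (D `&` [set x | X x = i]).
Proof.
move=> mD.
suff h (r : seq I) : uniq r ->
    pr (D `&` [set x | X x \in r]) = \sum_(i <- r) pr (D `&` [set x | X x = i]).
  rewrite -h ?index_enum_uniq//; congr pr.
  by apply/seteqP; split => x /= => [Dx|[]//]; split=> //; rewrite mem_index_enum.
elim: r => [_|i r IH /= /andP[ir ur]].
  by rewrite big_nil -pr0; congr pr; apply/seteqP; split => // x [].
rewrite big_cons -IH// -pr_setU; first congr pr.
- apply/seteqP; split => x /=; rewrite ?inE.
    by case=> Dx /orP[/eqP|]; [left|right].
  case=> -[Dx xi]; split=> //; first by rewrite xi eqxx.
  by rewrite xi orbT.
- exact: measurableI.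
- by apply: measurableI => //; exact: measurable_fin_preimage (mem r).
- apply/seteqP; split => // x /= [[_ xi] [_]]; rewrite xi.
  by move/negP: ir.
Qed.

Lemma integral_fin_valued (phi : I -> R) :
  (\int[mu]_x (phi (X x))%:E)%E = (\sum_i pr [set x | X x = i] * phi i)%:E.
Proof.
transitivity (\int[mu]_x (\sum_i (phi i)%:E * (\1_[set y | X y = i] x)%:E))%E.
  apply: eq_integral => x _; rewrite (bigD1 (X x))//= big1.
    by rewrite adde0 indicE mem_set// mule1.
  by move=> i iX; rewrite indicE memNset ?mule0//= => h; rewrite h eqxx in iX.
rewrite integral_sum//; last first.
  by move=> i; apply: integrableZl => //; exact: integrable_indic.
rewrite -sumEFin; apply: eq_bigr => i _.
rewrite integralZl//; last exact: integrable_indic.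
rewrite integral_indic// setIT.
by transitivity ((phi i)%:E * mu [set x | X x = i])%E; rewrite // prE// -EFinM mulrC.
Qed.

End FiniteValued.

End Pr.

Section UniformContinuity.
Variables (n : nat) (R : realType).
Implicit Types (F : Sigma n -> R) (om : Sigma n).

Definition ucont F := forall e : R, 0 < e -> exists k, forall om om',
  sprefix om k = sprefix om' k -> `|F om - F om'| < e.

(** Compactness of the shift space as an argument of König type: a word is bad if no modulus works
    on its cylinder. A bad word has a bad one-letter extension, and continuity fails at the limit
    point of an infinite bad branch. *)
Lemma cont_Sigma_ucont F : cont_Sigma F -> ucont F.
Proof.
move=> cF e e0; apply: contrapT => nk.
pose bad (w : seq 'I_n.+1) := forall k, exists om om',
  [/\ cyl w om, cyl w om', sprefix om k = sprefix om' k & e <= `|F om - F om'|].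
have bad0 : bad [::].
  move=> k; apply: contrapT => h; apply: nk; exists k => om om' hk.
  by rewrite ltNge; apply/negP => he; apply: h; exists om, om'.
have badS w : bad w -> exists a, bad (rcons w a).
  move=> bw; apply: contrapT => /forallNP h.
  have {}h a : exists k, ~ exists om om', [/\ cyl (rcons w a) om, cyl (rcons w a) om',
      sprefix om k = sprefix om' k & e <= `|F om - F om'|].
    by apply/existsNP; exact: h.
  have [K hK] := choice h.
  (* The length exceeds [size w], so both points carry the same letter after [w], and it dominates
     the modulus [K a] of every letter. *)
  have [om [om' [omw omw' hk he]]] := bw ((size w).+1 + \max_a K a)%N.
  apply: (hK (om (size w))); exists om, om'; split => //.
  - by rewrite /cyl /= size_rcons sprefixS omw.
  - rewrite /cyl /= size_rcons sprefixS omw'; congr rcons; apply/esym.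
    by apply: (proj2 (sprefixP _ _ _) hk); rewrite addSn ltnS leq_addr.
  - apply: sprefix_le hk; apply: leq_trans (leq_addl _ _); exact: leq_bigmax.
have /choice[nxt hnxt] : forall w, exists a, bad w -> bad (rcons w a).
  move=> w.
  have [/badS[a ba]|nb] := pselect (bad w); first by exists a.
  by exists ord0.
pose W := fix W k := if k is k'.+1 then rcons (W k') (nxt (W k')) else [::].
have bW k : bad (W k) by elim: k => //= k; exact: hnxt.
pose om : Sigma n := fun k => nxt (W k).
have omW k : sprefix om k = W k by elim: k => // k IH; rewrite sprefixS IH.
have [N hN] := cF om (e / 2) (divr_gt0 e0 (ltr0Sn _ 1)).
have [om1 [om2 [h1 h2 _]]] := bW N 0%N.
have sW : size (W N) = N by rewrite -omW size_sprefix.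
move: h1 h2; rewrite /cyl /= sW => h1 h2.
have d1 : `|F om1 - F om| < e / 2.
  by apply: hN; apply/sprefixP; rewrite omW.
have d2 : `|F om2 - F om| < e / 2.
  by apply: hN; apply/sprefixP; rewrite omW.
apply/negP; rewrite -ltNge.
have -> : F om1 - F om2 = (F om1 - F om) - (F om2 - F om) by ring.
by apply: (le_lt_trans (ler_normB _ _)); lra.
Qed.

End UniformContinuity.

(** * Finite entropy *)

Section Entropy.
Variable R : realType.

(** The inequality ln x <= x - 1 at x = q/p. Since [q] may have total mass below 1, product weights
    restricted to part of a product space are allowed. *)
Lemma gibbs (I : finType) (p q : I -> R) :
  (forall i, 0 <= p i) -> \sum_i p i = 1 ->
  (forall i, 0 <= q i) -> \sum_i q i <= 1 ->
  (forall i, 0 < p i -> 0 < q i) ->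
  \sum_i xlnx (p i) <= \sum_i - (p i * ln (q i)).
Proof.
move=> p0 p1 q0 q1 pq; rewrite -subr_ge0 -sumrB.
apply: (@le_trans _ _ (\sum_i (p i - q i))); first by rewrite sumrB p1 subr_ge0.
apply: ler_sum => i _; rewrite /xlnx.
have := p0 i; rewrite le_eqVlt => /orP[/eqP <-|pi0].
  by rewrite !mul0r !oppr0 sub0r addr0 oppr_le0.
have qi0 := pq i pi0.
have h : ln (q i / p i) <= q i / p i - 1.
  have h0 : 0 < q i / p i by rewrite divr_gt0.
  by have := @le_ln1Dx R (q i / p i - 1); rewrite [1 + _]addrC subrK; apply; lra.
rewrite ln_div ?posrE// in h.
have : p i * (ln (q i) - ln (p i)) <= p i * (q i / p i - 1) by rewrite ler_pM2l.
rewrite mulrBr mulrBr mulrCA divff ?gt_eqF// !mulr1; lra.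
Qed.

Lemma xlnxD (x y : R) : 0 <= x -> 0 <= y -> xlnx (x + y) <= xlnx x + xlnx y.
Proof.
rewrite /xlnx le_eqVlt => /orP[/eqP <-|x0]; first by rewrite !add0r mul0r oppr0 add0r.
rewrite le_eqVlt => /orP[/eqP <-|y0]; first by rewrite !addr0 mul0r oppr0 addr0.
have h1 : ln x <= ln (x + y) by rewrite ler_ln ?posrE ?addr_gt0//; lra.
have h2 : ln y <= ln (x + y) by rewrite ler_ln ?posrE ?addr_gt0//; lra.
have := ler_wpM2l (ltW x0) h1; have := ler_wpM2l (ltW y0) h2; rewrite mulrDl; lra.
Qed.

Lemma xlnx_sum (I : Type) (r : seq I) (P : pred I) (F : I -> R) :
  (forall i, 0 <= F i) ->
  xlnx (\sum_(i <- r | P i) F i) <= \sum_(i <- r | P i) xlnx (F i).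
Proof.
move=> F0; elim: r => [|i r IH]; first by rewrite !big_nil /xlnx mul0r oppr0.
rewrite !big_cons; case: (P i) => //.
by apply: le_trans (xlnxD (F0 i) _) _; [exact: sumr_ge0|rewrite lerD2l].
Qed.

Section RandomVariables.
Context d (T : measurableType d) (mu : probability T R).

Definition rvent (I : finType) (X : T -> I) : R :=
  \sum_i xlnx (pr mu [set x | X x = i]).

Lemma pr_pred (I : finType) (X : T -> I) (P : pred I) :
  (forall i, measurable [set x | X x = i]) ->
  pr mu [set x | P (X x)] = \sum_(i | P i) pr mu [set x | X x = i].
Proof.
move=> mX; rewrite (pr_sum mu mX); last exact: measurable_fin_preimage.
rewrite [RHS]big_mkcond/=; apply: eq_bigr => i _; case: ifPn => Pi.
  by congr pr; apply/seteqP; split => x /= => [[]//|xi]; rewrite xi.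
by rewrite -(pr0 mu); congr pr; apply/seteqP; split => // x /= [] /[swap] ->; exact/negP.
Qed.

Lemma sum_pr1 (I : finType) (X : T -> I) :
  (forall i, measurable [set x | X x = i]) ->
  \sum_i pr mu [set x | X x = i] = 1.
Proof.
by move=> mX; rewrite -(@pr_pred _ X xpredT)// -(prT mu); congr pr; apply/seteqP.
Qed.

Lemma pr_comp (I J : finType) (X : T -> I) (g : I -> J) j :
  (forall i, measurable [set x | X x = i]) ->
  pr mu [set x | g (X x) = j] = \sum_(i | g i == j) pr mu [set x | X x = i].
Proof.
move=> mX; rewrite -(@pr_pred _ X (fun i => g i == j))//; congr pr.
by apply/seteqP; split => x /= /eqP.
Qed.

Lemma sum_pr_comp (I J : finType) (X : T -> I) (g : I -> J) (phi : J -> R) :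
  (forall i, measurable [set x | X x = i]) ->
  \sum_i pr mu [set x | X x = i] * phi (g i) =
  \sum_j pr mu [set x | g (X x) = j] * phi j.
Proof.
move=> mX; rewrite (partition_big g xpredT)//=; apply: eq_bigr => j _.
by rewrite pr_comp// mulr_suml; apply: eq_bigr => i /eqP ->.
Qed.

Lemma rvent_comp (I J : finType) (X : T -> I) (g : I -> J) :
  (forall i, measurable [set x | X x = i]) ->
  rvent (g \o X) <= rvent X.
Proof.
move=> mX; rewrite /rvent [leRHS](partition_big g xpredT)//=.
apply: ler_sum => j _.
rewrite [X in xlnx X](pr_comp _ _ mX).
by apply: xlnx_sum => i; exact: pr_ge0.
Qed.

Lemma rvent_gibbs (I : finType) (X : T -> I) (q : I -> R) :
  (forall i, measurable [set x | X x = i]) ->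
  (forall i, 0 <= q i) -> \sum_i q i <= 1 ->
  (forall i, 0 < pr mu [set x | X x = i] -> 0 < q i) ->
  rvent X <= \sum_i - (pr mu [set x | X x = i] * ln (q i)).
Proof. by move=> mX q0 q1 qp; apply: gibbs => //; rewrite ?sum_pr1// => i; exact: pr_ge0. Qed.

Lemma measurable_pair_eq (I J : finType) (X : T -> I) (Y : T -> J) :
  (forall i, measurable [set x | X x = i]) ->
  (forall i, measurable [set x | Y x = i]) ->
  forall i, measurable [set x | (X x, Y x) = i].
Proof.
move=> mX mY [i j].
have -> : [set x | (X x, Y x) = (i, j)] = [set x | X x = i] `&` [set x | Y x = j].
  by apply/seteqP; split => x /= [-> ->].
exact: measurableI.
Qed.

(** Gibbs' inequality against the product of the two marginals. *)
Lemma rvent_pair (I J : finType) (X : T -> I) (Y : T -> J) :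
  (forall i, measurable [set x | X x = i]) ->
  (forall i, measurable [set x | Y x = i]) ->
  rvent (fun x => (X x, Y x)) <= rvent X + rvent Y.
Proof.
move=> mX mY; have mXY := measurable_pair_eq mX mY.
pose p i := pr mu [set x | X x = i]; pose q j := pr mu [set x | Y x = j].
have pp i j : 0 < pr mu [set x | (X x, Y x) = (i, j)] -> 0 < p i /\ 0 < q j.
  move=> h; split; apply: lt_le_trans h _; apply: le_pr => //;
    by [exact: mXY|move=> x /= []].
apply: le_trans (@rvent_gibbs _ _ (fun ij => p ij.1 * q ij.2) mXY _ _ _) _.
- by move=> i; rewrite mulr_ge0// pr_ge0.
- rewrite -(pair_big xpredT xpredT (fun i j => p i * q j))/=.
  under eq_bigr do rewrite -mulr_sumr sum_pr1// mulr1.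
  by rewrite sum_pr1.
- by move=> [i j] /pp[? ?]; rewrite mulr_gt0.
rewrite (eq_bigr (fun ij => pr mu [set x | (X x, Y x) = ij] * (- ln (p ij.1)) +
   pr mu [set x | (X x, Y x) = ij] * (- ln (q ij.2)))); last first.
  move=> [i j] _ /=.
  have := pr_ge0 mu [set x | (X x, Y x) = (i, j)].
  rewrite le_eqVlt => /orP[/eqP <-|/[dup] h /pp[pi qj]]; first by rewrite !mul0r oppr0 addr0.
  by rewrite lnM ?posrE//; ring.
rewrite big_split/= (sum_pr_comp fst (fun i => - ln (p i)) mXY).
rewrite (sum_pr_comp snd (fun j => - ln (q j)) mXY)/=.
by rewrite lerD//; apply: ler_sum => i _; rewrite mulrN.
Qed.

End RandomVariables.

(** The limit is the infimum of a k / k over k >= 1, approached by dividing N by a nearly optimal K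
    with remainder. *)
Lemma fekete (a : nat -> R) : (forall k, 0 <= a k) ->
  (forall k l, a (k + l)%N <= a k + a l) ->
  cvgn (fun k => a k / k%:R).
Proof.
move=> a0 asub.
pose S := [set a k.+1 / k.+1%:R | k in [set: nat]].
have hS : has_inf S.
  split; first by exists (a 1%N / 1%:R), 0%N.
  by exists 0 => _ [k _ <-]; rewrite divr_ge0.
apply/cvg_ex; exists (inf S); apply/cvgrPdist_lt => e e0.
have [_ [k _ <-] hk] := inf_adherent (divr_gt0 e0 (ltr0Sn R 1)) hS.
set K := k.+1 in hk.
have aq q : a (q * K)%N <= q%:R * a K + a 0%N.
  elim: q => [|q IH]; first by rewrite mul0n mul0r add0r.
  rewrite mulSn; apply: le_trans (asub _ _) _; rewrite -natr1; lra.
(* [M] absorbs the remainder term a(N mod K) and the value [a 0], which is not assumed to vanish. *)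
pose M := a 0%N + \sum_(r < K) a r.
have M0 : 0 <= M by rewrite addr_ge0// sumr_ge0.
near=> N.
have N0 : 0 < N%:R :> R by rewrite ltr0n; near: N; exists 1%N.
rewrite ltr_norml; apply/andP; split; last first.
  have : inf S <= a N / N%:R.
    apply: ge_inf; first by case: hS.
    by exists N.-1 => //=; rewrite prednK// -(ltr0n R).
  lra.
have h1 : a N <= (N %/ K)%:R * a K + M.
  rewrite {1}(divn_eq N K); apply: le_trans (asub _ _) _.
  have h2 : a (N %% K)%N <= \sum_(r < K) a r.
    rewrite (bigD1 (Ordinal (ltn_pmod N (ltn0Sn k))))//= lerDl.
    by rewrite sumr_ge0.
  by have := aq (N %/ K)%N; rewrite /M; lra.
have h3 : (N %/ K)%:R * a K <= N%:R * (a K / K%:R).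
  rewrite mulrA mulrAC ler_wpM2r//.
  by rewrite ler_pdivlMr ?ltr0n// -natrM ler_nat leq_divM.
have h4 : a N / N%:R <= a K / K%:R + M / N%:R.
  rewrite ler_pdivrMr// mulrDl divfK ?gt_eqF//; lra.
have h5 : M / N%:R < e / 2.
  rewrite ltr_pdivrMr//; have -> : M = e / 2 * (M / (e / 2)).
    by rewrite mulrCA divff ?mulr1// gt_eqF// divr_gt0.
  rewrite ltr_pM2l ?divr_gt0//; near: N; exact: nbhs_infty_gtr.
lra.
Unshelve. all: by end_near. Qed.

End Entropy.

(** * Birkhoff sums and integrals on the shift *)

Lemma sum_lt_minn (R : realType) (c : R) k l :
  \sum_(j < k) (if (j < l)%N then c else 0) = c *+ minn k l.
Proof.
elim: k => [|k IH]; first by rewrite big_ord0 min0n.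
rewrite big_ord_recr/= IH; case: ltnP => kl.
  by rewrite -mulrSr; congr (_ *+ _); lia.
by rewrite addr0; congr (_ *+ _); lia.
Qed.

Section OnSigma.
Variables (n : nat) (R : realType).
Implicit Types (F : Sigma n -> R) (om : Sigma n) (mu : probability (SigmaM n) R).

Lemma measurable_pword k (w : k.-tuple 'I_n.+1) :
  measurable [set om : SigmaM n | pword om k = w].
Proof. by rewrite -cyl_pword; exact: measurable_cyl. Qed.

Lemma measurable_pword_shiftn t k (w : k.-tuple 'I_n.+1) :
  measurable [set om : SigmaM n | pword (shiftn t om) k = w].
Proof.
rewrite -[X in measurable X]setTI.
exact: (@measurable_shiftn n t measurableT _ (measurable_pword w)).
Qed.

Lemma ucont_bounded F : ucont F -> exists M, forall om, `|F om| <= M.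
Proof.
move=> /(_ 1 ltr01)[k hk].
exists (1 + \sum_(w : k.-tuple 'I_n.+1) `|F (ext w)|) => om.
have h : sprefix om k = sprefix (ext (pword om k)) k.
  by rewrite sprefix_ext_tuple pwordE.
have h1 := hk _ _ h.
have h2 : `|F (ext (pword om k))| <= \sum_(w : k.-tuple 'I_n.+1) `|F (ext w)|.
  by rewrite (bigD1 (pword om k))//= lerDl sumr_ge0.
have : `|F om| <= `|F om - F (ext (pword om k))| + `|F (ext (pword om k))|.
  by rewrite -{1}(subrK (F (ext (pword om k))) (F om)) ler_normD.
lra.
Qed.

Lemma ucont_measurable F : ucont F -> measurable_fun setT (F : SigmaM n -> R).
Proof.
move=> uF; apply/measurable_EFinP.
apply: (emeasurable_fun_cvg (fun k (om : SigmaM n) => (F (ext (pword om k)))%:E)).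
  move=> k; apply/measurable_EFinP => _ Y mY; rewrite setTI.
  have -> : (fun om : SigmaM n => F (ext (pword om k))) @^-1` Y =
      [set om | (fun w : k.-tuple 'I_n.+1 => `[< Y (F (ext w)) >]) (pword om k)].
    by apply/seteqP; split => om /= /asboolP.
  exact: (@measurable_fin_preimage _ (SigmaM n) _ (fun om => pword om k)
    (@measurable_pword k) (fun w => `[< Y (F (ext w)) >])).
move=> om _; apply/cvg_EFin; first exact: nearW.
apply/cvgrPdist_lt => e e0; have [k hk] := uF e e0.
exists k => // l kl; apply: hk; apply: (sprefix_le kl).
by rewrite sprefix_ext_tuple pwordE.
Qed.

Lemma ucont_integrable mu F : ucont F -> mu.-integrable setT (EFin \o F).
Proof.
move=> uF; apply: measurable_bounded_integrable => //.
- by apply: le_lt_trans (ltry 1); rewrite probability_le1.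
- exact: ucont_measurable.
- have [M hM] := ucont_bounded uF.
  by exists M; split; [exact: num_real|move=> x Mx om _; exact: le_trans (hM om) (ltW Mx)].
Qed.

Definition mean mu F : R := fine (\int[mu]_x (F x)%:E)%E.

Lemma meanE mu F : ucont F -> (\int[mu]_x (F x)%:E)%E = (mean mu F)%:E.
Proof.
by move=> uF; rewrite /mean fineK//; exact/integrable_fin_num/ucont_integrable.
Qed.

(** [F] is compared with its value at the reference point of the k-cylinder, whose integral is a
    finite sum. This is how limits of cylinder weights are recognised as integrals. *)
Lemma mean_approx mu F k v : ucont F ->
  (forall om om', sprefix om k = sprefix om' k -> `|F om - F om'| <= v) ->
  `|mean mu F - \sum_(w : k.-tuple 'I_n.+1) pr mu (cyl w) * F (ext w)| <= v.
Proof.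
move=> uF hv.
pose G om := F (ext (pword om k)).
have hG om : `|F om - G om| <= v.
  by apply: hv; rewrite sprefix_ext_tuple pwordE.
have GE : (\int[mu]_x (G x)%:E)%E = (\sum_(w : k.-tuple 'I_n.+1) pr mu (cyl w) * F (ext w))%:E.
  rewrite (@integral_fin_valued _ _ _ mu _ (fun om : SigmaM n => pword om k)
    (@measurable_pword k) (fun w => F (ext w))).
  by congr EFin; apply: eq_bigr => w _; rewrite cyl_pword.
have uG : ucont G.
  move=> e e0; exists k => om om' h; rewrite /G.
  have -> : pword om k = pword om' k by apply: val_inj; rewrite /= !pwordE.
  by rewrite subrr normr0.
have -> : \sum_(w : k.-tuple 'I_n.+1) pr mu (cyl w) * F (ext w) = mean mu G.
  by rewrite /mean GE.
have iF := ucont_integrable mu uF; have iG := ucont_integrable mu uG.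
have uc c : ucont (fun _ => c) by move=> e e0; exists 0%N => *; rewrite subrr normr0.
have hc : mean mu (fun _ => v) = v.
  transitivity (fine (v%:E * mu setT)%E); first by rewrite /mean integral_cst.
  by rewrite probability_setT mule1.
have key F1 F2 : ucont F1 -> ucont F2 -> (forall om, F1 om <= F2 om + v) ->
    mean mu F1 <= mean mu F2 + v.
  move=> u1 u2 h12; rewrite -[X in _ <= _ + X]hc -lee_fin EFinD -!meanE//.
  rewrite -integralD_EFin//; [|exact: ucont_integrable..].
  apply: le_integral => //; first exact: ucont_integrable.
    by apply: (integrableD measurableT); exact: ucont_integrable.
  by move=> x _; rewrite /= -EFinD lee_fin.
have h1 : mean mu F <= mean mu G + v.
  by apply: key => // om; have := hG om; rewrite ler_norml; lra.
have h2 : mean mu G <= mean mu F + v.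
  by apply: key => // om; have := hG om; rewrite ler_norml; lra.
by rewrite ler_norml; lra.
Qed.

Lemma shiftn_invariant mu t : shift_invariant mu ->
  forall D : set (SigmaM n), measurable D -> mu (@shiftn n t @^-1` D) = mu D.
Proof.
move=> inv; elim: t => [|t IH] D mD.
  by congr (mu _); apply/seteqP; split => om; rewrite /preimage /= shiftn0.
have -> : @shiftn n t.+1 @^-1` D = @Defs.shift n @^-1` (@shiftn n t @^-1` D).
  by apply/seteqP; split => om; rewrite /preimage /= shift_shiftn shiftnD addn1.
rewrite inv ?IH//.
by rewrite -[X in measurable X]setTI; exact: (@measurable_shiftn n t measurableT _ mD).
Qed.

Lemma mean_shiftn mu F t : shift_invariant mu -> ucont F ->
  mean mu (fun om => F (shiftn t om)) = mean mu F.
Proof.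
move=> inv uF; rewrite /mean; congr fine.
have mF : measurable_fun setT (EFin \o F : SigmaM n -> \bar R).
  by apply/measurable_EFinP; exact: ucont_measurable.
have -> : (\int[mu]_x (F x)%:E = \int[pushforward mu (@shiftn n t : SigmaM n -> SigmaM n)]_x (F x)%:E)%E.
  apply: eq_measure_integral => [|mS D mD _]; first exact: measurable_shiftn.
  exact: (esym (shiftn_invariant t inv mD)).
rewrite (@integral_pushforward _ _ _ (SigmaM n) _ _ (@measurable_shiftn n t) mu setT (EFin \o F))//.
apply: (@ucont_integrable mu (fun om => F (shiftn t om))).
move=> e e0; have [k hk] := uF e e0; exists (t + k)%N => om om' h.
by apply: hk; exact: sprefix_shiftn.
Qed.

Definition bsum F k om : R := \sum_(i < k) F (shiftn i om).

Lemma bsum_prefix F k l om om' v : (forall j, (j < k)%N -> forall om om', sprefix om (k + l - j) = sprefix om' (k + l - j) -> `|F om - F om'| <= v j) ->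
  sprefix om (k + l) = sprefix om' (k + l) ->
  `|bsum F k om - bsum F k om'| <= \sum_(j < k) v j.
Proof.
move=> h hp; rewrite /bsum -sumrB; apply: le_trans (ler_norm_sum _ _ _) _.
apply: ler_sum => j _; apply: h => //; apply: sprefix_shiftn.
by rewrite subnKC// ltnW// ltn_addr.
Qed.

Lemma ucontD F G : ucont F -> ucont G -> ucont (fun om => F om + G om).
Proof.
move=> uF uG e e0; have [k hk] := uF _ (divr_gt0 e0 (ltr0Sn R 1)).
have [l hl] := uG _ (divr_gt0 e0 (ltr0Sn R 1)).
exists (maxn k l) => om om' h.
have := hk _ _ (sprefix_le (leq_maxl k l) h).
have := hl _ _ (sprefix_le (leq_maxr k l) h).
rewrite !ltr_norml; lra.
Qed.

Lemma ucont_shiftn F t : ucont F -> ucont (fun om => F (shiftn t om)).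
Proof.
move=> uF e e0; have [k hk] := uF e e0; exists (t + k)%N => om om' h.
by apply: hk; exact: sprefix_shiftn.
Qed.

Lemma ucont_bsum F k : ucont F -> ucont (bsum F k).
Proof.
move=> uF; elim: k => [|k IH].
  by move=> e e0; exists 0%N => om om' _; rewrite /bsum !big_ord0 subrr normr0.
have -> : bsum F k.+1 = (fun om => bsum F k om + F (shiftn k om)).
  by apply/funext => om; rewrite /bsum big_ord_recr.
by apply: ucontD => //; exact: ucont_shiftn.
Qed.

Lemma meanD mu F G : ucont F -> ucont G ->
  mean mu (fun om => F om + G om) = mean mu F + mean mu G.
Proof.
move=> uF uG; apply: EFin_inj; rewrite EFinD -!meanE//; last exact: ucontD.
by rewrite -integralD_EFin//; exact: ucont_integrable.
Qed.

Lemma mean_bsum mu F k : shift_invariant mu -> ucont F -> mean mu (bsum F k) = k%:R * mean mu F.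
Proof.
move=> inv uF; elim: k => [|k IH].
  rewrite mul0r /mean (eq_integral (cst 0%E)) ?integral0//.
  by move=> om _; rewrite /bsum big_ord0.
have -> : bsum F k.+1 = (fun om => bsum F k om + F (shiftn k om)).
  by apply/funext => om; rewrite /bsum big_ord_recr.
by rewrite meanD ?IH ?mean_shiftn// -?natr1 ?mulrDl ?mul1r//; [exact: ucont_bsum|exact: ucont_shiftn].
Qed.

Lemma bsum_ucont F e : ucont F -> 0 < e -> exists K, forall k, (K <= k)%N -> forall om om',
  sprefix om k = sprefix om' k -> `|bsum F k om - bsum F k om'| <= e * k%:R.
Proof.
move=> uF e0; have [M hM] := ucont_bounded uF.
have M0 : 0 <= M by apply: le_trans (hM point); exact: normr_ge0.
have [l hl] := uF _ (divr_gt0 e0 (ltr0Sn R 1)).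
have hK : \forall k \near \oo, l%:R * (2 * M) / (e / 2) < k%:R by exact: nbhs_infty_gtr.
have [K _ {}hK] := hK.
exists K => k /hK /= {}hK om om' h.
apply: (@le_trans _ _ (\sum_(j < k) (e / 2 + (if (k <= l + j)%N then 2 * M else 0)))).
  apply: (@bsum_prefix F k 0 om om'
    (fun j => e / 2 + (if (k <= l + j)%N then 2 * M else 0))) => [j jk om1 om2|];
    last by rewrite addn0; exact: h.
  rewrite addn0 => h12; case: leqP => hj.
    have := hM om1; have := hM om2; rewrite !ler_norml; lra.
  rewrite addr0; apply/ltW/hl; apply: sprefix_le h12.
  by rewrite leq_subRL ?(ltnW jk)// addnC ltnW.
rewrite big_split/= sumr_const card_ord -[_ *+ k]mulr_natr.
have : \sum_(j < k) (if (k <= l + j)%N then 2 * M else 0) <= l%:R * (2 * M).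
  rewrite (reindex_inj rev_ord_inj)/=.
  rewrite (eq_bigr (fun j : 'I_k => if (j < l)%N then 2 * M else 0)); last first.
    by move=> j _; congr (if _ then _ else _); have := ltn_ord j; lia.
  rewrite sum_lt_minn -[_ *+ _]mulr_natl ler_wpM2r ?mulr_ge0// ler_nat.
  exact: geq_minr.
move: hK; rewrite ltr_pdivrMr ?divr_gt0// => hK; lra.
Qed.

End OnSigma.

(** * Entropy of partitions *)

Section Approximation.
Variables (n : nat) (R : realType) (mu : probability (SigmaM n) R).
Implicit Types (D E : set (SigmaM n)) (l : nat) (B : seq 'I_n.+1 -> bool).

Definition clopen l B : set (SigmaM n) := [set om | B (sprefix om l)].

Lemma measurable_clopen l B : measurable (clopen l B).
Proof.
have -> : clopen l B = [set om | (fun w : l.-tuple 'I_n.+1 => B w) (pword om l)].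
  by apply/seteqP; split => om /=; rewrite pwordE.
exact: (@measurable_fin_preimage _ (SigmaM n) _ (fun om => pword om l)
    (@measurable_pword n l) (fun w => B w)).
Qed.

Definition sdiff D E := (D `\` E) `|` (E `\` D).

Lemma measurable_sdiff D E : measurable D -> measurable E -> measurable (sdiff D E).
Proof. by move=> mD mE; apply: measurableU; exact: measurableD. Qed.

Definition approximable D := measurable D /\
  forall e : R, 0 < e -> exists l B, pr mu (sdiff D (clopen l B)) < e.

Lemma approximableU D E : approximable D -> approximable E -> approximable (D `|` E).
Proof.
move=> [mD hD] [mE hE]; split; first exact: measurableU.
move=> e e0; have [l [B h]] := hD _ (divr_gt0 e0 (ltr0Sn R 1)).
have [l' [B' h']] := hE _ (divr_gt0 e0 (ltr0Sn R 1)).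
exists (maxn l l'), (fun w => B (take l w) || B' (take l' w)).
apply: le_lt_trans (_ : _ <= pr mu (sdiff D (clopen l B) `|` sdiff E (clopen l' B'))) _.
  apply: le_pr.
  - by apply: measurable_sdiff; [exact: measurableU|exact: measurable_clopen].
  - by apply: measurableU; apply: measurable_sdiff => //; exact: measurable_clopen.
  - move=> om; rewrite /sdiff /clopen /= !take_sprefix ?leq_maxl ?leq_maxr//.
    case=> -[].
      by case=> Dx h1; [left|right]; left; split => //; apply: contra_not h1 => ->; rewrite ?orbT.
    move=> /orP[] Bx h1; [left|right]; right; split => //; apply: contra_not h1; tauto.
apply: le_lt_trans (le_pr_setU _ _ _) _;
  try by apply: measurable_sdiff => //; exact: measurable_clopen.
lra.
Qed.

Lemma approximable0 : approximable set0.
Proof.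
split; first exact: measurable0.
move=> e e0; exists 0%N, (fun _ => false).
have -> : sdiff set0 (clopen 0 (fun=> false)) = set0.
  by apply/seteqP; split => om // [[]|[]].
by rewrite pr0.
Qed.

Lemma approximable_cyl (w : seq 'I_n.+1) : approximable (cyl w).
Proof.
split; first exact: measurable_cyl.
move=> e e0; exists (size w), (fun v => v == w).
have -> : clopen (size w) (fun v => v == w) = cyl w.
  by apply/seteqP; split => om /= /eqP.
by rewrite /sdiff setDv setU0 pr0.
Qed.

(** Continuity of the measure from below reduces a countable union to a finite one, at the cost of
    half of the error. *)
Lemma approximable_sigma_algebra : sigma_algebra setT approximable.
Proof.
split.
- exact: approximable0.
- move=> D [mD hD]; split; first exact: measurableD.
  move=> e /hD[l [B h]]; exists l, (fun w => ~~ B w).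
  apply: le_lt_trans h; apply: le_pr.
  - by apply: measurable_sdiff; [exact: measurableD|exact: measurable_clopen].
  - by apply: measurable_sdiff; [|exact: measurable_clopen].
  - move=> om; rewrite /sdiff /clopen /= => -[[[_ nD] /negP/negPn]|[/negP nB h]].
      by right.
    by left; split => //; apply: contrapT => nD; exact: h.
- move=> F hF; split; first by apply: bigcupT_measurable => i; case: (hF i).
  pose U m := \big[setU/set0]_(i < m) F i.
  have aU m : approximable (U m).
    elim: m => [|m IH]; rewrite /U ?big_ord0 ?big_ord_recr/=; last exact: approximableU.
    exact: approximable0.
  have mF i : measurable (F i) by case: (hF i).
  have mU m : measurable (U m) by case: (aU m).
  have mUF : measurable (\bigcup_i F i) by exact: bigcupT_measurable.
  have UF m : U m `<=` \bigcup_i F i.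
    by rewrite /U -bigcup_mkord => om [i _ Fi]; exists i.
  move=> e e0; have e2 := divr_gt0 e0 (ltr0Sn R 1).
  have cU : (mu \o U) @ \oo --> mu (\bigcup_i F i).
    have <- : \bigcup_m U m = \bigcup_i F i.
      apply/seteqP; split => om; first by case=> m _ /UF.
      by move=> [i _ Fi]; exists i.+1 => //; rewrite /U big_ord_recr/=; right.
    apply: nondecreasing_cvg_mu => //.
      exact: bigcupT_measurable.
    apply/nondecreasing_seqP => m; apply/subsetPset => om h.
    by rewrite /U big_ord_recr/=; left.
  have {}cU : (fun m => pr mu (U m)) @ \oo --> pr mu (\bigcup_i F i).
    apply: fine_cvg; rewrite fineK ?fin_num_measure//.
  have [m _ hm] := proj1 (cvgrPdist_lt _ _) cU _ e2.
  have {hm} := hm m (leqnn _) => /= hm.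
  have [l [B h]] := (aU m).2 _ e2.
  exists l, B.
  apply: le_lt_trans (_ : _ <= pr mu ((\bigcup_i F i `\` U m) `|` sdiff (U m) (clopen l B))) _.
    apply: le_pr.
    - by apply: measurable_sdiff => //; exact: measurable_clopen.
    - by apply: measurableU; [exact: measurableD|apply: measurable_sdiff => //; exact: measurable_clopen].
    - move=> om [[h1 h2]|[h1 h2]].
        by have [h3|h3] := pselect (U m om); [right; left|left].
      by right; right; split => // /UF.
  apply: le_lt_trans (le_pr_setU _ _ _) _.
  - exact: measurableD.
  - by apply: measurable_sdiff => //; exact: measurable_clopen.
  have : pr mu (\bigcup_i F i) = pr mu (U m) + pr mu (\bigcup_i F i `\` U m).
    rewrite -pr_setU//; first by congr pr; rewrite setDUK//.
    - exact: measurableD.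
    - by rewrite setDIK.
  move: hm; rewrite ltr_norml; lra.
Qed.

Lemma measurable_approximable D : measurable D -> approximable D.
Proof.
apply: smallest_sub; first exact: approximable_sigma_algebra.
by move=> _ [k [v ->]]; rewrite cylinder_cyl; exact: approximable_cyl.
Qed.

End Approximation.

Section KolmogorovSinai.
Variables (n : nat) (R : realType) (mu : probability (SigmaM n) R).

Definition Hcyl N : R := rvent mu (fun om : SigmaM n => pword om N).

Lemma HcylE N : Hcyl N = \sum_(w : N.-tuple 'I_n.+1) xlnx (pr mu (cyl w)).
Proof. by apply: eq_bigr => w _; rewrite cyl_pword. Qed.

Lemma ln_prod (I : Type) (r : seq I) (F : I -> R) : (forall i, 0 < F i) ->
  ln (\prod_(i <- r) F i) = \sum_(i <- r) ln (F i).
Proof.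
move=> F0; elim: r => [|i r IH]; first by rewrite !big_nil ln1.
by rewrite !big_cons lnM ?IH// posrE// prodr_gt0.
Qed.

Lemma ler1_sum_guess (K : nat) (j : 'I_K) (th : R) : 0 <= th ->
  \sum_i (if i == j then 1 - th else th / K%:R) <= 1.
Proof.
move=> th0; have K0 : 0 < K%:R :> R by rewrite ltr0n (leq_ltn_trans _ (ltn_ord j)).
apply: (@le_trans _ _ (\sum_(i < K) ((if i == j then 1 - th else 0) + th / K%:R))).
  apply: ler_sum => i _; case: ifP => _; last by rewrite add0r.
  by rewrite lerDl divr_ge0// ltW.
rewrite big_split/= -big_mkcond/= big_pred1_eq sumr_const card_ord -[_ *+ K]mulr_natr.
by rewrite divfK ?gt_eqF// subrK.
Qed.

(* Fano's argument: predict the partition index of [om] from a prefix of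
   length [l] by a guess that errs with small probability. *)
Lemma part_entropy_le_Hcyl K (P : 'I_K -> set (SigmaM n)) (e : R) :
  shift_invariant mu -> is_partition P -> 0 < e ->
  exists l, forall N, part_entropy mu P N <= Hcyl (N + l) + N%:R * e.
Proof.
move=> inv [mP [dP cP]] e0.
have [idx hidx] := choice cP.
have idxE om i : (idx om = i) <-> P i om.
  split=> [<-//|Pi]; apply/eqP; apply/negPn/negP => ne.
  by have /seteqP[/(_ om) h _] := dP _ _ ne; exact: h.
have i0 : 'I_K := idx point.
have K0 : 0 < K%:R :> R by rewrite ltr0n (leq_ltn_trans _ (ltn_ord i0)).
(* With this value a correct guess costs - ln (1 - th) = e/2 exactly. *)
pose th : R := 1 - expR (- (e / 2)).
have th0 : 0 < th by rewrite subr_gt0 expR_lt1; lra.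
have th1 : 0 < 1 - th by rewrite /th opprB addrC subrK expR_gt0.
have lnth : ln (1 - th) = - (e / 2) by rewrite /th opprB addrC subrK expRK.
pose B := `|ln (th / K%:R)|.
have B0 : 0 <= B := normr_ge0 _.
(* A wrong guess costs at most [B] more and has probability at most K dl, so the expected extra cost
   per step is at most e/2. The summand 1 avoids a division by zero when [B] vanishes. *)
pose dl := e / 2 / (K%:R * (B + 1)).
have dl0 : 0 < dl by rewrite !divr_gt0// mulr_gt0//; lra.
have : forall i, exists lB : nat * (seq 'I_n.+1 -> bool),
    pr mu (sdiff (P i) (clopen lB.1 lB.2)) < dl.
  by move=> i; have [_ /(_ _ dl0)[l [b h]]] := measurable_approximable mu (mP i); exists (l, b).
move=> /choice[lB hlB].
pose l := \max_i (lB i).1.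
have ll i : ((lB i).1 <= l)%N by exact: leq_bigmax.
pose g (s : seq 'I_n.+1) := odflt i0 [pick i | (lB i).2 (take (lB i).1 s)].
have gE om k : (l <= k)%N -> g (sprefix om k) = g (sprefix om l).
  move=> lk; rewrite /g; congr odflt; apply: eq_pick => i.
  by rewrite !take_sprefix// (leq_trans (ll i)).
pose wrong : set (SigmaM n) := [set om | idx om != g (sprefix om l)].
have mX i : measurable [set om : SigmaM n | idx om = i].
  by have -> : [set om : SigmaM n | idx om = i] = P i by apply/seteqP; split => om /= /idxE.
have mwrong : measurable wrong.
  have -> : wrong = [set om | (fun z : 'I_K * l.-tuple 'I_n.+1 => z.1 != g z.2) (idx om, pword om l)].
    by apply/seteqP; split => om /=; rewrite pwordE.
  apply: (@measurable_fin_preimage _ (SigmaM n) _ (fun om => (idx om, pword om l)) _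
     (fun z : 'I_K * l.-tuple 'I_n.+1 => z.1 != g z.2)).
  by apply: measurable_pair_eq => //; exact: measurable_pword.
have wrong_le : pr mu wrong <= K%:R * dl.
  (* If the guess is wrong, then either the approximation of the true atom misses the point or that
     of the guessed atom contains it wrongly; if no index qualifies, the true atom was missed. *)
  have sub : wrong `<=` \big[setU/set0]_(i < K) sdiff (P i) (clopen (lB i).1 (lB i).2).
    move=> om; rewrite /wrong /= /g => ne.
    have Pi := hidx om.
    case: pickP ne => [i hi|none] /= ne; last first.
      rewrite (bigD1 (idx om))//=; left; left; split => //.
      by rewrite /clopen /= => h; have := none (idx om); rewrite take_sprefix// h.
    rewrite take_sprefix// in hi; rewrite (bigD1 i)//=; left; right; split => // /idxE h.
    by rewrite h eqxx in ne.
  apply: le_trans (le_pr mu mwrong _ sub) _.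
    by apply: bigsetU_measurable => i _; apply: measurable_sdiff => //; exact: measurable_clopen.
  apply: le_trans (le_pr_bigsetU _ _ _ _) _.
    by move=> i; apply: measurable_sdiff => //; exact: measurable_clopen.
  rewrite -[in leRHS](card_ord K) mulr_natl -sumr_const.
  by apply: ler_sum => i _; exact/ltW/hlB.
exists l => N.
pose X om : {ffun 'I_N -> 'I_K} := [ffun t : 'I_N => idx (shiftn t om)].
pose Y (om : Sigma n) := pword om (N + l).
have mY := @measurable_pword n (N + l).
have XE om a : (X om = a) <-> (forall t : 'I_N, P (a t) (shiftn t om)).
  split=> [<- t|h]; first by rewrite ffunE.
  by apply/ffunP => t; rewrite ffunE; apply/idxE.
have mXN a : measurable [set om : SigmaM n | X om = a].
  have -> : [set om : SigmaM n | X om = a] =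
      \bigcap_(t in [set: 'I_N]) (@shiftn n t @^-1` P (a t)).
    by apply/seteqP; split => om /= => [/XE h t _|h]; [exact: h|apply/XE => t; exact: h].
  apply: fin_bigcap_measurable => // t _.
  by rewrite -[X in measurable X]setTI; exact: (@measurable_shiftn n t measurableT _ (mP _)).
have -> : part_entropy mu P N = rvent mu (X : SigmaM n -> _).
  apply: eq_bigr => a _; congr xlnx; rewrite /pr; congr (fine (mu _)).
  by apply/seteqP; split => om /XE.
pose Z om := (X om, Y om).
have mZ : forall z, measurable [set om : SigmaM n | Z om = z].
  exact: measurable_pair_eq.
apply: le_trans (@rvent_comp _ _ _ mu _ _ (Z : SigmaM n -> _) fst mZ) _.
pose r (i j : 'I_K) := if i == j then 1 - th else th / K%:R.
have r0 i j : 0 < r i j by rewrite /r; case: ifP => // _; rewrite divr_gt0.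
pose rr (z : {ffun 'I_N -> 'I_K} * (N + l).-tuple 'I_n.+1) :=
  \prod_t r (z.1 t) (g (drop t z.2)).
have rr0 z : 0 < rr z by rewrite prodr_gt0.
pose py w := pr mu [set om : SigmaM n | Y om = w].
(* The comparison weight draws the word by its own law and then the N indices independently, each
   concentrated on its guess. The word has N + l letters so that the guess at every time below N can
   read l of them. *)
apply: le_trans (@rvent_gibbs _ _ _ mu _ (Z : SigmaM n -> _)
  (fun z => py z.2 * rr z) mZ _ _ _) _.
- by move=> z; rewrite mulr_ge0 ?pr_ge0// ltW.
- rewrite -(pair_big xpredT xpredT (fun a w => py w * rr (a, w)))/= exchange_big/=.
  apply: (@le_trans _ _ (\sum_w py w)); last by rewrite sum_pr1.
  apply: ler_sum => w _; rewrite -mulr_sumr -[leRHS]mulr1 ler_wpM2l ?pr_ge0//.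
  rewrite /rr /= -(bigA_distr_bigA (fun (t : 'I_N) i => r i (g (drop t w))))/=.
  apply: prodr_ile1 => t _; apply/andP; split.
    by apply: sumr_ge0 => i _; exact: ltW.
  by apply: ler1_sum_guess; exact: ltW.
- move=> [a w] h; rewrite mulr_gt0//; apply: lt_le_trans h _; apply: le_pr => //.
  by move=> om [].
have lnrr z : - ln (rr z) <= N%:R * (e / 2) +
    B * \sum_(t < N) (z.1 t != g (drop t z.2))%:R.
  have -> : - ln (rr z) = \sum_(t < N) - ln (r (z.1 t) (g (drop t z.2))).
    by rewrite sumrN ln_prod.
  rewrite mulr_sumr mulr_natl -[in _ *+ N](card_ord N) -sumr_const -big_split/=.
  apply: ler_sum => t _; rewrite /r; case: eqP => _ /=.
    by rewrite lnth opprK mulr0 addr0.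
  rewrite mulr1; apply: le_trans (ler_norm _) _; rewrite normrN -/B; lra.
rewrite (_ : _ + _ = \sum_z - (pr mu [set om : SigmaM n | Z om = z] * ln (py z.2)) + N%:R * e); last first.
  congr (_ + _); under eq_bigr do rewrite -mulrN.
  rewrite (sum_pr_comp mu snd (fun w => - ln (py w)) mZ).
  by apply: eq_bigr => w _; rewrite mulrN.
apply: (@le_trans _ _ (\sum_z (- (pr mu [set om : SigmaM n | Z om = z] * ln (py z.2)) +
   pr mu [set om : SigmaM n | Z om = z] * (N%:R * (e / 2) +
    B * \sum_(t < N) (z.1 t != g (drop t z.2))%:R)))).
  apply: ler_sum => -[a w] _ /=.
  have := pr_ge0 mu [set om : SigmaM n | Z om = (a, w)].
  rewrite le_eqVlt => /orP[/eqP <-|h]; first by rewrite !mul0r oppr0 addr0.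
  have pw : 0 < py w.
    by apply: lt_le_trans h _; apply: le_pr => // om [].
  rewrite lnM ?posrE// mulrDr opprD lerD2l -mulrN ler_wpM2l ?(ltW h)//.
rewrite big_split/= lerD2l.
under eq_bigr do rewrite mulrDr.
rewrite big_split/= -mulr_suml sum_pr1// mul1r.
have : \sum_z pr mu [set om : SigmaM n | Z om = z] *
    (B * \sum_(t < N) (z.1 t != g (drop t z.2))%:R) <= N%:R * (B * (K%:R * dl)).
  under eq_bigr do rewrite mulrCA mulr_sumr.
  rewrite -mulr_sumr exchange_big/= mulrCA ler_wpM2l//.
  apply: (@le_trans _ _ (\sum_(t < N) (K%:R * dl))); last by rewrite sumr_const card_ord -[leLHS]mulr_natl.
  apply: ler_sum => t _; apply: le_trans wrong_le.
  (* By invariance the guess at time t errs with the same probability as at time 0. *)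
  rewrite -[leRHS](_ : pr mu (@shiftn n t @^-1` wrong) = _); last first.
    by rewrite /pr shiftn_invariant.
  rewrite (_ : @shiftn n t @^-1` wrong =
     [set om | (fun z : {ffun 'I_N -> 'I_K} * (N + l).-tuple 'I_n.+1 =>
        z.1 t != g (drop t z.2)) (Z om)]); last first.
    have dE om : g (drop t (Y om)) = g (sprefix (shiftn t om) l).
      rewrite /Y pwordE -(gE (shiftn t om) (N + l - t)%N); last by have := ltn_ord t; lia.
      by rewrite -drop_sprefix subnKC//; have := ltn_ord t; lia.
    by apply/seteqP; split => om; rewrite /wrong /preimage /= dE ffunE.
  rewrite (@pr_pred _ _ _ mu _ (Z : SigmaM n -> _) (fun z => z.1 t != g (drop t z.2)))//.
  rewrite [leRHS]big_mkcond/=; apply: ler_sum => z _.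
  by case: ifP => _; rewrite ?mulr1 ?mulr0.
have : B * (K%:R * dl) <= e / 2.
  rewrite /dl invfM.
  have -> : B * (K%:R * (e / 2 * (K%:R^-1 / (B + 1)))) = e / 2 * (B / (B + 1)).
    have B1 : B + 1 != 0 by rewrite gt_eqF//; lra.
    have Kn : K%:R != 0 :> R by rewrite gt_eqF.
    by field; rewrite ?B1 ?Kn.
  rewrite -[leRHS]mulr1 ler_wpM2l//; first lra.
  by rewrite ler_pdivrMr; lra.
move=> /(ler_wpM2l (ler0n R N)); lra.
Qed.

End KolmogorovSinai.

(** * Entropy of cylinders and its relation to the entropy of the shift *)

Section CylinderEntropy.
Variables (n : nat) (R : realType) (mu : probability (SigmaM n) R).

Lemma xlnx_ge0 (x : R) : 0 <= x <= 1 -> 0 <= xlnx x.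
Proof.
by move=> /andP[x0 x1]; rewrite /xlnx oppr_ge0 mulr_ge0_le0// ln_le0.
Qed.

Lemma Hcyl_ge0 N : 0 <= Hcyl mu N.
Proof.
apply: sumr_ge0 => w _; apply: xlnx_ge0; rewrite pr_ge0 pr_le1//.
exact: measurable_pword.
Qed.

Lemma Hcyl_subadditive : shift_invariant mu ->
  forall k l, Hcyl mu (k + l) <= Hcyl mu k + Hcyl mu l.
Proof.
move=> inv k l.
pose X (om : SigmaM n) := pword om k; pose Y (om : SigmaM n) := pword (shiftn k om) l.
have mX := @measurable_pword n k.
have mY := @measurable_pword_shiftn n k l.
have -> : Hcyl mu l = rvent mu Y.
  apply: eq_bigr => w _; congr xlnx; apply/esym; rewrite /pr; congr fine.
  exact: (shiftn_invariant k inv (@measurable_pword n l w)).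
apply: le_trans (rvent_pair mu mX mY).
rewrite /Hcyl (_ : (fun om : SigmaM n => pword om (k + l)) =
  (fun uv => cat_tuple uv.1 uv.2) \o (fun om => (X om, Y om))).
  exact: rvent_comp (measurable_pair_eq mX mY).
by apply/funext => om; apply: val_inj; rewrite /= !pwordE sprefix_add.
Qed.

Definition cyl0 (i : 'I_n.+1) : set (SigmaM n) := [set om | om 0%N = i].

Lemma measurable_cyl0 i : measurable (cyl0 i).
Proof.
have -> : cyl0 i = cyl [:: i].
  by apply/seteqP; split => om; rewrite /cyl /cyl0 /sprefix /=; [move=> ->|case].
exact: measurable_cyl.
Qed.

Lemma is_partition_cyl0 : is_partition cyl0.
Proof.
split; first exact: measurable_cyl0.
split; last by move=> om; exists (om 0%N).
by move=> i j ij; apply/seteqP; split => // om []; rewrite /cyl0 /= => -> /eqP; exact/negP.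
Qed.

Lemma part_entropy_cyl0 N : part_entropy mu cyl0 N = Hcyl mu N.
Proof.
rewrite /part_entropy HcylE.
pose tpl (a : {ffun 'I_N -> 'I_n.+1}) : N.-tuple 'I_n.+1 := [tuple a i | i < N].
pose ff (w : N.-tuple 'I_n.+1) : {ffun 'I_N -> 'I_n.+1} := [ffun i => tnth w i].
rewrite [RHS](reindex tpl); last first.
  exists ff => x _; first by apply/ffunP => i; rewrite ffunE tnth_mktuple.
  by apply: eq_from_tnth => i; rewrite tnth_mktuple ffunE.
apply: eq_bigr => a _; congr xlnx; rewrite /pr; congr (fine (mu _)).
rewrite cyl_pword; apply/seteqP; split => om h.
  change (pword om N = tpl a); apply: eq_from_tnth => i; rewrite !tnth_mktuple.
  by have := h i; rewrite /cyl0 /= /shiftn add0n.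
move=> t; have := congr1 (fun w : N.-tuple _ => tnth w t) (h : pword om N = tpl a).
by rewrite !tnth_mktuple /cyl0 /= /shiftn add0n.
Qed.

(** The partition by the first letter alone gives the bound. Subadditivity enters because the bound
    passes to [lim] only for a convergent sequence. *)
Lemma ks_entropy_ge (c : R) : shift_invariant mu ->
  (forall N, (0 < N)%N -> c * N%:R <= Hcyl mu N) -> (c%:E <= ks_entropy mu)%E.
Proof.
move=> inv hc.
apply: le_trans (ereal_sup_ubound _); last first.
  by exists n.+1, cyl0; split; [exact: is_partition_cyl0|reflexivity].
rewrite lee_fin.
have -> : (fun N => part_entropy mu cyl0 N / N%:R) = (fun N => Hcyl mu N / N%:R).
  by apply/funext => N; rewrite part_entropy_cyl0.
apply: limr_ge; first exact: (fekete Hcyl_ge0 (Hcyl_subadditive inv)).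
near=> N; have N0 : (0 < N)%N by near: N; exists 1%N.
by rewrite ler_pdivlMr ?ltr0n// hc.
Unshelve. all: by end_near. Qed.

End CylinderEntropy.

(** * Measures with prescribed cylinder weights *)

(* The measure is the image of Lebesgue measure on [0, 1[ under the coding of its
   points by nested intervals of length [p w]. *)
Section Coding.
Variables (n : nat) (R : realType) (p : seq 'I_n.+1 -> R).
Hypotheses (p_ge0 : forall w, 0 <= p w) (p_nil : p [::] = 1).
Hypothesis p_rcons : forall w, p w = \sum_a p (rcons w a).

Let lft (x : R) (w : seq 'I_n.+1) (a : 'I_n.+1) : R :=
  x + \sum_(b < n.+1 | (b < a)%N) p (rcons w b).

(* The word [w] is coded by the interval [left_end w, left_end w + p w[. *)
Fixpoint rev_left_end (w : seq 'I_n.+1) : R :=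
  if w is a :: v then lft (rev_left_end v) (rev v) a else 0.
Definition left_end w := rev_left_end (rev w).

Lemma left_end_rcons w a : left_end (rcons w a) = left_end w + \sum_(b < n.+1 | (b < a)%N) p (rcons w b).
Proof. by rewrite /left_end rev_rcons /= revK. Qed.

Definition inI w (x : R) := (left_end w <= x) && (x < left_end w + p w).

(** The intervals of the children tile that of the parent: the child sought is the last one before
    the partial sum of lengths first exceeds x. Half-open intervals make words of weight zero
    empty. *)
Lemma inI_child w x : inI w x -> exists a, inI (rcons w a) x.
Proof.
move=> /andP[h1 h2]; pose s k := \sum_(b < n.+1 | (b < k)%N) p (rcons w b).
have sS (a : 'I_n.+1) : s a.+1 = s a + p (rcons w a).
  rewrite /s (bigD1 a)//= addrC; congr (_ + _); apply: eq_bigl => b.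
  by rewrite ltnS ltn_neqAle andbC.
have h0 : exists k, x < left_end w + s k.
  exists n.+1; rewrite /s (eq_bigl xpredT) -?p_rcons// => b; exact: ltn_ord.
pose k := ex_minn h0.
have [k' hk hmin] := ex_minnP h0.
case: k' hk hmin => [|k'] hk hmin.
  by move: hk; rewrite /s big_pred0// addr0 ltNge h1.
have kn : (k' < n.+1)%N.
  rewrite ltnNge; apply/negP => nk; suff : (k' < k')%N by rewrite ltnn.
  apply: hmin; rewrite (_ : s k' = s k'.+1)//; apply: eq_bigl => b.
  by rewrite !(leq_trans (ltn_ord b))// ltnW.
exists (Ordinal kn); rewrite /inI left_end_rcons/= -/(s k').
apply/andP; split; last by rewrite -addrA -(sS (Ordinal kn)).
by rewrite leNgt; apply/negP => /hmin; rewrite ltnn.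
Qed.

Lemma inI_parent w a x : inI (rcons w a) x -> inI w x.
Proof.
rewrite /inI left_end_rcons => /andP[h1 h2].
have h3 : 0 <= \sum_(b < n.+1 | (b < a)%N) p (rcons w b) by exact: sumr_ge0.
have h4 : \sum_(b < n.+1 | (b < a)%N) p (rcons w b) + p (rcons w a) <= p w.
  rewrite [leRHS]p_rcons [leRHS](bigD1 a)//= [leRHS]addrC lerD2r.
  rewrite [leRHS](bigID (fun b : 'I_n.+1 => (b < a)%N))/= -[leLHS]addr0 lerD ?sumr_ge0//.
  by rewrite le_eqVlt; apply/orP; left; apply/eqP; apply: eq_bigl => b;
    case: ltngtP; rewrite ?andbF ?andbT//= => ba; apply/esym/eqP => h; rewrite h ltnn in ba.
apply/andP; split; lra.
Qed.

Lemma inI_inj w a b x : inI (rcons w a) x -> inI (rcons w b) x -> a = b.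
Proof.
wlog ab : a b / (a < b)%N => [hw|].
  by case: (ltngtP a b) => [||/val_inj//] ab ha hb; [|apply/esym]; exact: hw.
rewrite /inI !left_end_rcons => /andP[h1 h2] /andP[h3 h4].
have : \sum_(c < n.+1 | (c < a)%N) p (rcons w c) + p (rcons w a) <=
    \sum_(c < n.+1 | (c < b)%N) p (rcons w c).
  rewrite [leRHS](bigD1 a)//= [leRHS]addrC lerD2r.
  rewrite [leRHS](bigID (fun c : 'I_n.+1 => (c < a)%N))/= -[leLHS]addr0 lerD ?sumr_ge0//.
  rewrite le_eqVlt; apply/orP; left; apply/eqP; apply: eq_bigl => c.
  case: (ltnP c a) => ca; rewrite ?andbF// andbT (ltn_trans ca ab)/=.
  by apply/esym/eqP => h; rewrite h ltnn in ca.
by move=> ?; exfalso; lra.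
Qed.

(** The default letter is reached only for x outside the interval of [w], so never along the coding
    of a point of [0, 1[. *)
Definition next w x : 'I_n.+1 := odflt ord0 [pick a | inI (rcons w a) x].

Fixpoint code_word (x : R) k : seq 'I_n.+1 :=
  if k is k'.+1 then rcons (code_word x k') (next (code_word x k') x) else [::].

Definition code (x : R) : Sigma n := fun k => next (code_word x k) x.

Lemma sprefix_code x k : sprefix (code x) k = code_word x k.
Proof. by elim: k => // k IH; rewrite sprefixS IH. Qed.

Lemma inI_code x k w : 0 <= x < 1 -> size w = k -> inI w x <-> code_word x k = w.
Proof.
move=> x01; elim: k w => [|k IH] w.
  by move=> /size0nil ->; rewrite /inI /left_end/= p_nil add0r x01.
elim/last_ind: w => // w a _; rewrite size_rcons => -[sw]; split=> [h|/=].
  have hw := (IH w sw).1 (inI_parent h); rewrite /= hw; congr rcons.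
  rewrite /next; case: pickP => [b hb|none]; last by rewrite none in h.
  exact: inI_inj hb h.
move=> /rcons_inj[h1 h2].
have hw : inI w x by apply/IH.
move: h2; rewrite h1 /next; case: pickP => [b hb /= <-//|none].
by have [b hb] := inI_child hw; rewrite none in hb.
Qed.

Lemma inI01 w x : inI w x -> 0 <= x < 1.
Proof.
elim/last_ind: w => [|w a IH]; first by rewrite /inI /left_end /= p_nil add0r.
by move=> /inI_parent.
Qed.

Lemma inI_itv w : [set x | inI w x] = `[left_end w, left_end w + p w[%classic.
Proof. by apply/seteqP; split => x /=; rewrite in_itv. Qed.

Lemma measurable_inI w : measurable [set x | inI w x].
Proof. by rewrite inI_itv; exact: measurable_itv. Qed.

Lemma measurable_next w a : measurable [set x | next w x = a].
Proof.
pose X x : {ffun 'I_n.+1 -> bool} := [ffun b => inI (rcons w b) x].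
have mX f : measurable [set x | X x = f].
  have -> : [set x | X x = f] =
      \bigcap_(b in [set: 'I_n.+1]) [set x | inI (rcons w b) x = f b].
    apply/seteqP; split => x /=; first by move=> <- b _; rewrite ffunE.
    by move=> h; apply/ffunP => b; rewrite ffunE h.
  apply: fin_bigcap_measurable => // b _; case: (f b); first exact: measurable_inI.
  have -> : [set x | inI (rcons w b) x = false] = ~` [set x | inI (rcons w b) x].
    by apply/seteqP; split => x /=; [move=> ->|move/negP/negbTE].
  by apply: measurableC; exact: measurable_inI.
have -> : [set x | next w x = a] =
    [set x | (fun f : {ffun 'I_n.+1 -> bool} => odflt ord0 [pick b | f b] == a) (X x)].
  have nE x : next w x = odflt ord0 [pick b | X x b].
    by rewrite /next; congr odflt; apply: eq_pick => b; rewrite ffunE.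
  by apply/seteqP; split => x /=; rewrite nE => /eqP.
exact: (measurable_fin_preimage mX (fun f : {ffun 'I_n.+1 -> bool} => odflt ord0 [pick b | f b] == a)).
Qed.

Lemma measurable_code_word k w : measurable [set x | code_word x k = w].
Proof.
elim: k w => [|k IH] w /=.
  have [->|ne] := eqVneq w [::]; first by rewrite (_ : mkset _ = setT)//; apply/seteqP.
  by rewrite (_ : mkset _ = set0)//; apply/seteqP; split => // x /= h; rewrite -h in ne.
case/lastP: w => [|w a].
  rewrite (_ : mkset _ = set0)//; apply/seteqP; split => // x /= /(congr1 size).
  by rewrite size_rcons.
rewrite (_ : mkset _ = [set x | code_word x k = w] `&` [set x | next w x = a]).
  by apply: measurableI => //; exact: measurable_next.
apply/seteqP; split => x /=; first by move=> /rcons_inj[<- <-].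
by move=> [-> ->].
Qed.

Lemma measurable_code : measurable_fun setT (code : R -> SigmaM n).
Proof.
apply: (@measurability _ _ R (SigmaM n) setT _ (@cylinders n)) => //.
move=> _ [_ [l [w ->]] <-]; rewrite setTI cylinder_cyl.
have -> : code @^-1` cyl (codom w) = [set x | code_word x (size (codom w)) = codom w].
  by apply/seteqP; split => x; rewrite /preimage /cyl /= sprefix_code.
exact: measurable_code_word.
Qed.

Let mI : measurable (`[0, 1[%classic : set R). Proof. exact: measurable_itv. Qed.

Definition code_prob : set (SigmaM n) -> \bar R :=
  pushforward (mrestr (@lebesgue_measure R) mI) (code : measurableTypeR R -> SigmaM n).

Lemma code_prob_cyl w : code_prob (cyl w) = (p w)%:E.
Proof.
rewrite /code_prob /pushforward /mrestr.
rewrite (_ : _ `&` _ = [set x | inI w x]).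
  rewrite inI_itv lebesgue_measure_itv/= lte_fin; case: ifPn => h.
    by rewrite -EFinD addrAC subrr add0r.
  congr EFin; apply/eqP; rewrite eq_le p_ge0 /= leNgt; apply: contra h; lra.
apply/seteqP; split => x; rewrite /preimage /cyl /= in_itv/= sprefix_code.
  by move=> [h x01]; apply/(inI_code x01 erefl).
by move=> h; have x01 := inI01 h; split => //; apply/(inI_code x01 erefl).
Qed.

Let code_prob_measure : {measure set (SigmaM n) -> \bar R} :=
  @measure_function_pushforward__canonical__measure_function_Measure _ _ _ _ _
    (mrestr (@lebesgue_measure R) mI) (code : measurableTypeR R -> SigmaM n) measurable_code.

Let code_prob0 : code_prob set0 = 0%E.
Proof. exact: (measure0 code_prob_measure). Qed.
Let code_prob_ge0 D : (0 <= code_prob D)%E.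
Proof. exact: (measure_ge0 code_prob_measure). Qed.
Let code_prob_sigma_additive : semi_sigma_additive code_prob.
Proof. exact: (@measure_semi_sigma_additive _ _ _ code_prob_measure). Qed.

HB.instance Definition _ := isMeasure.Build _ _ _ code_prob
  code_prob0 code_prob_ge0 code_prob_sigma_additive.

Let code_probT : code_prob setT = 1%E.
Proof.
rewrite -p_nil -code_prob_cyl; congr code_prob; apply/seteqP; split => // om.
Qed.

HB.instance Definition _ := @Measure_isProbability.Build _ _ R code_prob code_probT.

Lemma coding_probability : exists mu : probability (SigmaM n) R,
  forall w, pr mu (cyl w) = p w.
Proof.
exists code_prob => w; transitivity (fine (code_prob (cyl w))) => //.
by rewrite code_prob_cyl.
Qed.

End Coding.

Section Invariance.
Variables (n : nat) (R : realType) (mu : probability (SigmaM n) R).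

Lemma cyl_sub (w w' : seq 'I_n.+1) om : (size w <= size w')%N ->
  cyl w om -> cyl w' om -> cyl w' `<=` cyl w.
Proof.
move=> ww hw hw' om' h'; rewrite /cyl /= -{2}hw.
by apply: (sprefix_le ww); rewrite h' hw'.
Qed.

Lemma cylI (w w' : seq 'I_n.+1) : (size w <= size w')%N ->
  cyl w `&` cyl w' = set0 \/ cyl w `&` cyl w' = cyl w'.
Proof.
move=> ww; have [->|/set0P[om [h h']]] := eqVneq (cyl w `&` cyl w') set0; first by left.
by right; apply/setIidr; exact: cyl_sub h h'.
Qed.

(** Two cylinders are nested or disjoint, so the cylinders and the empty set are stable under
    intersection and a measure is determined by its values on them. The preimage of a cylinder under
    the shift splits by its first letter. *)
Lemma shift_invariant_cyl :
  (forall w, pr mu (cyl w) = \sum_a pr mu (cyl (a :: w))) -> shift_invariant mu.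
Proof.
move=> hp.
have ms : measurable_fun setT (@Defs.shift n : SigmaM n -> SigmaM n).
  have -> : @Defs.shift n = shiftn 1 by apply/funext => om; exact: shift_shiftn.
  exact: measurable_shiftn.
pose G := [set C : set (SigmaM n) | C = set0 \/ exists w, C = cyl w].
have GT : G setT.
  by right; exists [::]; apply/seteqP; split.
suff h D : <<s G >> D ->
    (pushforward mu (@Defs.shift n : SigmaM n -> SigmaM n) : set (SigmaM n) -> \bar R) D = mu D.
  move=> D mD; apply: h; move: D mD; apply: smallest_sub.
    exact: smallest_sigma_algebra.
  move=> C [k [v ->]]; apply: sub_gen_smallest; right.
  by exists (codom v); rewrite cylinder_cyl.
apply: (@g_sigma_algebra_measure_unique _ R (SigmaM n) G _ (fun=> setT)).
- by move=> C [->|[w ->]]; [exact: measurable0|exact: measurable_cyl].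
- by move=> _; exact: GT.
- by apply/seteqP; split => // om _; exists 0%N.
- move=> C C' [->|[w ->]]; first by rewrite set0I; left.
  move=> [->|[w' ->]]; first by rewrite setI0; left.
  case/orP: (leq_total (size w) (size w')) => ww.
    by case: (cylI ww) => ->; [left|right; exists w'].
  by rewrite setIC; case: (cylI ww) => ->; [left|right; exists w].
- move=> C [->|[w ->]]; first by rewrite !measure0.
  rewrite /= /pushforward.
  transitivity (pr mu (@Defs.shift n @^-1` cyl w))%:E.
    by rewrite prE// -[X in measurable X]setTI; apply: ms => //; exact: measurable_cyl.
  rewrite -(_ : (pr mu (cyl w))%:E = mu (cyl w)); last by rewrite prE//; exact: measurable_cyl.
  congr EFin; rewrite hp.
  have m0 (a : 'I_n.+1) : measurable [set om : SigmaM n | om 0%N = a].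
    have -> : [set om : SigmaM n | om 0%N = a] = cyl [:: a].
      by apply/seteqP; split => om; rewrite /cyl /sprefix /=; [move=> ->|case].
    exact: measurable_cyl.
  rewrite (pr_sum mu m0).
    apply: eq_bigr => a _; congr pr; apply/seteqP; split => om /=.
      rewrite /cyl /preimage /= => -[h1 h2]; rewrite -[(size w).+1]add1n sprefix_add.
      by rewrite -shift_shiftn h1 /sprefix /= h2.
    rewrite /cyl /preimage /= -[(size w).+1]add1n sprefix_add -shift_shiftn /= => -[h1 h2].
    by split.
  by rewrite -[X in measurable X]setTI; apply: ms => //; exact: measurable_cyl.
- by move=> _; rewrite /= /pushforward preimage_setT probability_setT ltry.
Qed.

End Invariance.

(** * Geometry of the maps *)

Section Interval.
Variable R : realType.
Implicit Types (f D : R -> R).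

Lemma I01_itv : I01 = `[0, 1]%classic :> set R.
Proof. by apply/seteqP; split => x; rewrite /I01 /= in_itv. Qed.

Lemma within_cont_dist f (A : set R) : {within A, continuous f} -> forall x (e : R),
  A x -> 0 < e -> exists2 d : R, 0 < d & forall y, A y -> `|y - x| < d -> `|f y - f x| < e.
Proof.
move=> /subspace_continuousP cf x e Ax e0.
have /cvgrPdist_lt/(_ e e0)[d /= d0 hd] := cf x Ax.
exists d => // y Ay yx; rewrite distrC; apply: hd => //=.
by rewrite distrC.
Qed.

(** Pairs violating uniformity at scale 1/(k+1) cluster at a point of [0, 1], where continuity would
    fail. *)
Lemma unif_cont01 f :
  (forall x (e : R), I01 x -> 0 < e ->
    exists2 d : R, 0 < d & forall y, I01 y -> `|y - x| < d -> `|f y - f x| < e) ->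
  forall e : R, 0 < e -> exists2 d : R, 0 < d &
    forall x y, I01 x -> I01 y -> `|x - y| < d -> `|f x - f y| < e.
Proof.
move=> cf e e0; apply: contrapT => nh.
have h (k : nat) : exists xy : R * R, [/\ I01 xy.1, I01 xy.2, `|xy.1 - xy.2| < k.+1%:R^-1 &
    e <= `|f xy.1 - f xy.2| ].
  apply: contrapT => hk; apply: nh; exists k.+1%:R^-1; first by rewrite invr_gt0.
  move=> x y Ix Iy xy; rewrite ltNge; apply/negP => exy; apply: hk; by exists (x, y).
have {h}[z hz] := choice h.
have cI : compact (I01 : set R) by rewrite I01_itv; exact: segment_compact.
have [p [Ip cp]] : I01 `&` cluster ((fun k => (z k).1) @ \oo) !=set0.
  by apply: cI; exists 0%N => // k _; case: (hz k).
have [d d0 hd] := cf p (e / 2) Ip (divr_gt0 e0 (ltr0Sn R 1)).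
have hN : \forall k \near \oo, 2 / d < k%:R by exact: nbhs_infty_gtr.
have [N _ {}hN] := hN.
have [||x [[k /= Nk <-] /= xp]] :=
    cp [set (z k).1 | k in [set k | (N <= k)%N]] (ball p (d / 2)).
- by exists N => // k Nk; exists k.
- by apply: nbhsx_ballx; rewrite divr_gt0.
have [I1 I2 h12 he] := hz k.
have kd : k.+1%:R^-1 < d / 2.
  have /= := hN k Nk; rewrite ltr_pdivrMr// => hk.
  rewrite -[ltLHS]mul1r ltr_pdivrMr ?ltr0n// -(natr1 k); nra.
rewrite /ball /= in xp.
have h1 : `|f (z k).1 - f p| < e / 2.
  by apply: hd => //; rewrite distrC; lra.
have h2 : `|f (z k).2 - f p| < e / 2.
  apply: hd => //; move: xp h12 kd; rewrite !ltr_norml; move: (k.+1%:R^-1) => q; lra.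
move: he; apply/negP; rewrite -ltNge.
move: h1 h2; rewrite !ltr_norml; lra.
Qed.

Lemma C1_quotient f D x (e : R) : C1_on01 f D -> I01 x -> 0 < e ->
  exists2 d : R, 0 < d & forall y, I01 y -> y != x -> `|y - x| < d ->
    `|(f y - f x) / (y - x) - D x| < e.
Proof.
move=> [_ hD] Ix e0; have /cvgrPdist_lt/(_ e e0)[d /= d0 hd] := hD x Ix.
exists d => // y Iy yx h; rewrite distrC; apply: hd => /=; first by rewrite distrC.
by split => //; exact/eqP.
Qed.

Lemma C1_continuous f D : C1_on01 f D -> {within I01, continuous f}.
Proof.
move=> C; apply/subspace_continuousP => x Ix; apply/cvgrPdist_lt => e e0.
have [d d0 hd] := C1_quotient C Ix ltr01.
pose K := `|D x| + 1.
have K0 : 0 < K by rewrite ltr_wpDl.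
exists (Num.min d (e / K)); first by rewrite /= lt_min d0 divr_gt0.
move=> y /=; rewrite lt_min distrC => /andP[h1 h2] Iy; rewrite distrC.
have [->|yx] := eqVneq y x; first by rewrite subrr normr0.
have h3 := hd y Iy yx h1.
have yx0 : y - x != 0 by rewrite subr_eq0.
have -> : f y - f x = (f y - f x) / (y - x) * (y - x) by rewrite divfK.
rewrite normrM.
have h4 : `|(f y - f x) / (y - x)| < K.
  have := ler_normD ((f y - f x) / (y - x) - D x) (D x).
  rewrite subrK /K; lra.
rewrite ltr_pdivlMr// in h2.
apply: le_lt_trans h2; rewrite mulrC ler_wpM2l//; exact: ltW.
Qed.

Lemma C1_is_derive f D (x : R) : C1_on01 f D -> 0 < x < 1 -> is_derive x 1 f (D x).
Proof.
move=> C /andP[x0 x1].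
have Ix : I01 x by rewrite /I01 /= !ltW.
have cv : (fun h : R => h^-1 *: ((f \o shift x) (h *: (1 : R)) - f x)) @ 0^' --> D x.
  apply/cvgrPdist_lt => e e0; have [d d0 hd] := C1_quotient C Ix e0.
  exists (Num.min d (Num.min x (1 - x))); first by rewrite /= !lt_min d0 x0 subr_gt0.
  move=> h /=; rewrite sub0r normrN !lt_min => /and3P[h1 h2 h3] h0.
  rewrite distrC /shift /= -[h *: 1]/(h * 1) mulr1 -[_ *: _]/(_ * _) mulrC.
  have -> : h = (h + x) - x by rewrite addrK.
  rewrite subrK; apply: hd.
  - rewrite /I01 /=; move: h2 h3; rewrite !ltr_norml; lra.
  - by rewrite -subr_eq0 addrK.
  - by rewrite addrK.
apply: DeriveDef; first by apply/cvg_ex; exists (D x).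
exact: cvg_lim.
Qed.

Lemma C1_MVT f D (a b : R) : C1_on01 f D -> 0 <= a -> a < b -> b <= 1 ->
  exists2 c, a <= c <= b & f b - f a = D c * (b - a).
Proof.
move=> C a0 ab b1; have [||c] := @MVT R f D a b ab.
- move=> x; rewrite in_itv /= => /andP[ax xb]; apply: C1_is_derive => //.
  by rewrite (le_lt_trans a0 ax) (lt_le_trans xb b1).
- apply: continuous_subspaceW (C1_continuous C).
  by move=> x; rewrite /= in_itv /= /I01 /= => /andP[ax xb]; rewrite (le_trans a0 ax) (le_trans xb b1).
- by rewrite in_itv /= => /andP[ac cb] h; exists c => //; rewrite !ltW.
Qed.

End Interval.

Section IteratedFunctionSystem.
Variables (R : realType) (n : nat) (T T' : 'I_n.+1 -> R -> R).
Hypothesis hTmap : forall i x, I01 x -> I01 (T i x).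
Hypothesis hC1 : forall i, C1_on01 (T i) (T' i).
Hypothesis hpos : forall i x, I01 x -> 0 < T' i x.
Implicit Types (w u v : seq 'I_n.+1) (om : Sigma n) (x y : R).

Lemma I01_0 : I01 (0 : R). Proof. by rewrite /I01 /= lexx ler01. Qed.
Lemma I01_1 : I01 (1 : R). Proof. by rewrite /I01 /= lexx ler01. Qed.

Lemma T_MVT i x y : I01 x -> I01 y -> x < y ->
  exists2 c, x <= c <= y & T i y - T i x = T' i c * (y - x).
Proof. by move=> /andP[x0 _] /andP[_ y1] xy; exact: (C1_MVT (hC1 i)). Qed.

Lemma T_lt i x y : I01 x -> I01 y -> x < y -> T i x < T i y.
Proof.
move=> Ix Iy xy; have [c /andP[xc cy] h] := T_MVT i Ix Iy xy.
rewrite -subr_gt0 h mulr_gt0// ?subr_gt0//; apply: hpos.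
by move: Ix Iy; rewrite /I01 /=; lra.
Qed.

Lemma T_le i x y : I01 x -> I01 y -> x <= y -> T i x <= T i y.
Proof.
by move=> Ix Iy; rewrite le_eqVlt => /predU1P[->//|xy]; exact/ltW/T_lt.
Qed.

Lemma compw_cat u v x : compw T (u ++ v) x = compw T u (compw T v x).
Proof. by elim: u => //= a u IH; rewrite IH. Qed.

Lemma compw_I01 w x : I01 x -> I01 (compw T w x).
Proof. by elim: w => //= a w IH Ix; apply/hTmap/IH. Qed.

Lemma compw_lt w x y : I01 x -> I01 y -> x < y -> compw T w x < compw T w y.
Proof. by elim: w => //= a w IH Ix Iy xy; apply: T_lt; [exact: compw_I01..|exact: IH]. Qed.

Lemma compw_le w x y : I01 x -> I01 y -> x <= y -> compw T w x <= compw T w y.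
Proof.
by move=> Ix Iy; rewrite le_eqVlt => /predU1P[->//|xy]; exact/ltW/compw_lt.
Qed.

Definition lo w : R := compw T w 0.
Definition hi w : R := compw T w 1.
Definition len w : R := hi w - lo w.

Lemma len_gt0 w : 0 < len w.
Proof. by rewrite subr_gt0; apply: compw_lt; [exact: I01_0|exact: I01_1|exact: ltr01]. Qed.

Lemma lo_I01 w : I01 (lo w). Proof. exact/compw_I01/I01_0. Qed.
Lemma hi_I01 w : I01 (hi w). Proof. exact/compw_I01/I01_1. Qed.

Lemma lo_cat u v : lo u <= lo (u ++ v).
Proof.
rewrite /lo compw_cat; apply: compw_le; [exact: I01_0|exact: lo_I01|].
by have /andP[] := lo_I01 v.
Qed.

Lemma hi_cat u v : hi (u ++ v) <= hi u.
Proof.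
rewrite /hi compw_cat; apply: compw_le; [exact: hi_I01|exact: I01_1|].
by have /andP[] := hi_I01 v.
Qed.

Lemma projPi_cvg om : cvgn (fun k => compw T (sprefix om k) 0).
Proof.
apply: nondecreasing_is_cvgn.
  by apply/nondecreasing_seqP => k; rewrite sprefixS -cats1; exact: lo_cat.
by exists 1 => _ [k _ <-]; have /andP[] := lo_I01 (sprefix om k).
Qed.

Lemma projPi_between om k : lo (sprefix om k) <= projPi T om <= hi (sprefix om k).
Proof.
apply/andP; split.
  apply: limr_ge; first exact: projPi_cvg.
  by exists k => // l /= kl; rewrite -(subnKC kl) sprefix_add; exact: lo_cat.
apply: limr_le; first exact: projPi_cvg.
exists k => // l /= kl; rewrite -(subnKC kl) sprefix_add.
apply: le_trans (hi_cat _ (sprefix (shiftn k om) (l - k))).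
by rewrite -subr_ge0 ltW// len_gt0.
Qed.

Lemma projPi_I01 om : I01 (projPi T om).
Proof. by have := projPi_between om 0. Qed.

Hypothesis hdisj : forall i j : 'I_n.+1, i != j -> T i @` I01o `&` T j @` I01o = set0.

Lemma T_onto i y : T i 0 < y -> y < T i 1 -> (T i @` I01o) y.
Proof.
move=> h0 h1.
have cT : {within `[0, 1], continuous (T i)}.
  by rewrite -I01_itv; exact: C1_continuous (hC1 i).
have [|x] := IVT ler01 cT (v := y).
  by rewrite ge_min le_max (ltW h0) (ltW h1) orbT.
rewrite in_itv /= => /andP[x0 x1] hx; exists x => //.
rewrite /I01o /= !lt_neqAle x0 x1 !andbT; apply/andP; split; apply/eqP => h.
  by move: h0; rewrite -hx -h ltxx.
by move: h1; rewrite -hx h ltxx.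
Qed.

(** If neither order held, the two image intervals would overlap in a nondegenerate interval, and by
    the intermediate value theorem its midpoint would lie in both open images. *)
Lemma T_separated i j : i != j -> T i 1 <= T j 0 \/ T j 1 <= T i 0.
Proof.
move=> ij; have [h|h1] := leP (T i 1) (T j 0); first by left.
have [h|h2] := leP (T j 1) (T i 0); first by right.
exfalso.
have hi0 : T i 0 < T i 1 by apply: T_lt; [exact: I01_0|exact: I01_1|exact: ltr01].
have hj0 : T j 0 < T j 1 by apply: T_lt; [exact: I01_0|exact: I01_1|exact: ltr01].
pose a := Num.max (T i 0) (T j 0); pose b := Num.min (T i 1) (T j 1).
have ab : a < b by rewrite /a /b gt_max !lt_min hi0 hj0 h1 h2.
have ai : T i 0 <= a by rewrite le_max lexx.
have aj : T j 0 <= a by rewrite le_max lexx orbT.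
have bi : b <= T i 1 by rewrite ge_min lexx.
have bj : b <= T j 1 by rewrite ge_min lexx orbT.
have /seteqP[/(_ ((a + b) / 2)) h _] := hdisj ij.
by apply: h; split; apply: T_onto; lra.
Qed.

(** Common first letters are stripped by monotonicity; the first differing letter separates. The
    inequalities cannot be strict, since neighbouring intervals may share an endpoint. *)
Lemma words_separated u v : size u = size v -> u != v -> hi u <= lo v \/ hi v <= lo u.
Proof.
elim: u v => [|a u IH] [|b v]//= [suv].
rewrite eqseq_cons negb_and; have [->/=|ab _] := eqVneq a b.
  move=> /(IH _ suv)[h|h]; [left|right]; apply: T_le => //;
    by [exact: hi_I01|exact: lo_I01].
case: (T_separated ab) => h; [left|right].
  apply: le_trans (_ : T a 1 <= _); first by apply: T_le; [exact: hi_I01|exact: I01_1|case/andP: (hi_I01 u)].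
  apply: le_trans h _; by apply: T_le; [exact: I01_0|exact: lo_I01|case/andP: (lo_I01 v)].
apply: le_trans (_ : T b 1 <= _); first by apply: T_le; [exact: hi_I01|exact: I01_1|case/andP: (hi_I01 v)].
apply: le_trans h _; by apply: T_le; [exact: I01_0|exact: lo_I01|case/andP: (lo_I01 u)].
Qed.

Hypothesis hdiam : forall e : R, 0 < e -> exists N : nat, forall k, (N <= k)%N ->
     forall om : Sigma n, (diamE (compw T (sprefix om k) @` I01) < e%:E)%E.

Lemma len_small (e : R) : 0 < e -> exists N, forall w, (N <= size w)%N -> len w < e.
Proof.
move=> /hdiam[N hN]; exists N => w Nw.
rewrite -lte_fin; have := hN _ Nw (ext w); rewrite sprefix_ext; apply: le_lt_trans.
apply: le_trans (_ : ((`|hi w - lo w|)%:E <= _)%E).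
  by rewrite lee_fin ler_norm.
apply: ereal_sup_ubound; right; exists (hi w), (lo w); split; last split => //.
  by exists 1 => //; exact: I01_1.
by exists 0 => //; exact: I01_0.
Qed.

Lemma lnT'_unif (e : R) : 0 < e -> exists2 d : R, 0 < d & forall i x y, I01 x -> I01 y ->
  `|x - y| < d -> `|ln (T' i x) - ln (T' i y)| < e.
Proof.
move=> e0.
have h i : exists d : R, 0 < d /\ forall x y, I01 x -> I01 y ->
    `|x - y| < d -> `|ln (T' i x) - ln (T' i y)| < e.
  have [|d d0 hd] := @unif_cont01 R (fun x => ln (T' i x)) _ e e0; last by exists d.
  move=> x a Ix a0.
  have /cvgrPdist_lt/(_ a a0)[b /= b0 hb] := continuous_ln (hpos i Ix).
  have [d d0 hd] := within_cont_dist (hC1 i).1 Ix b0.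
  exists d => // y Iy yx; rewrite distrC; apply: hb => /=; rewrite distrC; exact: hd.
have [d hd] := choice h.
exists (\big[Num.min/1]_i d i).
  apply: (big_ind (fun z => 0 < z)) => // [a b ha hb|i _]; first by rewrite lt_min ha.
  by case: (hd i).
move=> i x y Ix Iy xy; apply: (hd i).2 => //; apply: lt_le_trans xy _.
exact: bigmin_le_cond.
Qed.

Lemma lnT'_bounded : exists M : R, forall i x y, I01 x -> I01 y ->
  `|ln (T' i x) - ln (T' i y)| <= M.
Proof.
have h i : exists M : R, forall x y, I01 x -> I01 y -> `|ln (T' i x) - ln (T' i y)| <= M.
  have cT : {within `[0, 1], continuous (T' i)} by rewrite -I01_itv; exact: (hC1 i).1.
  have [c c01 hc] := EVT_max ler01 cT; have [b b01 hb] := EVT_min ler01 cT.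
  have Ib : I01 b by move: b01; rewrite in_itv.
  have Ic : I01 c by move: c01; rewrite in_itv.
  exists (ln (T' i c) - ln (T' i b)) => x y Ix Iy.
  have hh z : I01 z -> ln (T' i b) <= ln (T' i z) <= ln (T' i c).
    move=> Iz; have z01 : z \in `[0, 1] by rewrite in_itv.
    by apply/andP; split; rewrite ler_ln ?posrE ?hpos//; [exact: hb|exact: hc].
  by have := hh x Ix; have := hh y Iy; rewrite ler_norml; lra.
have [M hM] := choice h.
exists (\sum_i `|M i|) => i x y Ix Iy; apply: le_trans (hM i x y Ix Iy) _.
by rewrite (bigD1 i)//= (le_trans (ler_norm _))// lerDl sumr_ge0.
Qed.

(** Points with a common prefix project into a common short interval, on which ln T' is nearly
    constant. The prefix needs one more letter than the interval because [geom] evaluates the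
    derivative at the shifted point. *)
Lemma ucont_geom : ucont (geom T T').
Proof.
move=> e e0; have [d d0 hd] := lnT'_unif e0.
have [N hN] := len_small d0.
exists N.+1 => om om' h; rewrite /geom.
have -> : om 0%N = om' 0%N by apply: (proj2 (sprefixP _ _ _) h).
have {}h : sprefix (Defs.shift om) N = sprefix (Defs.shift om') N.
  by rewrite !shift_shiftn; apply: sprefix_shiftn; rewrite add1n.
rewrite opprK addrC; apply: hd; try exact: projPi_I01.
have := projPi_between (Defs.shift om) N; have := projPi_between (Defs.shift om') N.
have := hN (sprefix (Defs.shift om) N); rewrite size_sprefix h /len => /(_ (leqnn _)).
by rewrite ltr_norml; lra.
Qed.

Lemma len_cons a v : exists2 c, lo v <= c <= hi v & len (a :: v) = T' a c * len v.
Proof.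
have h : lo v < hi v by rewrite -subr_gt0; exact: len_gt0.
by have [c hc h'] := T_MVT a (lo_I01 v) (hi_I01 v) h; exists c.
Qed.

(* Each step of the telescoped product [len w = T'_{w_1}(c_1) T'_{w_2}(c_2) ...]
   distorts by the oscillation of [ln T'] on a cylinder interval. *)
Lemma len_distortion (e : R) : 0 < e -> exists N, forall k, (N <= k)%N -> forall om,
  `|ln (len (sprefix om k)) + bsum (geom T T') k om| <= e * k%:R.
Proof.
move=> e0; have e2 := divr_gt0 e0 (ltr0Sn R 1).
have [d d0 hd] := lnT'_unif e2.
have [L hL] := len_small d0.
have [M hM] := lnT'_bounded.
have M0 : 0 <= M by apply: le_trans (hM ord0 0 0 I01_0 I01_0); exact: normr_ge0.
(* [m l] bounds the error of the step at which l letters remain: it is small once the remaining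
   interval is short, and only the L shortest words need the crude bound [M]. *)
pose m l : R := e / 2 + if (l < L)%N then M else 0.
have key k om : `|ln (len (sprefix om k)) + bsum (geom T T') k om| <= \sum_(l < k) m l.
  elim: k om => [|k IH] om.
    by rewrite /bsum !big_ord0 addr0 /sprefix /len /hi /lo /= subr0 ln1 normr0.
  rewrite big_ord_recr/= /bsum big_ord_recl/= shiftn0.
  have -> : sprefix om k.+1 = om 0%N :: sprefix (Defs.shift om) k.
    by rewrite -[k.+1]add1n sprefix_add shift_shiftn.
  have -> : \sum_(i < k) geom T T' (shiftn (bump 0 i) om) = bsum (geom T T') k (Defs.shift om).
    by apply: eq_bigr => i _; rewrite shift_shiftn shiftnD /bump /= addnC.
  set v := sprefix _ _; have [c /andP[c1 c2] ->] := len_cons (om 0%N) v.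
  have Ic : I01 c.
    by have := lo_I01 v; have := hi_I01 v; rewrite /I01 /=; lra.
  rewrite lnM ?posrE ?len_gt0 ?hpos//.
  have IH' := IH (Defs.shift om).
  have hm : `|ln (T' (om 0%N) c) + geom T T' om| <= m k.
    rewrite /geom /m; case: ltnP => kL.
      apply: le_trans (hM _ _ _ Ic (projPi_I01 _)) _; lra.
    rewrite addr0; apply/ltW/hd => //; first exact: projPi_I01.
    have := projPi_between (Defs.shift om) k; rewrite -/v.
    have := hL v; rewrite size_sprefix => /(_ kL); rewrite /len ltr_norml; lra.
  move: IH' hm; rewrite -/v !ler_norml; lra.
have hK : \forall k \near \oo, (M *+ L) / (e / 2) < k%:R by exact: nbhs_infty_gtr.
have [K _ {}hK] := hK.
exists K => k /hK /= {}hK om; apply: le_trans (key k om) _.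
rewrite /m big_split/= sumr_const card_ord -[_ *+ k]mulr_natr sum_lt_minn.
rewrite ltr_pdivrMr// in hK.
have : M *+ minn k L <= M *+ L by rewrite -[leLHS]mulr_natl -[leRHS]mulr_natl ler_wpM2r// ler_nat geq_minr.
lra.
Qed.

End IteratedFunctionSystem.

(** * Upper bound *)

Lemma ler_sum_inj (R : realType) (I J : finType) (f : I -> J) (F : J -> R) :
  injective f -> (forall j, 0 <= F j) -> \sum_i F (f i) <= \sum_j F j.
Proof.
move=> fI F0; have -> : \sum_i F (f i) = \sum_(j in [set f i | i in setT]%SET) F j.
  rewrite big_imset/=; first by apply: eq_bigl => i; rewrite in_setT.
  by move=> ? ? _ _; exact: fI.
by rewrite [leRHS](bigID [in [set f i | i in setT]%SET])/= lerDl sumr_ge0.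
Qed.

(* Averages of observables over the periodic orbits of the words of length [k],
   weighted by a probability [nu] on these words. *)
Section PeriodicAverage.
Variables (n : nat) (R : realType) (k : nat) (nu : k.-tuple 'I_n.+1 -> R).
Hypotheses (k0 : (0 < k)%N) (nu_ge0 : forall x, 0 <= nu x) (nu1 : \sum_x nu x = 1).
Implicit Types (x : k.-tuple 'I_n.+1) (phi psi : Sigma n -> R).

Definition per x : Sigma n := fun j => nth ord0 x (j %% k).

Lemma sprefix_per x : sprefix (per x) k = x.
Proof.
apply: (@eq_from_nth _ ord0); rewrite size_sprefix ?size_tuple// => i ik.
by rewrite nth_sprefix// /per modn_small.
Qed.

Lemma shiftn_per x : shiftn k (per x) = per x.
Proof. by apply/funext => j; rewrite /shiftn /per modnDr. Qed.

(** Reading k letters of a k-periodic point from any offset is a rotation of its word, hence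
    invertible. *)
Lemma shiftn_per_inj t : injective (fun x => sprefix (shiftn t (per x)) k).
Proof.
move=> x y h; apply: val_inj; rewrite /= -(sprefix_per x) -(sprefix_per y).
apply/sprefixP => i ik.
(* The position which the offset t carries to i modulo k. *)
pose j := ((i + (k - t %% k)) %% k)%N.
have jk : (j < k)%N by rewrite ltn_mod.
have := proj2 (sprefixP _ _ _) h j jk; rewrite /shiftn /per.
have -> : ((j + t) %% k = i %% k)%N; last by [].
rewrite /j modnDml -(modnDmr (i + _)) -addnA subnK ?modnDr//.
by apply/ltnW; rewrite ltn_mod.
Qed.

Definition pavg phi : R := k%:R^-1 * \sum_x nu x * bsum phi k (per x).

Lemma pavgD phi psi : pavg (fun om => phi om + psi om) = pavg phi + pavg psi.
Proof.
rewrite /pavg -mulrDr -big_split/=; congr (_ * _); apply: eq_bigr => x _.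
by rewrite -mulrDr /bsum -big_split.
Qed.

Lemma pavgZ c phi : pavg (fun om => c * phi om) = c * pavg phi.
Proof.
rewrite /pavg mulrCA; congr (_ * _); rewrite mulr_sumr; apply: eq_bigr => x _.
by rewrite [RHS]mulrCA; congr (_ * _); rewrite /bsum mulr_sumr.
Qed.

Lemma pavg_sum (I : finType) (F : I -> Sigma n -> R) :
  pavg (fun om => \sum_i F i om) = \sum_i pavg (F i).
Proof.
rewrite /pavg -mulr_sumr exchange_big/=; congr (_ * _); apply: eq_bigr => x _.
by rewrite -mulr_sumr /bsum exchange_big.
Qed.

Lemma pavg_le phi psi : (forall om, phi om <= psi om) -> pavg phi <= pavg psi.
Proof.
move=> h; rewrite ler_wpM2l ?invr_ge0//; apply: ler_sum => x _.
by rewrite ler_wpM2l//; apply: ler_sum.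
Qed.

Lemma pavg_cst c : pavg (fun=> c) = c.
Proof.
rewrite /pavg /bsum; under eq_bigr do rewrite sumr_const card_ord.
by rewrite -mulr_suml nu1 mul1r -[c *+ k]mulr_natl mulKf// pnatr_eq0 -lt0n.
Qed.

(** Exact invariance: a sum over a whole period does not change under the shift, since the term that
    leaves equals the one that enters. *)
Lemma pavg_shiftn t phi : pavg (fun om => phi (shiftn t om)) = pavg phi.
Proof.
elim: t => [|t IH].
  by congr pavg; apply/funext => om; rewrite shiftn0.
rewrite -[RHS]IH /pavg; congr (_ * _); apply: eq_bigr => x _; congr (_ * _).
rewrite /bsum; set F := fun i => phi (shiftn t (shiftn i (per x))).
rewrite (eq_bigr (fun i : 'I_k => F i.+1)); last first.
  by move=> i _; rewrite /F !shiftnD addSnnS.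
have Fk : F k = F 0%N by rewrite /F shiftn_per shiftn0.
apply: (addIr (F 0%N)); rewrite -[in RHS]Fk.
transitivity (\sum_(i < k.+1) F i); last by rewrite big_ord_recr.
by rewrite big_ord_recl/= addrC.
Qed.

Definition ind (w : seq 'I_n.+1) : Sigma n -> R := fun om => (sprefix om (size w) == w)%:R.

Lemma pavg_ind l (phi : seq 'I_n.+1 -> R) :
  pavg (fun om => phi (sprefix om l)) = \sum_(w : l.-tuple 'I_n.+1) pavg (ind w) * phi w.
Proof.
transitivity (pavg (fun om => \sum_(w : l.-tuple 'I_n.+1) phi w * ind w om)).
  congr pavg; apply/funext => om; rewrite (bigD1 (pword om l))// big1 => [|w ne].
    by rewrite /ind size_tuple pwordE eqxx mulr1; exact/esym/addr0.
  rewrite /ind size_tuple; case: eqP => h; last by rewrite mulr0.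
  by case/eqP: ne; apply: val_inj; rewrite /= pwordE.
by rewrite pavg_sum; apply: eq_bigr => w _; rewrite pavgZ mulrC.
Qed.

Lemma ind_rcons w om : ind w om = \sum_a ind (rcons w a) om.
Proof.
rewrite (bigD1 (om (size w)))//= big1 => [|a ne].
  by rewrite addr0 /ind size_rcons sprefixS eqseq_rcons eqxx andbT.
rewrite /ind size_rcons sprefixS eqseq_rcons; case: (_ =P a) => // h; last by rewrite andbF.
by rewrite -h eqxx in ne.
Qed.

Lemma ind_cons w om : ind w (shiftn 1 om) = \sum_a ind (a :: w) om.
Proof.
have h a : ind (a :: w) om = ((om 0%N == a) && (sprefix (shiftn 1 om) (size w) == w))%:R.
  by rewrite /ind /= -[(size w).+1]add1n sprefix_add /= eqseq_cons.
rewrite (bigD1 (om 0%N))//= big1 => [|a ne]; first by rewrite addr0 h eqxx.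
by rewrite h; case: (_ =P a) => // e; rewrite -e eqxx in ne.
Qed.

(* The blocks of length [l] at positions [t, t + l, t + 2 l, ...] determine a
   periodic word; Gibbs' inequality for the product weight of the blocks,
   averaged over the offset [t]. *)
Lemma entropy_le_pavg l (r : seq 'I_n.+1 -> R) : (0 < l)%N ->
  (forall w, 0 < r w) -> \sum_(w : l.-tuple 'I_n.+1) r w <= 1 ->
  \sum_x xlnx (nu x) <= (k %/ l).+1%:R * \sum_(w : l.-tuple 'I_n.+1) - (pavg (ind w) * ln (r w)).
Proof.
move=> l0 r0 r1.
(* Rounding up: M blocks of length l cover a whole period and so determine the word, although the
   last one may overrun it. *)
pose M := (k %/ l).+1.
have kM : (k <= M * l)%N by rewrite ltnW// ltn_ceil.
pose win t x : l.-tuple 'I_n.+1 := pword (shiftn t (per x)) l.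
have win_inj t : injective (fun x => [ffun j : 'I_M => win (t + j * l)%N x]).
  move=> x y h; apply: (@shiftn_per_inj t).
  apply/sprefixP => i ik.
  have il : (i %/ l < M)%N by rewrite ltn_divLR// (leq_trans ik).
  have := congr1 (fun a : {ffun 'I_M -> l.-tuple 'I_n.+1} => nth ord0 (a (Ordinal il)) (i %% l)%N) h.
  rewrite !ffunE /win !pwordE !nth_sprefix ?ltn_mod// /shiftn /=.
  by rewrite (addnC t) addnA (addnC (i %% l)%N) -divn_eq.
(* Distinct words give distinct sequences of blocks, so the product weights sum to at most the M-th
   power of the total of [r], hence to at most 1. *)
have step t : \sum_x xlnx (nu x) <= \sum_(j < M) \sum_x - (nu x * ln (r (win (t + j * l)%N x))).
  apply: le_trans (@gibbs R _ nu (fun x => \prod_(j < M) r (win (t + j * l)%N x)) nu_ge0 nu1 _ _ _) _.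
  - by move=> x; apply: prodr_ge0 => j _; exact: ltW.
  - pose rt (w : l.-tuple 'I_n.+1) := r w.
    apply: (@le_trans _ _ (\sum_(a : {ffun 'I_M -> l.-tuple 'I_n.+1}) \prod_j rt (a j))).
      rewrite (eq_bigr (fun x => (fun a => \prod_j rt (a j)) [ffun j : 'I_M => win (t + j * l)%N x])).
        apply: (ler_sum_inj (win_inj t)) => a.
        by apply: prodr_ge0 => j _; exact/ltW/r0.
      by move=> x _; apply: eq_bigr => j _; rewrite ffunE.
    rewrite -(bigA_distr_bigA (fun (_ : 'I_M) w => rt w))/=.
    apply: prodr_ile1 => j _; rewrite r1 andbT; apply: sumr_ge0 => w _; exact/ltW/r0.
  - by move=> x _; apply: prodr_gt0 => j _; exact: r0.
  rewrite exchange_big/=; apply: ler_sum => x _.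
  by rewrite ln_prod// mulr_sumr sumrN.
have -> : M%:R * \sum_(w : l.-tuple 'I_n.+1) - (pavg (ind w) * ln (r w)) =
   \sum_(j < M) pavg (fun om => - ln (r (sprefix (shiftn (j * l) om) l))).
  rewrite [RHS](eq_bigr (fun _ => \sum_(w : l.-tuple 'I_n.+1) - (pavg (ind w) * ln (r w)))).
    by rewrite sumr_const card_ord mulr_natl.
  move=> j _; rewrite (pavg_shiftn (j * l) (fun om => - ln (r (sprefix om l)))).
  rewrite (pavg_ind l (fun w => - ln (r w))).
  by apply: eq_bigr => w _; rewrite mulrN.
(* The left side does not depend on the offset, so it equals its own average over offsets and [step]
   applies for each of them. *)
rewrite -(pavg_cst (\sum_x xlnx (nu x))) -pavg_sum /pavg.
rewrite ler_wpM2l ?invr_ge0// /bsum; under eq_bigr do rewrite mulr_sumr.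
under [leRHS]eq_bigr do rewrite mulr_sumr.
rewrite exchange_big/= [leRHS]exchange_big/=; apply: ler_sum => t _.
rewrite -mulr_suml nu1 mul1r; apply: le_trans (step t) _.
rewrite exchange_big/= le_eqVlt; apply/orP; left; apply/eqP.
apply: eq_bigr => x _; rewrite mulr_sumr; apply: eq_bigr => j _.
by rewrite mulrN /win pwordE shiftnD addnC.
Qed.

End PeriodicAverage.

(** * Limits of bounded sequences along an ultrafilter *)

Section UltraLimit.
Variable R : realType.

Definition bounded_seq (a : nat -> R) := exists M, forall q, `|a q| <= M.

(** The values lie in a compact segment, so their image under the ultrafilter has a cluster point,
    and a cluster point of an ultrafilter is a limit. *)
Lemma ultra_cvg (U : set_system nat) (a : nat -> R) : UltraFilter U ->
  bounded_seq a -> exists l : R, a @ U --> l.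
Proof.
move=> UU [M hM].
have cK := @segment_compact R (- M) M.
have [|p [_ cp]] := cK (a @ U).
  by apply: nearW => q; rewrite /= in_itv/= -ler_norml.
exists p => V nV.
have [//|nU] := in_ultra_setVsetC (a @^-1` V) UU.
have H : (a @ U) (~` V) by exact: nU.
by have [x [nx Vx]] := cp _ _ H nV.
Qed.

(** An ultrafilter refining [\oo] gives limits to all bounded sequences at once, linearly and
    monotonically. This replaces weak compactness of the space of measures and the extraction of
    diagonal subsequences. *)
Lemma limit_functional : exists L : (nat -> R) -> R, [/\
  forall c, L (fun=> c) = c,
  forall a b, bounded_seq a -> bounded_seq b -> L (fun q => a q + b q) = L a + L b,
  forall c a, bounded_seq a -> L (fun q => c * a q) = c * L a &
  forall a b, bounded_seq a -> bounded_seq b ->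
    (exists N, forall q, (N <= q)%N -> a q <= b q) -> L a <= L b].
Proof.
have [U [UU sU]] := @ultraFilterLemma _ (\oo : set_system nat) _.
have PU : ProperFilter U := @ultra_proper _ _ UU.
have LU a : bounded_seq a -> a @ U --> lim (a @ U).
  by move=> /(ultra_cvg UU)[l hl]; apply/cvg_ex; exists l.
exists (fun a => lim (a @ U)); split.
- by move=> c; apply: cvg_lim => //; exact: cvg_cst.
- by move=> a b ha hb; apply: cvg_lim => //; apply: cvgD; exact: LU.
- by move=> c a ha; apply: cvg_lim => //; apply: cvgMl_tmp; exact: LU.
- move=> a b ha hb [N hN]; apply: (ler_cvg_to (LU _ ha) (LU _ hb)).
  by apply: sU; exists N.
Qed.

End UltraLimit.

(** * Restricted partition sums and the measure they produce in the limit *)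

Section Pressure.
Variables (n : nat) (R : realType) (f g : Sigma n -> R) (alpha s eta : R).
Hypotheses (uf : ucont f) (ug : ucont g) (s0 : 0 <= s).

Definition osc (F : Sigma n -> R) l v := forall om om',
  sprefix om l = sprefix om' l -> `|F om - F om'| <= v.

Definition good k (eps : R) (w : seq 'I_n.+1) : bool :=
  (`|bsum f k (ext w) - k%:R * alpha| <= k%:R * eps) && (k%:R * eta <= bsum g k (ext w)).

Definition Zsum k eps : R :=
  \sum_(w : k.-tuple 'I_n.+1 | good k eps w) expR (- (s * bsum g k (ext w))).

(** What is kept of the weighted periodic orbits of length k: [P] holds the cylinder weights, [a]
    and [b] the averages of [f] and [g]. The entropy clause is stated for arbitrary test weights
    [r], being then linear in [P] and stable under limits. *)
Definition stage k (eps : R) (P : seq 'I_n.+1 -> R) (a b : R) := [/\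
  [/\ forall w, 0 <= P w <= 1, P [::] = 1, forall w, P w = \sum_i P (rcons w i) &
      forall w, P w = \sum_i P (i :: w)],
  forall l v, osc f l v -> `|a - \sum_(w : l.-tuple 'I_n.+1) P w * f (ext w)| <= v,
  forall l v, osc g l v -> `|b - \sum_(w : l.-tuple 'I_n.+1) P w * g (ext w)| <= v,
  forall e, osc (bsum f k) k (e * k%:R) -> `|a - alpha| <= eps + e &
  forall e, osc (bsum g k) k (e * k%:R) -> eta - e <= b /\
    forall l (r : seq 'I_n.+1 -> R), (0 < l)%N -> (forall w, 0 < r w) ->
      \sum_(w : l.-tuple 'I_n.+1) r w <= 1 ->
      s * (b - e) - eps <=
        (l%:R^-1 + k%:R^-1) * \sum_(w : l.-tuple 'I_n.+1) - (P w * ln (r w))].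

Lemma pavg_approx k nu F l v : (0 < k)%N -> (forall x, 0 <= nu x) -> \sum_x nu x = 1 ->
  osc F l v ->
  `|@pavg n R k nu F - \sum_(w : l.-tuple 'I_n.+1) pavg nu (ind R w) * F (ext w)| <= v.
Proof.
move=> k0 nu0 nu1 h; rewrite -(pavg_ind nu l (fun w => F (ext w))).
have h' om : `|F om - F (ext (sprefix om l))| <= v.
  apply: h; rewrite -{3}(size_sprefix om l) sprefix_ext //.
rewrite ler_distl; apply/andP; split.
  rewrite lerBlDr -(pavg_cst k0 nu1 v) -pavgD; apply: pavg_le => // om.
  have := h' om; rewrite ler_distl; lra.
rewrite -(pavg_cst k0 nu1 v) -pavgD; apply: pavg_le => // om.
have := h' om; rewrite ler_distl; lra.
Qed.

(** The words are weighted as a Gibbs state on the good words, whose entropy is s times its mean of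
    S_k g plus the logarithm of the partition sum. The lower bound on [Zsum] makes that logarithm at
    least - k eps. *)
Lemma stage_exists k eps : (0 < k)%N -> 0 <= eps -> expR (- (k%:R * eps)) < Zsum k eps ->
  exists P a b, stage k eps P a b.
Proof.
move=> k0 eps0 hZ.
have kR : 0 < k%:R :> R by rewrite ltr0n.
have kn : k%:R != 0 :> R by rewrite gt_eqF.
have Z0 : 0 < Zsum k eps by apply: lt_trans hZ; exact: expR_gt0.
pose nu (x : k.-tuple 'I_n.+1) : R :=
  if good k eps x then expR (- (s * bsum g k (ext x))) / Zsum k eps else 0.
have nu0 x : 0 <= nu x.
  by rewrite /nu; case: ifP => // _; rewrite divr_ge0 ?expR_ge0// ltW.
have nu1 : \sum_x nu x = 1.
  by rewrite /nu -big_mkcond/= -mulr_suml divff// gt_eqF.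
have nug x : 0 < nu x -> good k eps x by rewrite /nu; case: ifP => //; rewrite ltxx.
have per_ext (x : k.-tuple 'I_n.+1) : sprefix (per x) k = sprefix (ext x) k.
  by rewrite sprefix_per sprefix_ext_tuple.
pose P w := pavg nu (ind R w).
have ind01 w (om : Sigma n) : 0 <= ind R w om <= 1 by rewrite /ind; case: (_ == _); rewrite lexx ler01.
have avg_ge (F : Sigma n -> R) (c : R) : (forall x : k.-tuple 'I_n.+1, good k eps x -> c * k%:R <= bsum F k (per x)) -> c <= pavg nu F.
  move=> h; rewrite -[c]mulr1 -nu1 /pavg mulr_sumr mulr_sumr; apply: ler_sum => x _.
  have := nu0 x; rewrite le_eqVlt => /predU1P[<-|nx]; first by rewrite mul0r !mulr0.
  rewrite mulrCA [leLHS]mulrC ler_pM2l// ler_pdivlMl// [leLHS]mulrC; exact/h/nug.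
have avg_le (F : Sigma n -> R) (c : R) : (forall x : k.-tuple 'I_n.+1, good k eps x -> bsum F k (per x) <= c * k%:R) -> pavg nu F <= c.
  move=> h; rewrite -[c]mulr1 -nu1 /pavg mulr_sumr mulr_sumr; apply: ler_sum => x _.
  have := nu0 x; rewrite le_eqVlt => /predU1P[<-|nx]; first by rewrite mul0r !mulr0.
  rewrite mulrCA [leRHS]mulrC ler_pM2l// ler_pdivrMl// [leRHS]mulrC; exact/h/nug.
exists P, (pavg nu f), (pavg nu g); split.
- split.
  + move=> w; apply/andP; split.
      by rewrite -(pavg_cst k0 nu1 0); apply: pavg_le => // om; case/andP: (ind01 w om).
    by rewrite -(pavg_cst k0 nu1 1); apply: pavg_le => // om; case/andP: (ind01 w om).
  + by rewrite -(pavg_cst k0 nu1 1).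
  + by move=> w; rewrite /P -pavg_sum; congr pavg; apply/funext => om; exact: ind_rcons.
  + move=> w; rewrite /P -(pavg_shiftn nu 1) -pavg_sum; congr pavg.
    by apply/funext => om; exact: ind_cons.
- by move=> l v; exact: pavg_approx.
- by move=> l v; exact: pavg_approx.
- move=> e he; rewrite ler_distl; apply/andP; split.
    apply: avg_ge => x /andP[+ _]; have := he _ _ (per_ext x); rewrite !ler_distl; lra.
  apply: avg_le => x /andP[+ _]; have := he _ _ (per_ext x); rewrite !ler_distl; lra.
- move=> e he; split.
    apply: avg_ge => x /andP[_]; have := he _ _ (per_ext x); rewrite !ler_distl; lra.
  move=> l r l0 r0 r1.
  have := entropy_le_pavg k0 nu0 nu1 l0 r0 r1; rewrite -/(P _).
  set X := \sum_(w : l.-tuple _) _ => hX.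
  have X0 : 0 <= X.
    apply: sumr_ge0 => w _; rewrite oppr_ge0 mulr_ge0_le0//.
      by rewrite -(pavg_cst k0 nu1 0); apply: pavg_le => // om; case/andP: (ind01 w om).
    rewrite ln_le0//; apply: le_trans r1; rewrite (bigD1 w)//= lerDl sumr_ge0// => i _.
    exact: ltW.
  (* Since - ln (nu x) = s S_k g + ln Z on good words, the entropy is computed exactly. *)
  have hH : \sum_x xlnx (nu x) = s * \sum_x nu x * bsum g k (ext x) + ln (Zsum k eps).
    rewrite -[X in _ + X]mulr1 -nu1 !mulr_sumr -big_split/=; apply: eq_bigr => x _.
    rewrite /xlnx {2}/nu; case: ifP => gx; last by rewrite /nu gx; ring.
    by rewrite ln_div ?posrE ?expR_gt0// expRK; ring.
  have hb : (pavg nu g - e) * k%:R <= \sum_x nu x * bsum g k (ext x).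
    have e1 : pavg nu g * k%:R = \sum_x nu x * bsum g k (per x) by rewrite /pavg mulrAC mulVf// mul1r.
    have e2 : e * k%:R = \sum_x nu x * (e * k%:R) by rewrite -mulr_suml nu1 mul1r.
    rewrite mulrBl e1 e2 -sumrB.
    apply: ler_sum => x _.
    have := he _ _ (per_ext x); rewrite ler_distl => /andP[_ h].
    have := ler_wpM2l (nu0 x) h; lra.
  have hlnZ : - (k%:R * eps) <= ln (Zsum k eps).
    by rewrite -[leLHS]expRK ler_ln ?posrE ?expR_gt0// ltW.
  have hs := ler_wpM2l s0 hb.
  (* The number of blocks is at most k/l + 1; the summand 1 becomes the term 1/k of [stage]. *)
  have hkl : (k %/ l).+1%:R <= (l%:R^-1 + k%:R^-1) * k%:R :> R.
    rewrite mulrDl mulVf// -natr1 lerD2r ler_pdivlMl ?ltr0n// -natrM ler_nat mulnC.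
    exact: leq_divM.
  have := ler_wpM2r X0 hkl.
  have : (s * (pavg nu g - e) - eps) * k%:R <= (k %/ l).+1%:R * X.
    apply: le_trans hX; rewrite hH; lra.
  move=> h1 h2; have := le_trans h1 h2.
  by rewrite mulrAC ler_pM2r.
Qed.

Hypothesis hZ : forall q : nat, exists2 k, (q < k)%N & expR (- (k%:R * q.+1%:R^-1)) < Zsum k q.+1%:R^-1.

(** The limits of the cylinder weights are again consistent and shift invariant, so they define a
    measure, to which the clauses of [stage] pass. *)
Lemma equilibrium_state : exists mu : probability (SigmaM n) R,
  [/\ shift_invariant mu, mean mu f = alpha, eta <= mean mu g &
    forall N, (0 < N)%N -> s * mean mu g * N%:R <= Hcyl mu N].
Proof.
have : forall q, exists z : nat * (seq 'I_n.+1 -> R) * R * R, (q < z.1.1.1)%N /\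
    stage z.1.1.1 q.+1%:R^-1 z.1.1.2 z.1.2 z.2.
  move=> q; have [k qk hk] := hZ q.
  have [||P [a [b h]]] := stage_exists _ _ hk; first exact: leq_ltn_trans qk.
    by rewrite invr_ge0.
  by exists (k, P, a, b).
move=> /choice[z hz].
pose k q := (z q).1.1.1; pose P q := (z q).1.1.2; pose a q := (z q).1.2; pose b q := (z q).2.
have qk q : (q < k q)%N by case: (hz q).
have hst q : stage (k q) q.+1%:R^-1 (P q) (a q) (b q) by case: (hz q).
have [L [Lc LD LZ Lle]] := limit_functional R.
have bP w : bounded_seq (fun q => P q w).
  exists 1 => q; have [[h _ _ _] _ _ _ _] := hst q.
  by have /andP[h0 h1] := h w; rewrite ger0_norm.
have bc c : bounded_seq (fun=> c : R) by exists `|c|.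
have bD c d : bounded_seq c -> bounded_seq d -> bounded_seq (fun q => c q + d q).
  by move=> [M hM] [M' hM']; exists (M + M') => q; apply: le_trans (ler_normD _ _) _; exact: lerD.
have bZ c d : bounded_seq d -> bounded_seq (fun q => c * d q).
  by move=> [M hM]; exists (`|c| * M) => q; rewrite normrM ler_wpM2l.
have bnd_sum (I : finType) (F : I -> nat -> R) : (forall i, bounded_seq (F i)) ->
    bounded_seq (fun q => \sum_i F i q).
  move=> /choice[M hM]; exists (\sum_i M i) => q.
  by apply: le_trans (ler_norm_sum _ _ _) _; apply: ler_sum.
have Lsum (I : finType) (F : I -> nat -> R) : (forall i, bounded_seq (F i)) ->
    L (fun q => \sum_i F i q) = \sum_i L (F i).
  move=> hF; suff h (rs : seq I) : L (fun q => \sum_(i <- rs) F i q) = \sum_(i <- rs) L (F i) /\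
      bounded_seq (fun q => \sum_(i <- rs) F i q) by case: (h (index_enum I)).
  elim: rs => [|i rs [IH1 IH2]].
    have -> : (fun q => \sum_(i <- [::]) F i q) = fun=> 0 by apply/funext => q; rewrite big_nil.
    by rewrite Lc big_nil.
  have -> : (fun q => \sum_(j <- i :: rs) F j q) = fun q => F i q + \sum_(j <- rs) F j q.
    by apply/funext => q; rewrite big_cons.
  by rewrite LD// IH1 big_cons; split => //; exact: bD.
pose p w := L (fun q => P q w).
have p0 w : 0 <= p w.
  rewrite -(Lc 0); apply: Lle => //; exists 0%N => q _.
  by have [[h _ _ _] _ _ _ _] := hst q; case/andP: (h w).
have p1 : p [::] = 1.
  rewrite /p -[RHS]Lc; congr L; apply/funext => q.
  by have [[_ h _ _] _ _ _ _] := hst q.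
have pr_ w : p w = \sum_i p (rcons w i).
  rewrite /p -Lsum//; congr L; apply/funext => q.
  by have [[_ _ h _] _ _ _ _] := hst q.
have pc_ w : p w = \sum_i p (i :: w).
  rewrite /p -Lsum//; congr L; apply/funext => q.
  by have [[_ _ _ h] _ _ _ _] := hst q.
have [mu hmu] := coding_probability p0 p1 pr_.
have inv : shift_invariant mu.
  apply: shift_invariant_cyl => w; rewrite hmu pc_.
  by apply: eq_bigr => i _; rewrite hmu.
(* Both [c] and the integral are within the oscillation of [F] of the same finite sum of cylinder
   weights, in the limit; the oscillation is then made small. *)
have key F c : ucont F -> (forall q l v, osc F l v ->
    `|c q - \sum_(w : l.-tuple 'I_n.+1) P q w * F (ext w)| <= v) ->
    bounded_seq c /\ L c = mean mu F.
  move=> uF hc.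
  have bs l : bounded_seq (fun q => \sum_(w : l.-tuple 'I_n.+1) P q w * F (ext w)).
    apply: bnd_sum => w; have -> : (fun q => P q w * F (ext w)) = fun q => F (ext w) * P q w.
      by apply/funext => q; rewrite mulrC.
    exact: bZ.
  have Ls l : L (fun q => \sum_(w : l.-tuple 'I_n.+1) P q w * F (ext w)) =
      \sum_(w : l.-tuple 'I_n.+1) pr mu (cyl w) * F (ext w).
    rewrite (_ : (fun q => _) = fun q => \sum_(w : l.-tuple 'I_n.+1) F (ext w) * P q w); last first.
      by apply/funext => q; apply: eq_bigr => w _; rewrite mulrC.
    rewrite Lsum; last by move=> w; exact: bZ.
    by apply: eq_bigr => w _; rewrite LZ// hmu mulrC.
  have oF v : 0 < v -> exists l, osc F l v.
    by move=> v0; have [l hl] := uF v v0; exists l => om om' h; exact/ltW/hl.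
  have bc' : bounded_seq c.
    have [l /hc hl] := oF 1 ltr01; have [M hM] := bs l; exists (1 + M) => q.
    rewrite -(subrK (\sum_(w : l.-tuple 'I_n.+1) P q w * F (ext w)) (c q)).
    by apply: le_trans (ler_normD _ _) _; rewrite lerD.
  split => //; apply/eqP; rewrite -subr_eq0 -normr_le0; apply/ler_addgt0Pr => v v0.
  have v2 := divr_gt0 v0 (ltr0Sn R 1).
  have [l hl] := oF _ v2.
  have h1 := mean_approx mu uF hl.
  have h2 : L c <= \sum_(w : l.-tuple 'I_n.+1) pr mu (cyl w) * F (ext w) + v / 2.
    rewrite -Ls -[X in _ + X]Lc -LD//; apply: Lle => //; first exact: bD.
    by exists 0%N => q _; have := hc q l _ hl; rewrite ler_distl => /andP[].
  have h3 : \sum_(w : l.-tuple 'I_n.+1) pr mu (cyl w) * F (ext w) <= L c + v / 2.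
    rewrite -Ls -[X in _ + X]Lc -LD//; apply: Lle => //; first exact: bD.
    by exists 0%N => q _; have := hc q l _ hl; rewrite ler_distl => /andP[]; lra.
  move: h1; rewrite add0r !ler_norml; lra.
have [ba La] := key f a uf (fun q l v h => let: And5 _ h' _ _ _ := hst q in h' l v h).
have [bb Lb] := key g b ug (fun q l v h => let: And5 _ _ h' _ _ := hst q in h' l v h).
have small (e : R) : 0 < e -> exists N, forall q, (N <= q)%N -> q.+1%:R^-1 <= e.
  move=> e0; have [N _ hN] : \forall q \near \oo, e^-1 < q%:R by exact: nbhs_infty_gtr.
  exists N => q /hN /= h; rewrite -[e]invrK lef_pV2 ?posrE ?invr_gt0//.
  by apply/ltW/(lt_le_trans h); rewrite ler_nat.
have oS F e : ucont F -> 0 < e -> exists N, forall q, (N <= q)%N ->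
    osc (bsum F (k q)) (k q) (e * (k q)%:R).
  move=> uF e0; have [K hK] := bsum_ucont uF e0; exists K => q Kq om om' h.
  by apply: hK => //; exact/ltnW/(leq_ltn_trans Kq).
exists mu; split => //.
- rewrite -La; apply/eqP; rewrite -subr_eq0 -normr_le0; apply/ler_addgt0Pr => v v0.
  have v2 := divr_gt0 v0 (ltr0Sn R 1).
  have [N1 h1] := small _ v2; have [N2 h2] := oS f _ uf v2.
  have hq q : (maxn N1 N2 <= q)%N -> `|a q - alpha| <= v.
    rewrite geq_max => /andP[/h1 q1 /h2 q2].
    have [_ _ _ h _] := hst q; apply: le_trans (h _ q2) _.
    by rewrite [leRHS]splitr lerD2r.
  have : L a <= alpha + v.
    rewrite -(Lc (alpha + v)); apply: Lle => //; exists (maxn N1 N2) => q /hq.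
    by rewrite ler_distl => /andP[].
  have : alpha - v <= L a.
    rewrite -(Lc (alpha - v)); apply: Lle => //; exists (maxn N1 N2) => q /hq.
    by rewrite ler_distl => /andP[].
  rewrite add0r ler_distl; lra.
- rewrite -Lb; apply/ler_addgt0Pr => v v0.
  have [N2 h2] := oS g _ ug v0.
  rewrite -[leLHS]Lc -[X in _ + X]Lc -LD//; apply: Lle => //; first exact: bD.
  by exists N2 => q /h2 q2; have [_ _ _ _ h] := hst q; have [h' _] := h _ q2; lra.
- move=> l l0; rewrite -Lb.
  have lR : 0 < l%:R :> R by rewrite ltr0n.
  have main (r : seq 'I_n.+1 -> R) : (forall w, 0 < r w) ->
      \sum_(w : l.-tuple 'I_n.+1) r w <= 1 ->
      s * L b <= l%:R^-1 * \sum_(w : l.-tuple 'I_n.+1) - (p w * ln (r w)).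
    move=> r0 r1.
    have r1' (w : l.-tuple 'I_n.+1) : 0 <= - ln (r w).
      rewrite oppr_ge0 ln_le0//; apply: le_trans r1; rewrite (bigD1 w)//= lerDl sumr_ge0// => i _.
      exact: ltW.
    pose C := \sum_(w : l.-tuple 'I_n.+1) - ln (r w).
    have C0 : 0 <= C by exact: sumr_ge0.
    pose X q := \sum_(w : l.-tuple 'I_n.+1) - ln (r w) * P q w.
    have bX : bounded_seq X by apply: bnd_sum => w; exact: bZ.
    have LX : L X = \sum_(w : l.-tuple 'I_n.+1) - (p w * ln (r w)).
      rewrite /X Lsum; last by move=> w; exact: bZ.
      by apply: eq_bigr => w _; rewrite LZ// mulrC mulrN.
    rewrite -LX -!LZ//; apply/ler_addgt0Pr => v v0.
    (* The errors are s e from the distortion, at most e from the tolerance, and at most e C from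
       the term 1/k, as [C] bounds every [X q]. *)
    pose e := v / (s + 2 + C).
    have D0 : 0 < s + 2 + C by rewrite ltr_wpDr// ltr_wpDl.
    have e0 : 0 < e by rewrite divr_gt0.
    have [N1 h1] := small _ e0; have [N2 h2] := oS g _ ug e0.
    rewrite -[X in _ + X]Lc -LD//; last exact: bZ.
    apply: Lle; [exact: bZ|by apply: bD => //; exact: bZ|exists (maxn N1 N2) => q].
    rewrite geq_max => /andP[/h1 q1 /h2 q2].
    have [[hP _ _ _] _ _ _ h] := hst q; have [_ /(_ l r l0 r0 r1)] := h _ q2.
    have -> : \sum_(w : l.-tuple 'I_n.+1) - (P q w * ln (r w)) = X q.
      by apply: eq_bigr => w _; rewrite mulNr mulrC.
    have X0 : 0 <= X q by apply: sumr_ge0 => w _; rewrite mulr_ge0//; case/andP: (hP w).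
    have XC : X q <= C.
      by apply: ler_sum => w _; rewrite ler_piMr//; case/andP: (hP w).
    have hk : (k q)%:R^-1 <= e.
      apply: le_trans q1; rewrite lef_pV2 ?posrE ?ltr0n ?(leq_ltn_trans _ (qk q))//.
      by rewrite ler_nat.
    have h3 : (k q)%:R^-1 * X q <= e * C by apply: ler_pM; rewrite ?invr_ge0.
    have -> : v = e * (s + 2 + C) by rewrite /e divfK// gt_eqF.
    move=> h4; move: (le_trans (lerB (lexx _) q1) h4) h3.
    rewrite mulrDl; move: (k q)%:R^-1 l%:R^-1 => kk ll; lra.
  apply/ler_addgt0Pr => v v0.
  (* The test weights are the limit weights mixed with the uniform ones, so that they stay positive
     where [p] vanishes. As 1 - th = exp(- v), the mixing costs at most v in the logarithm. *)
  pose th : R := 1 - expR (- v).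
  have th1 : 1 - th = expR (- v) by rewrite /th opprB addrC subrK.
  have th0 : 0 < th by rewrite subr_gt0 expR_lt1; lra.
  pose A : R := #|{: l.-tuple 'I_n.+1}|%:R.
  have A0 : 0 < A by rewrite ltr0n card_tuple card_ord expn_gt0.
  pose r w := (1 - th) * p w + th / A.
  have r0 w : 0 < r w.
    by rewrite /r ltr_wpDl ?divr_gt0// mulr_ge0// th1 expR_ge0.
  have sp : \sum_(w : l.-tuple 'I_n.+1) p w = 1.
    rewrite -(sum_pr1 mu (@measurable_pword n l)); apply: eq_bigr => w _.
    by rewrite -hmu cyl_pword.
  have r1 : \sum_(w : l.-tuple 'I_n.+1) r w <= 1.
    rewrite big_split/= -mulr_sumr sp sumr_const -[_ *+ _]mulr_natr -/A divfK ?gt_eqF//.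
    by rewrite mulr1 subrK.
  have := main r r0 r1; rewrite ler_pdivlMl// mulrC => /le_trans; apply.
  rewrite HcylE -[X in _ + X]mulr1 -sp mulr_sumr -big_split/=; apply: ler_sum => w _.
  rewrite hmu /xlnx; have := p0 w; rewrite le_eqVlt => /predU1P[<-|pw].
    by rewrite !mul0r mulr0 oppr0 addr0.
  have : ln (expR (- v) * p w) <= ln (r w).
    rewrite ler_ln ?posrE ?mulr_gt0 ?expR_gt0//.
    by rewrite /r th1 lerDl divr_ge0// ltW.
  rewrite lnM ?posrE ?expR_gt0// expRK => h.
  have := ler_wpM2l (ltW pw) h; lra.
Qed.

End Pressure.

(** * Sets of Hausdorff measure zero *)

Section Hausdorff.
Variable R : realType.
Implicit Types (E : set R) (s d e : R).

Definition small_cover s d e E (U : nat -> set R) := [/\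
  E `<=` \bigcup_k U k, forall k, (diamE (U k) <= d%:E)%E &
  (\sum_(0 <= k <oo) ((fine (diamE (U k))) `^ s)%:E <= e%:E)%E].

Definition null_set s E := forall d e, 0 < d -> 0 < e -> exists U, small_cover s d e E U.

Lemma powR_fine_ge0 s (A : set R) : (0 <= ((fine (diamE A)) `^ s)%:E)%E.
Proof. by rewrite lee_fin powR_ge0. Qed.

Lemma null_setP s E : null_set s E <-> hausdorff_meas s E = 0%E.
Proof.
have pre0 d : (0 <= hausdorff_pre s d E)%E.
  apply: le_ereal_inf_tmp => _ [U _ <-]; apply: nneseries_ge0 => k _ _.
  exact: powR_fine_ge0.
split=> [h|h].
  apply/eqP; rewrite eq_le; apply/andP; split.
    apply: ge_ereal_sup => _ [d /= d0 <-]; apply/lee_addgt0Pr => e e0.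
    have [U [h1 h2 h3]] := h d e d0 e0; rewrite add0e; apply: le_trans h3.
    by apply: ereal_inf_lbound; exists U.
  apply: le_trans (pre0 1) _; apply: ereal_sup_ubound.
  by exists 1; rewrite /= ?ltr01.
move=> d e d0 e0.
have : (hausdorff_pre s d E < e%:E)%E.
  apply: le_lt_trans (_ : (_ <= 0)%E) _; last by rewrite lte_fin.
  by rewrite -h; apply: ereal_sup_ubound; exists d.
move=> /ereal_inf_lt[_ [U [h1 h2] <-] h3]; exists U; split => //.
exact: ltW.
Qed.

(** The i-th set receives the share e / 2^(i+1) of the total, and the double family of covers is
    renumbered by a bijection between pairs and integers. *)
Lemma null_set_bigcup s (F : nat -> set R) : (forall i, null_set s (F i)) ->
  null_set s (\bigcup_i F i).
Proof.
move=> hF d e d0 e0.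
have h i : exists U, small_cover s d (e / (2 ^ i.+1)%:R) (F i) U.
  by apply: hF => //; rewrite divr_gt0// ltr0n expn_gt0.
have [U hU] := choice h.
have /card_esym/card_set_bijP[phi bij] := card_nat2.
exists (fun m => U (phi m).1 (phi m).2); split.
- move=> x [i _ Fx]; have [/(_ x Fx)[j _ Ux] _ _] := hU i.
  have [m _ hm] := set_bij_surj bij (I : [set: nat * nat] (i, j)).
  by exists m => //; rewrite hm.
- by move=> k; have [_ h2 _] := hU (phi k).1.
- rewrite nneseries_esumT; last by move=> m; exact: powR_fine_ge0.
  pose a i j := ((fine (diamE (U i j))) `^ s)%:E.
  rewrite -(@reindex_esum R _ _ _ _ phi (fun k : nat * nat => a k.1 k.2) bij).
  have -> : [set: nat * nat] = [set: nat] `*`` (fun _ => [set: nat]).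
    by apply/seteqP; split.
  rewrite -esum_esum; last by move=> i j _ _; exact: powR_fine_ge0.
  rewrite -nneseries_esumT; last by move=> i; apply: esum_ge0 => j _; exact: powR_fine_ge0.
  apply: le_trans (epsilon_trick0 xpredT (ltW e0)).
  apply: lee_nneseries => [i _ _|i _].
    by apply: esum_ge0 => j _; exact: powR_fine_ge0.
  rewrite -nneseries_esumT; last by move=> j; exact: powR_fine_ge0.
  by have [_ _ h3] := hU i.
Qed.

Lemma null_set_sub s E E' : E `<=` E' -> null_set s E' -> null_set s E.
Proof.
move=> sub h d e d0 e0; have [U [h1 h2 h3]] := h d e d0 e0.
by exists U; split => //; exact: subset_trans sub h1.
Qed.

Lemma diamE_ge0 (A : set R) : (0 <= diamE A)%E.
Proof. by apply: ereal_sup_ubound; left. Qed.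

Lemma diamE_le (A : set R) c : 0 <= c -> (forall x y, A x -> A y -> `|x - y| <= c) ->
  (diamE A <= c%:E)%E.
Proof.
move=> c0 h; apply: ge_ereal_sup => _ [->|[x [y [Ax [Ay ->]]]]]; rewrite lee_fin//.
exact: h.
Qed.

Lemma finite_small_cover (I : finType) (P : pred I) (V : I -> set R) (c : I -> R) s d e E :
  0 < s -> 0 <= d -> (forall x, E x -> exists2 i, P i & V i x) ->
  (forall i, 0 <= c i <= d) ->
  (forall i x y, V i x -> V i y -> `|x - y| <= c i) ->
  \sum_(i | P i) c i `^ s <= e -> exists U, small_cover s d e E U.
Proof.
move=> s0 d0 hE hc hV he.
pose rs := [seq i <- enum I | P i].
pose U k : set R := if (k < size rs)%N then nth set0 (map V rs) k else set0.
have diam0 : diamE (set0 : set R) = 0%E.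
  apply/eqP; rewrite eq_le diamE_ge0 andbT; exact: diamE_le.
have hV' i : (diamE (V i) <= (c i)%:E)%E.
  by apply: diamE_le => [|x y]; [case/andP: (hc i)|exact: hV].
exists U; split.
- move=> x /hE[i Pi Vx].
  have irs : i \in rs by rewrite mem_filter Pi mem_enum.
  by exists (index i rs) => //; rewrite /U index_mem irs (nth_map i) ?index_mem// nth_index.
- move=> k; rewrite /U; case: ifPn => [krs|_]; last by rewrite diam0 lee_fin.
  case E1 : rs krs => [//|i0 r] krs; rewrite (nth_map i0)//.
  by apply: le_trans (hV' _) _; rewrite lee_fin; case/andP: (hc (nth i0 (i0 :: r) k)).
- rewrite (nneseries_split 0 (size rs)); last by move=> k _; exact: powR_fine_ge0.
  (* The padding by empty sets is free because s > 0: the power of 0 with exponent 0 would be 1. *)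
  rewrite add0n eseries0 ?adde0; last first.
    move=> k hk _; rewrite /U ltnNge hk/= diam0 /= powR0// gt_eqF//.
  apply: (@le_trans _ _ (\sum_(i | P i) c i `^ s)%:E); last by rewrite lee_fin.
  rewrite sumEFin lee_fin.
  have -> : \sum_(i | P i) c i `^ s = \sum_(i <- rs) c i `^ s.
    by rewrite big_filter big_enum_cond.

  case E1 : rs => [|i0 r]; first by rewrite /= big_nat big_nil big_pred0// => k; lia.
  rewrite -E1 [leRHS](big_nth i0); apply: ler_sum_nat => k /andP[_ krs].
  rewrite /U krs (nth_map i0)//.
  have /andP[c0 _] := hc (nth i0 rs k).
  have h := hV' (nth i0 rs k).
  apply: ge0_ler_powR; first exact: ltW.
  + by rewrite nnegrE fine_ge0// diamE_ge0.
  + by rewrite nnegrE.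
  + rewrite -lee_fin fineK// ge0_fin_numE ?diamE_ge0//.
    by apply: le_lt_trans h _; rewrite ltry.
Qed.

End Hausdorff.

(** * Efficient covers of the level set *)

Section UpperBound.
Variables (R : realType) (n : nat) (T T' : 'I_n.+1 -> R -> R).
Hypothesis hTmap : forall i x, I01 x -> I01 (T i x).
Hypothesis hC1 : forall i, C1_on01 (T i) (T' i).
Hypothesis hpos : forall i x, I01 x -> 0 < T' i x.
Hypothesis hdiam : forall e : R, 0 < e -> exists N : nat, forall k, (N <= k)%N ->
     forall om : Sigma n, (diamE (compw T (sprefix om k) @` I01) < e%:E)%E.
Variables (f : Sigma n -> R) (alpha s : R).
Hypotheses (uf : ucont f) (s0 : 0 < s).
Let g := geom T T'.
Let ug : ucont g := ucont_geom hTmap hC1 hpos hdiam.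

Hypothesis no_state : forall mu : probability (SigmaM n) R, shift_invariant mu ->
  mean mu f = alpha -> 0 < mean mu g ->
  ~ (forall N, (0 < N)%N -> s * mean mu g * N%:R <= Hcyl mu N).

Definition piece (eta eps : R) N : set (Sigma n) := [set om | forall k, (N <= k)%N ->
  `|bsum f k om - k%:R * alpha| <= k%:R * eps /\ k%:R * eta <= bsum g k om].

(** If every eps = 1/(q+1) failed, the failures would feed [equilibrium_state] and yield a measure
    excluded by [no_state]. The same eps serves as tolerance for [f] and as rate of decay. *)
Lemma Zsum_small (eta : R) : 0 < eta -> exists eps, 0 < eps /\
  exists N, forall k, (N <= k)%N -> Zsum f g alpha s eta k eps <= expR (- (k%:R * eps)).
Proof.
move=> eta0; apply: contrapT => nh.
have hZ (q : nat) : exists2 k, (q < k)%N &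
    expR (- (k%:R * q.+1%:R^-1)) < Zsum f g alpha s eta k q.+1%:R^-1.
  apply: contrapT => hq; apply: nh; exists q.+1%:R^-1; split; first by rewrite invr_gt0.
  exists q.+1 => k qk; rewrite leNgt; apply/negP => h; apply: hq; by exists k.
have [mu [inv mf mg hH]] := equilibrium_state uf ug (ltW s0) hZ.
by apply: (no_state inv mf) hH; exact: lt_le_trans mg.
Qed.

(** The intervals of the good words of one large length k form the cover. Passing from a point to
    the reference point of its word halves both eta and eps. *)
Lemma piece_null (eta : R) : 0 < eta -> exists2 eps, 0 < eps &
  forall N, null_set s (projPi T @` piece eta eps N).
Proof.
move=> eta0; have eta2 := divr_gt0 eta0 (ltr0Sn R 1).
have [eps [eps0 [N1 hN1]]] := Zsum_small eta2.
have eps2 := divr_gt0 eps0 (ltr0Sn R 1).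
exists (eps / 2) => // N d e d0 e0.
(* The error in the interval lengths, raised to the power s, is exp(k eps / 2): it uses half of the
   decay exp(- k eps), and the other half makes the sum at most [e]. *)
pose de := eps / (2 * s).
have de0 : 0 < de by rewrite divr_gt0// mulr_gt0.
have [N2 hN2] := len_distortion hTmap hC1 hpos hdiam de0.
have [N3 hN3] := bsum_ucont uf eps2.
have [N4 hN4] := bsum_ucont ug eta2.
have [N5 hN5] := len_small hdiam d0.
have [N6 _ hN6] : \forall q \near \oo, - ln e / (eps / 2) < q%:R by exact: nbhs_infty_gtr.
pose k := (N + (N1 + (N2 + (N3 + (N4 + (N5 + N6))))))%N.
have kN : (N <= k)%N by rewrite /k; lia.
have kN1 : (N1 <= k)%N by rewrite /k; lia.
have kN2 : (N2 <= k)%N by rewrite /k; lia.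
have kN3 : (N3 <= k)%N by rewrite /k; lia.
have kN4 : (N4 <= k)%N by rewrite /k; lia.
have kN5 : (N5 <= k)%N by rewrite /k; lia.
have kN6 : (N6 <= k)%N by rewrite /k; lia.
pose V (w : k.-tuple 'I_n.+1) : set R := [set x | lo T w <= x <= hi T w].
apply: (@finite_small_cover R _ (fun w : k.-tuple 'I_n.+1 => good f g alpha (eta / 2) k eps w)
   V (fun w => len T w) s d e) => //; first exact: ltW.
- move=> _ [om hom <-]; exists (pword om k); last first.
    by rewrite /V /= pwordE; exact: projPi_between.
  have [h1 h2] := hom k kN.
  have he : sprefix om k = sprefix (ext (pword om k)) k by rewrite sprefix_ext_tuple pwordE.
  have h3 := hN3 k kN3 _ _ he; have h4 := hN4 k kN4 _ _ he.
  by rewrite /good; apply/andP; split; move: h1 h2 h3 h4; rewrite !ler_distl; lra.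
- move=> w; rewrite ltW ?(len_gt0 hTmap hC1 hpos)//=.
  by apply/ltW/hN5; rewrite size_tuple.
- move=> w x y /andP[x1 x2] /andP[y1 y2]; rewrite /len ler_distl; lra.
- apply: (@le_trans _ _ (expR (s * (de * k%:R)) * Zsum f g alpha s (eta / 2) k eps)).
    rewrite /Zsum mulr_sumr; apply: ler_sum => w _.
    have l0 := len_gt0 hTmap hC1 hpos w.
    rewrite /powR gt_eqF// -expRD ler_expR.
    have := hN2 k kN2 (ext w); rewrite sprefix_ext_tuple ler_norml => /andP[_ h].
    have := ler_wpM2l (ltW s0) h; rewrite -/g; lra.
  apply: le_trans (_ : expR (s * (de * k%:R)) * expR (- (k%:R * eps)) <= _).
    by rewrite ler_wpM2l ?expR_ge0// hN1.
  rewrite -expRD -[leRHS]lnK ?posrE// ler_expR.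
  have -> : s * (de * k%:R) = k%:R * (eps / 2).
    by rewrite /de; field; rewrite gt_eqF.
  have /= := hN6 k kN6; rewrite ltr_pdivrMr//; lra.
Qed.

(** A positive lower limit exceeds some 1/(i+1). The tolerance for [f] may depend on i, because
    convergence to alpha meets any tolerance eventually. *)
Lemma level_null : null_set s (projPi T @` (level_set f alpha `&` tildeSigma T T')).
Proof.
have h (i : nat) : exists eps : R, 0 < eps /\
    forall N, null_set s (projPi T @` piece i.+1%:R^-1 eps N).
  have [|eps e0 hN] := @piece_null i.+1%:R^-1; first by rewrite invr_gt0.
  by exists eps.
have [eps heps] := choice h.
apply: (@null_set_sub _ _ _
  (\bigcup_i \bigcup_N (projPi T @` piece i.+1%:R^-1 (eps i) N))); last first.
  by apply: null_set_bigcup => i; apply: null_set_bigcup => N; exact: (heps i).2.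
move=> _ [om [hl ht] <-].
have birkS F k : (0 < k)%N -> birk F k om = bsum F k om / k%:R by rewrite /birk /bsum mulrC.
have [i [N1 hi]] : exists i N, forall k, (N <= k)%N -> i.+1%:R^-1 <= birk g k om.
  move: ht; rewrite /tildeSigma /= limn_einf_lim => ht.
  have cvi := @is_cvg_einfs R (fun k => (birk g k om)%:E).
  have nd : nondecreasing_seq (einfs (fun k => (birk g k om)%:E)) by exact: nondecreasing_einfs.
  have hsup := ereal_nondecreasing_cvgn nd.
  have {}ht : (0 < ereal_sup (range (einfs (fun k => (birk g k om)%:E))))%E.
    by rewrite -(cvg_lim _ hsup).
  have [_ [N _ <-] h0] := ereal_sup_gt ht.
  (* The tail infimum is an extended real; if it is infinite, 1 serves as the bound. *)
  have [c c0 hc] : exists2 c : R, 0 < c & (c%:E <= einfs (fun k => (birk g k om)%:E) N)%E.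
    case E : (einfs _ N) h0 => [r| |] //; last by move=> _; exists 1; rewrite ?ltr01 ?leey.
    by rewrite lte_fin => r0; exists r.
  have [q _ hq] : \forall q \near \oo, c^-1 < q%:R by exact: nbhs_infty_gtr.
  exists q, N => k Nk.
  apply: (@le_trans _ _ c).
    rewrite -[c]invrK lef_pV2 ?posrE ?invr_gt0//.
    have /= := hq q (leqnn _) => h'; by apply/ltW; apply: (lt_le_trans h'); rewrite ler_nat leqnSn.
  rewrite -lee_fin; apply: le_trans hc _.
  by apply: ereal_inf_lbound; exists k.
have [e0 _] := heps i.
have [N2 _ hN2] := proj1 (cvgrPdist_le _ _) hl _ e0.
exists i => //; exists (N1 + N2).+1 => //; exists om => // k hk.
have k0 : 0 < k%:R :> R by rewrite ltr0n (leq_ltn_trans _ hk).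
have kn : (0 < k)%N by rewrite (leq_ltn_trans _ hk).
split.
  have /= := hN2 k; rewrite birkS// distrC => /(_ _).
  have -> : bsum f k om - k%:R * alpha = k%:R * (bsum f k om / k%:R - alpha).
    by field; rewrite gt_eqF.
  rewrite normrM normr_nat ler_pM2l// => h'; apply: h'.
  by rewrite /=; lia.
have := hi k; rewrite birkS// ler_pdivlMr// mulrC; apply; lia.
Qed.

End UpperBound.

(** * Lower bound *)

Section LawOfLargeNumbers.
Variables (R : realType) (X : finType) (p : X -> R).
Hypotheses (p0 : forall x, 0 <= p x) (p1 : \sum_x p x = 1).

Fixpoint lists N : seq (seq X) :=
  if N is N'.+1 then [seq x :: u | x <- enum X, u <- lists N'] else [:: [::]].

Definition wt (u : seq X) : R := \prod_(x <- u) p x.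

Lemma wt_ge0 u : 0 <= wt u. Proof. by apply: prodr_ge0 => x _; exact: p0. Qed.

Lemma uniq_lists N : uniq (lists N).
Proof.
elim: N => //= N IH; apply: allpairs_uniq => //; first exact: enum_uniq.
by move=> [x u] [y v] _ _ /= [-> ->].
Qed.

Lemma size_lists N u : u \in lists N -> size u = N.
Proof.
by elim: N u => [|N IH] u /=; [rewrite inE => /eqP ->|move=> /allpairsP[[x v] /= [_ /IH <- ->]]].
Qed.

Lemma sum_lists N (phi : seq X -> R) :
  \sum_(u <- lists N.+1) wt u * phi u =
  \sum_x p x * \sum_(u <- lists N) wt u * phi (x :: u).
Proof.
rewrite /= big_allpairs_dep big_enum/=; apply: eq_bigr => x _.
rewrite mulr_sumr; apply: eq_bigr => u _.
by rewrite /wt big_cons mulrA.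
Qed.

Lemma sum_wt N : \sum_(u <- lists N) wt u = 1.
Proof.
elim: N => [|N IH]; first by rewrite big_seq1 /wt big_nil.
rewrite (eq_bigr (fun u => wt u * 1)); last by move=> u _; rewrite mulr1.
rewrite (sum_lists N (fun=> 1)); under eq_bigr do under eq_bigr do rewrite mulr1.
by rewrite IH -mulr_suml p1 mul1r.
Qed.

Section Chebyshev.
Variable F : X -> R.
Let m := \sum_x p x * F x.
Let v := \sum_x p x * (F x - m) ^+ 2.

(** Variances of independent summands add: the cross term vanishes because F - m has mean zero under
    [p]. *)
Lemma variance_lists N :
  \sum_(u <- lists N) wt u * (\sum_(x <- u) F x - N%:R * m) ^+ 2 = N%:R * v.
Proof.
elim: N => [|N IH]; first by rewrite big_seq1 /wt !big_nil !mul0r subrr expr0n/= mulr0.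
rewrite (sum_lists N (fun u => (\sum_(x <- u) F x - N.+1%:R * m) ^+ 2)).
pose D u := \sum_(x <- u) F x - N%:R * m.
have h x : \sum_(u <- lists N) wt u * (\sum_(y <- x :: u) F y - N.+1%:R * m) ^+ 2 =
    (F x - m) ^+ 2 + (F x - m) * (2 * \sum_(u <- lists N) wt u * D u) + N%:R * v.
  have h1 : (F x - m) ^+ 2 = \sum_(u <- lists N) wt u * (F x - m) ^+ 2.
    by rewrite -mulr_suml sum_wt mul1r.
  transitivity (\sum_(u <- lists N) (wt u * (F x - m) ^+ 2 +
      (F x - m) * (2 * (wt u * D u)) + wt u * D u ^+ 2)).
    by apply: eq_bigr => u _; rewrite big_cons /D -(natr1 N); ring.
  by rewrite !big_split/= -h1 IH -!mulr_sumr.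
under eq_bigr do rewrite h !mulrDr.
rewrite !big_split/= -/v -[X in _ + _ + X]mulr_suml p1 mul1r.
have -> : \sum_x p x * ((F x - m) * (2 * \sum_(u <- lists N) wt u * D u)) = 0.
  under eq_bigr do rewrite mulrA.
  rewrite -mulr_suml; have -> : \sum_x p x * (F x - m) = 0; last by rewrite mul0r.
  by under eq_bigr do rewrite mulrBr; rewrite sumrB -mulr_suml p1 mul1r subrr.
by rewrite addr0 -natr1; ring.
Qed.

(** Chebyshev's inequality. With 1/8, three exceptional sets together still leave mass at least
    1/2. *)
Lemma chebyshev_lists (e : R) : 0 < e -> exists K, forall N, (K <= N)%N ->
  \sum_(u <- lists N | ~~ (`|\sum_(x <- u) F x - N%:R * m| <= N%:R * e)) wt u <= 1 / 8.
Proof.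
move=> e0.
have v0 : 0 <= v by apply: sumr_ge0 => x _; rewrite mulr_ge0// sqr_ge0.
have [K _ hK] : \forall q \near \oo, 8 * v / e ^+ 2 < q%:R by exact: nbhs_infty_gtr.
exists K.+1 => N KN.
have N0 : 0 < N%:R :> R by rewrite ltr0n (leq_ltn_trans _ KN).
have NK : 8 * v < N%:R * e ^+ 2.
  by have /= := hK N (ltnW KN); rewrite ltr_pdivrMr// exprn_gt0.
have c0 : 0 < (N%:R * e) ^+ 2 by rewrite exprn_gt0// mulr_gt0.
rewrite -(ler_pM2r c0) mulr_suml.
apply: (@le_trans _ _ (N%:R * v)).
  rewrite -variance_lists big_mkcond/=; apply: ler_sum => u _.
  case: ifPn => h; last by rewrite mulr_ge0 ?wt_ge0// sqr_ge0.
  rewrite ler_wpM2l ?wt_ge0// -[leRHS]real_normK ?num_real//.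
  by rewrite ler_sqr ?nnegrE ?mulr_ge0// ?ltW// ltNge.
rewrite exprMn; have := ler_wpM2l (ltW N0) (ltW NK); rewrite expr2; lra.
Qed.

End Chebyshev.

(** The third observable is the information - ln p. It bounds the weight of a typical list by exp(-
    N (H - e)), with H the entropy of [p], so mass 1/2 requires at least half the inverse of that
    number of lists. *)
Lemma typical_lists (F G : X -> R) (e : R) : 0 < e ->
  let mF := \sum_x p x * F x in let mG := \sum_x p x * G x in
  exists K, forall N, (K <= N)%N -> exists W : seq (seq X), [/\ uniq W,
    forall u, u \in W -> [/\ size u = N, `|\sum_(x <- u) F x - N%:R * mF| <= N%:R * e &
      `|\sum_(x <- u) G x - N%:R * mG| <= N%:R * e] &
    expR (N%:R * (\sum_x xlnx (p x) - e)) <= 2 * (size W)%:R].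
Proof.
move=> e0 mF mG.
pose I x := - ln (p x); pose mI := \sum_x p x * I x.
have [K1 h1] := chebyshev_lists F e0; have [K2 h2] := chebyshev_lists G e0.
have [K3 h3] := chebyshev_lists I e0.
exists (maxn K1 (maxn K2 K3)) => N; rewrite !geq_max => /and3P[/h1 {}h1 /h2 {}h2 /h3 {}h3].
pose okF (u : seq X) := `|\sum_(x <- u) F x - N%:R * mF| <= N%:R * e.
pose okG (u : seq X) := `|\sum_(x <- u) G x - N%:R * mG| <= N%:R * e.
pose okI (u : seq X) := `|\sum_(x <- u) I x - N%:R * mI| <= N%:R * e.
(* The identity exp(- I x) = p x holds only where p x > 0, so lists of weight zero are discarded,
   without loss of mass. *)
pose ok u := [&& 0 < wt u, okF u, okG u & okI u].
exists [seq u <- lists N | ok u]; split.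
- by rewrite filter_uniq// uniq_lists.
- by move=> u; rewrite mem_filter => /andP[/and4P[_ hF hG _] /size_lists].
have hmass : 1 / 2 <= \sum_(u <- lists N | ok u) wt u.
  have : 1 <= \sum_(u <- lists N | ok u) wt u + (\sum_(u <- lists N | ~~ okF u) wt u +
     (\sum_(u <- lists N | ~~ okG u) wt u + \sum_(u <- lists N | ~~ okI u) wt u)).
    rewrite -(sum_wt N) !(big_mkcond (fun u => ~~ _ u)) (big_mkcond ok) -!big_split/=.
    apply: ler_sum => u _; rewrite /ok; have := wt_ge0 u.
    case: (okF u); case: (okG u); case: (okI u) => //=; rewrite ?andbF ?andbT; try lra.
    by rewrite le_eqVlt => /predU1P[<-|->]; rewrite ?ltxx; lra.
  move: h1 h2 h3; rewrite -/mI -/mF -/mG => h1 h2 h3.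
  have {}h1 : \sum_(u <- lists N | ~~ okF u) wt u <= 1 / 8 := h1.
  have {}h2 : \sum_(u <- lists N | ~~ okG u) wt u <= 1 / 8 := h2.
  have {}h3 : \sum_(u <- lists N | ~~ okI u) wt u <= 1 / 8 := h3.
  lra.
have -> : \sum_x xlnx (p x) = mI by apply: eq_bigr => x _; rewrite /xlnx /I mulrN.
have hw u : u \in lists N -> ok u -> wt u <= expR (- (N%:R * (mI - e))).
  move=> uN /and4P[w0 _ _]; rewrite /okI => hI.
  have hp x : x \in u -> 0 < p x.
    move=> xu; rewrite lt_neqAle p0 andbT eq_sym; apply/eqP => px.
    by move: w0; rewrite /wt (big_rem x)//= px mul0r ltxx.
  have -> : wt u = expR (- \sum_(x <- u) I x).
    rewrite -sumrN expR_sum; rewrite /wt; apply: eq_big_seq => x xu.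
    by rewrite opprK lnK// posrE hp.
  by rewrite ler_expR; move: hI; rewrite ler_norml; lra.
have : \sum_(u <- lists N | ok u) wt u <= (size [seq u <- lists N | ok u])%:R * expR (- (N%:R * (mI - e))).
  rewrite -big_filter mulr_natl -[size _]count_predT -iter_addr_0 -big_const_seq.
  rewrite big_seq [leRHS]big_seq; apply: ler_sum => u; rewrite mem_filter => /andP[ou uN].
  exact: hw.
rewrite expRN => h; have := le_trans hmass h.
rewrite ler_pdivlMr ?expR_gt0//; lra.
Qed.

End LawOfLargeNumbers.

(** * Many words with prescribed averages from an invariant measure *)

Section TypicalWords.
Variables (n : nat) (R : realType) (mu : probability (SigmaM n) R).
Variables (F G : Sigma n -> R) (c : R).
Hypotheses (inv : shift_invariant mu) (uF : ucont F) (uG : ucont G).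
Hypothesis hent : forall e : R, 0 < e -> exists K, forall k, (K <= k)%N ->
  k%:R * (c - e) <= Hcyl mu k.

Definition join k (u : seq (k.-tuple 'I_n.+1)) : seq 'I_n.+1 := flatten (map (@tval k _) u).

Lemma size_join k u : size (@join k u) = (size u * k)%N.
Proof.
elim: u => //= x u IH; rewrite /join /= size_cat size_tuple.
by rewrite -/(join u) IH mulSn.
Qed.

Lemma join_inj k u v : size u = size v -> @join k u = join v -> u = v.
Proof.
have sh w : shape (map (@tval k _) w) = nseq (size w) k :> seq nat.
  by elim: w => //= x w ->; rewrite size_tuple.
move=> suv h; apply: (@inj_map _ _ (@tval k _) val_inj).
by rewrite -(flattenK (map (@tval k _) u)) -(flattenK (map (@tval k _) v)) !sh suv -/(join u) h.
Qed.

Lemma bsum_add (H : Sigma n -> R) k l om :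
  bsum H (k + l) om = bsum H k om + bsum H l (shiftn k om).
Proof.
rewrite /bsum big_split_ord/=; congr (_ + _); apply: eq_bigr => i _.
by rewrite shiftnD addnC.
Qed.

Lemma bsum_join (H : Sigma n -> R) k (e : R) u om :
  (forall om om', sprefix om k = sprefix om' k -> `|bsum H k om - bsum H k om'| <= e) ->
  cyl (join u) om ->
  `|bsum H (size u * k) om - \sum_(x <- u) bsum H k (ext (x : k.-tuple 'I_n.+1))| <= (size u)%:R * e.
Proof.
move=> hH; elim: u om => [|x u IH] om.
  by move=> _; rewrite /bsum mul0n big_ord0 big_nil subrr normr0 mul0r.
rewrite /cyl /= size_join /= mulSn sprefix_add /join /= => /eqP.
rewrite eqseq_cat ?size_sprefix ?size_tuple// => /andP[/eqP h1 /eqP h2].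
have h3 : cyl (join u) (shiftn k om) by rewrite /cyl /= size_join.
have h4 := IH _ h3.
have h5 : `|bsum H k om - bsum H k (ext x)| <= e by apply: hH; rewrite h1 sprefix_ext_tuple.
rewrite bsum_add big_cons -natr1; move: h4 h5; rewrite !ler_norml; lra.
Qed.

Lemma typical_words (e : R) : 0 < e -> exists l (W : seq (seq 'I_n.+1)), [/\ (0 < l)%N, uniq W,
  forall w, w \in W -> size w = l,
  forall w om, w \in W -> cyl w om ->
    `|bsum F l om - l%:R * mean mu F| <= l%:R * e /\ `|bsum G l om - l%:R * mean mu G| <= l%:R * e &
  expR (l%:R * (c - e)) <= (size W)%:R].
Proof.
(* Three errors of size d per letter occur for each observable: inside the blocks, in the mean of
   the block law, and from typicality. For the cardinality, two are used, and what remains pays for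
   a constant factor. *)
move=> e0; pose d := e / 4; have d0 : 0 < d by rewrite divr_gt0.
have [K1 h1] := bsum_ucont uF d0; have [K2 h2] := bsum_ucont uG d0; have [K3 h3] := hent d0.
pose k := (K1 + (K2 + K3)).+1.
have {}h1 := h1 k (leqW (leq_addr _ _)).
have {}h2 : forall om om', sprefix om k = sprefix om' k -> `|bsum G k om - bsum G k om'| <= d * k%:R.
  by apply: h2; rewrite /k; lia.
have {}h3 : k%:R * (c - d) <= Hcyl mu k by apply: h3; rewrite /k; lia.
have k0 : 0 < k%:R :> R by rewrite ltr0n.
pose p (w : k.-tuple 'I_n.+1) := pr mu [set om : SigmaM n | pword om k = w].
have p0 w : 0 <= p w by exact: pr_ge0.
have p1 : \sum_w p w = 1 by apply: sum_pr1; exact: measurable_pword.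
have dk0 : 0 < d * k%:R by rewrite mulr_gt0.
have [K hK] := typical_lists p0 p1 (fun w => bsum F k (ext w)) (fun w => bsum G k (ext w)) dk0.
(* N d > 1 leaves room for a factor [expR 1], which exceeds the factor 2 lost in counting. *)
have [K' _ hK'] : \forall q \near \oo, 1 / d < q%:R by exact: nbhs_infty_gtr.
pose N := (K + K').+1.
have [W [uW hW szW]] := hK N (leqW (leq_addr _ _)).
have NK : 1 < N%:R * d.
  have /= := hK' N; rewrite ltr_pdivrMr//; apply; rewrite /N /=; lia.
have N0 : 0 < N%:R :> R by rewrite ltr0n.
have hm (H : Sigma n -> R) : ucont H ->
    (forall om om', sprefix om k = sprefix om' k -> `|bsum H k om - bsum H k om'| <= d * k%:R) ->
    `|k%:R * mean mu H - \sum_w p w * bsum H k (ext w)| <= d * k%:R.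
  move=> uH hH; rewrite -mean_bsum//.
  have := mean_approx mu (ucont_bsum k uH) hH; congr (`|_ - _| <= _).
  by apply: eq_bigr => w _; rewrite cyl_pword.
have hmF := hm F uF h1; have hmG := hm G uG h2.
have hfin (H : Sigma n -> R) u om : size u = N -> cyl (join u) om ->
    (forall om om', sprefix om k = sprefix om' k -> `|bsum H k om - bsum H k om'| <= d * k%:R) ->
    `|\sum_(w <- u) bsum H k (ext (w : k.-tuple 'I_n.+1)) - N%:R * (\sum_w p w * bsum H k (ext w))| <= N%:R * (d * k%:R) ->
    `|k%:R * mean mu H - \sum_w p w * bsum H k (ext w)| <= d * k%:R ->
    `|bsum H (N * k) om - (N * k)%:R * mean mu H| <= (N * k)%:R * e.
  move=> su hu hH hs hmH; have := bsum_join hH hu; rewrite su natrM => hj.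
  have : `|N%:R * (k%:R * mean mu H) - N%:R * (\sum_w p w * bsum H k (ext w))| <= N%:R * (d * k%:R).
    by rewrite -mulrBr normrM normr_nat ler_wpM2l.
  have -> : N%:R * k%:R * e = 4 * (N%:R * (d * k%:R)) by rewrite /d; field.
  have : 0 <= N%:R * (d * k%:R) by rewrite mulr_ge0 ?ltW.
  move: hj hs; rewrite !ler_norml; lra.
exists (N * k)%N, (map (@join k) W); split.
- by rewrite muln_gt0.
- rewrite map_inj_in_uniq// => u v /hW[su _ _] /hW[sv _ _].
  by apply: join_inj; rewrite su sv.
- by move=> _ /mapP[u /hW[su _ _] ->]; rewrite size_join su.
- move=> _ om /mapP[u /hW[su hu1 hu2] ->] hom; split; exact: (hfin _ u).
- rewrite size_map.
  have : expR 1 * expR ((N * k)%:R * (c - e)) <= expR (N%:R * (\sum_x xlnx (p x) - d * k%:R)).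
    rewrite -expRD ler_expR natrM.
    have : N%:R * (k%:R * (c - d)) <= N%:R * (\sum_x xlnx (p x)) by rewrite ler_wpM2l// ltW.
    have : 1 <= N%:R * d * k%:R.
      by apply: le_trans (ltW NK) _; apply: ler_peMr; [rewrite mulr_ge0// ltW|rewrite ler1n].
    by rewrite /d; lra.
  move=> /le_trans/(_ szW).
  have h : 2 <= expR 1 :> R by have := expR_ge1Dx (1 : R); lra.
  have := ler_wpM2r (expR_ge0 ((N * k)%:R * (c - e))) h; lra.
Qed.

End TypicalWords.

(** * Moran sets and their uniform measures *)

Section Moran.
Variables (n : nat) (R : realType) (l : nat -> nat) (V : nat -> seq (seq 'I_n.+1)).
Hypothesis l_gt0 : forall j, (0 < l j)%N.
Hypothesis uniqV : forall j, uniq (V j).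
Hypothesis sizeV : forall j w, w \in V j -> size w = l j.
Hypothesis V_neq0 : forall j, (0 < size (V j))%N.

Fixpoint level j : seq (seq 'I_n.+1) :=
  if j is j'.+1 then [seq u ++ v | u <- level j', v <- V j'] else [:: [::]].

Definition pos j := (\sum_(i < j) l i)%N.

Lemma posS j : pos j.+1 = (pos j + l j)%N.
Proof. by rewrite /pos big_ord_recr. Qed.

Lemma pos_ge j : (j <= pos j)%N.
Proof. by elim: j => // j IH; rewrite posS; have := l_gt0 j; lia. Qed.

Lemma size_level j u : u \in level j -> size u = pos j.
Proof.
elim: j u => [|j IH] u /=; first by rewrite inE /pos big_ord0 => /eqP ->.
move=> /allpairsP[[x y] /= [/IH sx /sizeV sy ->]].
by rewrite size_cat sx sy posS.
Qed.

Lemma cat_inj (x x' y y' : seq 'I_n.+1) : size x = size x' -> x ++ y = x' ++ y' ->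
  x = x' /\ y = y'.
Proof. by move=> s /eqP; rewrite eqseq_cat// => /andP[/eqP -> /eqP ->]. Qed.

Lemma uniq_level j : uniq (level j).
Proof.
elim: j => //= j IH; apply: allpairs_uniq => // -[x y] [x' y'].
move=> /allpairsP[[a b] /= [ha _ [-> ->]]] /allpairsP[[a' b'] /= [ha' _ [-> ->]]].
by move=> /cat_inj[|-> ->//]; rewrite (size_level ha) (size_level ha').
Qed.

Lemma size_levelS j : size (level j.+1) = (size (level j) * size (V j))%N.
Proof. by rewrite /= size_allpairs. Qed.

Lemma level_neq0 j : (0 < size (level j))%N.
Proof. by elim: j => // j IH; rewrite size_levelS muln_gt0 IH V_neq0. Qed.

Definition cnt j (w : seq 'I_n.+1) := count (fun x => take (size w) x == w) (level j).

Lemma cntS j w : (size w <= pos j)%N -> cnt j.+1 w = (cnt j w * size (V j))%N.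
Proof.
move=> hw; rewrite /cnt /= count_flatten -map_comp /=.
have h (s : seq (seq 'I_n.+1)) : {subset s <= level j} ->
  sumn [seq count (fun x => take (size w) x == w) [seq x ++ v | v <- V j] | x <- s] =
  (count (fun x => take (size w) x == w) s * size (V j))%N.
  elim: s => //= x s IH hs.
  have sx : size x = pos j by apply: size_level; apply: hs; rewrite inE eqxx.
  rewrite IH; last by move=> y ys; apply: hs; rewrite inE ys orbT.
  rewrite count_map mulnDl; congr (_ + _)%N.
  rewrite (eq_count (a2 := fun _ => take (size w) x == w)).
    by case: eqP => _; rewrite ?count_predT ?count_pred0 ?mul1n ?mul0n.
  by move=> v /=; rewrite takel_cat// sx.
by rewrite -h.
Qed.

(** The share of the words of a late generation that begin with [w]. Generation [size w] is late
    enough, since each generation adds at least one letter. *)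
Definition weight (w : seq 'I_n.+1) : R := (cnt (size w) w)%:R / (size (level (size w)))%:R.

Lemma weightE j w : (size w <= j)%N -> weight w = (cnt j w)%:R / (size (level j))%:R.
Proof.
move=> wj; rewrite -(subnKC wj); elim: (j - size w)%N => [|i IH]; first by rewrite addn0.
rewrite IH addnS cntS; last by apply: leq_trans (pos_ge _); exact: leq_addr.
rewrite size_levelS !natrM invfM mulrACA divff ?mulr1// pnatr_eq0 -lt0n.
exact: V_neq0.
Qed.

(** The share of words beginning with a given prefix is the same in all generations long enough to
    contain it, which makes the weights consistent. *)
Lemma moran_measure : exists nu : probability (SigmaM n) R, forall j u, u \in level j ->
  pr nu (cyl u) = (size (level j))%:R^-1.
Proof.
have w0 w : 0 <= weight w by rewrite divr_ge0.
have w1 : weight [::] = 1 by rewrite /weight /cnt /= divr1.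
have wr w : weight w = \sum_a weight (rcons w a).
  rewrite (@weightE (size w).+1)//; under eq_bigr do rewrite (@weightE (size w).+1) ?size_rcons//.
  rewrite -mulr_suml -natr_sum; congr (_%:R / _); rewrite /cnt.
  have : {in level (size w).+1, forall x, (size w < size x)%N}.
    by move=> x /size_level ->; exact: pos_ge.
  elim: (level _) => [|x s IH] hs; first by rewrite big1.
  rewrite /= IH; last by move=> y ys; apply: hs; rewrite inE ys orbT.
  under [RHS]eq_bigr do rewrite /=; rewrite big_split/=; congr (_ + _)%N.
  have sx : (size w < size x)%N by apply: hs; rewrite inE eqxx.
  have tx a : (take (size (rcons w a)) x == rcons w a) =
      (take (size w) x == w) && (nth ord0 x (size w) == a).
    by rewrite size_rcons (take_nth ord0)// eqseq_rcons.
  rewrite (bigD1 (nth ord0 x (size w)))//= big1 => [|a ne].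
    by rewrite addn0 tx eqxx andbT.
  by rewrite tx [_ == a]eq_sym (negbTE ne) andbF.
have [nu hnu] := coding_probability w0 w1 wr.
exists nu => j u uj; rewrite hnu (@weightE (pos j)); last by rewrite (size_level uj).
(* The weight is known at generation [pos j]; each generation beyond j multiplies numerator and
   denominator by the same number. *)
have -> : (cnt (pos j) u)%:R / (size (level (pos j)))%:R = (cnt j u)%:R / (size (level j))%:R :> R.
  rewrite -(subnKC (pos_ge j)); elim: (pos j - j)%N => [|i IH]; first by rewrite addn0.
  rewrite -IH addnS cntS; last first.
    rewrite (size_level uj); elim: i {IH} => [|i IH]; first by rewrite addn0.
    by apply: leq_trans IH _; rewrite addnS posS leq_addr.
  rewrite size_levelS !natrM invfM mulrACA divff ?mulr1// pnatr_eq0 -lt0n.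
  exact: V_neq0.
rewrite /cnt (eq_in_count (a2 := pred1 u)).
  by rewrite count_uniq_mem ?uj ?mul1r//; exact: uniq_level.
by move=> x xj /=; rewrite (size_level uj) -(size_level xj) take_size.
Qed.

Definition moran_set : set (Sigma n) := [set om | forall j, sprefix om (pos j) \in level j].

End Moran.

Section MoranAverages.
Variables (n : nat) (R : realType) (l : nat -> nat) (V : nat -> seq (seq 'I_n.+1)).
Variable eps : nat -> R.
Hypothesis l_gt0 : forall j, (0 < l j)%N.
Hypothesis sizeV : forall j w, w \in V j -> size w = l j.
Hypothesis eps_to0 : forall e : R, 0 < e -> exists J, forall j, (J <= j)%N -> eps j <= e.
Hypothesis l_small : forall e : R, 0 < e -> exists J, forall j, (J <= j)%N ->
  (l j)%:R <= e * j%:R.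

Definition err j : R := \sum_(i < j) (l i)%:R * eps i.

(** A weighted Cesàro mean of the errors: the first J terms are a constant [C], the later ones are
    at most e/2 per letter. *)
Lemma err_small e : 0 < e -> exists J, forall j, (J <= j)%N -> err j <= e * (pos l j)%:R.
Proof.
move=> e0; have e2 := divr_gt0 e0 (ltr0Sn R 1).
have [J hJ] := eps_to0 e2.
pose C := \sum_(i < J) `|(l i)%:R * eps i|.
have [K _ hK] : \forall q \near \oo, C / (e / 2) < q%:R by exact: nbhs_infty_gtr.
exists (J + K)%N => j hj.
have key i : err (J + i) <= C + e / 2 * (pos l (J + i))%:R.
  elim: i => [|i IH].
    rewrite addn0 /err; apply: (@le_trans _ _ C); first by apply: ler_sum => i _; exact: ler_norm.
    by rewrite lerDl mulr_ge0// ltW.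
  rewrite addnS /err big_ord_recr/= -/(err _) posS natrD.
  have : (l (J + i))%:R * eps (J + i)%N <= (l (J + i))%:R * (e / 2).
    by rewrite ler_wpM2l// hJ// leq_addr.
  move: IH; lra.
have := key (j - J)%N; rewrite subnKC; last by lia.
have : C <= e / 2 * (pos l j)%:R.
  have /= := hK j; rewrite ltr_pdivrMr// => hKj.
  have {}hKj : C < j%:R * (e / 2) by apply: hKj; lia.
  apply: le_trans (ltW hKj) _; rewrite mulrC ler_wpM2l ?(ltW e2)// ler_nat.
  exact: pos_ge.
lra.
Qed.

Variables (H : Sigma n -> R) (m : R).
Hypothesis hV : forall j w om, w \in V j -> cyl w om ->
  `|bsum H (l j) om - (l j)%:R * m| <= (l j)%:R * eps j.

Lemma bsum_level j u om : u \in level V j -> cyl u om ->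
  `|bsum H (pos l j) om - (pos l j)%:R * m| <= err j.
Proof.
elim: j u om => [|j IH] u om.
  by move=> _ _; rewrite /pos /err !big_ord0 /bsum big_ord0 mul0r subrr normr0.
move=> /allpairsP[[x y] /= [hx hy ->]].
have sx := size_level sizeV hx; have sy := sizeV hy.
rewrite /cyl /= size_cat sx sy sprefix_add => /eqP.
rewrite eqseq_cat ?size_sprefix ?sx// => /andP[/eqP h1 /eqP h2].
have h3 := IH x om hx; rewrite {1}/cyl /= sx in h3; have {}h3 := h3 h1.
have h4 := @hV j y (shiftn (pos l j) om) hy; rewrite {1}/cyl /= sy in h4; have {}h4 := h4 h2.
rewrite posS bsum_add /err big_ord_recr/= -/(err j) natrD.
move: h3 h4; rewrite !ler_norml; lra.
Qed.

(** A time k falls inside some block. The complete blocks are controlled by [err], the incomplete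
    one by its length, which is small compared with its index and so with k. *)
Lemma moran_average : ucont H -> forall om, moran_set l V om ->
  forall e : R, 0 < e -> exists K, forall k, (K <= k)%N -> `|bsum H k om - k%:R * m| <= k%:R * e.
Proof.
move=> uH om hom e e0; have [M hM] := ucont_bounded uH.
have M0 : 0 <= M by apply: le_trans (hM point); exact: normr_ge0.
(* Cost per letter of the incomplete block, in the Birkhoff sum and in the comparison value k m; the
   1 keeps it positive. *)
pose B := M + `|m| + 1; have B0 : 0 < B by rewrite /B; have := normr_ge0 m; lra.
have e2 := divr_gt0 e0 (ltr0Sn R 1).
have [J1 h1] := err_small e2.
have [J2 h2] := l_small (divr_gt0 e2 B0).
exists (pos l (J1 + J2)) => k hk.
have [j [jk kj]] : exists j, (pos l j <= k < pos l j.+1)%N /\ (J1 + J2 <= j)%N.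
  have ex : exists j, (k < pos l j.+1)%N by exists k; exact: (pos_ge l_gt0 k.+1).
  have [j hj hmin] := ex_minnP ex; exists j; split.
    rewrite hj andbT; case: j hj hmin => [|j] hj hmin; first by rewrite /pos big_ord0.
    by rewrite leqNgt; apply/negP => /hmin; rewrite ltnn.
  rewrite leqNgt; apply/negP => jJ; move: hj; rewrite ltnNge => /negP; apply.
  apply: leq_trans hk; rewrite -(subnKC jJ); elim: (J1 + J2 - j.+1)%N => [|i IH]; first by rewrite addn0.
  by rewrite addnS [leqRHS]posS (leq_trans IH)// leq_addr.
case/andP: jk => jk kj'.
have hj := @bsum_level j _ om (hom j) (cyl_sprefix _ _).
have {}h1 : err j <= e / 2 * (pos l j)%:R by apply: h1; lia.
have {}h2 : (l j)%:R * B <= e / 2 * j%:R.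
  have := h2 j; rewrite mulrAC ler_pdivlMr//; apply; lia.
have hr : `|bsum H (k - pos l j) (shiftn (pos l j) om)| <= (k - pos l j)%:R * M.
  apply: le_trans (ler_norm_sum _ _ _) _.
  apply: (@le_trans _ _ (\sum_(i < k - pos l j) M)); first by apply: ler_sum.
  by rewrite sumr_const card_ord mulr_natl.
have hkp : (k - pos l j)%:R <= (l j)%:R :> R.
  by rewrite ler_nat; move: kj'; rewrite posS; lia.
have jk' : j%:R <= k%:R :> R by rewrite ler_nat (leq_trans _ jk)// pos_ge.
have pk : (pos l j)%:R <= k%:R :> R by rewrite ler_nat.
rewrite -{1 2}(subnKC jk) bsum_add natrD.
have h5 : `|(k - pos l j)%:R * m| <= (k - pos l j)%:R * `|m| by rewrite normrM normr_nat.
have h6 : (k - pos l j)%:R * B <= (l j)%:R * B by rewrite ler_wpM2r// ltW.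
have h7 : e / 2 * j%:R <= e / 2 * k%:R by rewrite ler_wpM2l// ltW.
have h8 : e / 2 * (pos l j)%:R <= e / 2 * k%:R by rewrite ler_wpM2l// ltW.
have h9 : 0 <= (k - pos l j)%:R :> R by [].
have {}h6 : (k - pos l j)%:R * M + (k - pos l j)%:R * `|m| <= e / 2 * k%:R.
  apply: le_trans (le_trans (le_trans _ h6) h2) h7.
  by rewrite /B !mulrDr mulr1 lerDl.
move: hj hr h5; rewrite !ler_norml.
move: (k%:R) ((pos l j)%:R) ((k - pos l j)%:R) h6 h8 h1 => kk pp qq; lra.
Qed.

End MoranAverages.

(** * Mass distribution on the Moran set *)

Section LowerBound.
Variables (R : realType) (n : nat) (T T' : 'I_n.+1 -> R -> R).
Hypothesis hTmap : forall i x, I01 x -> I01 (T i x).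
Hypothesis hC1 : forall i, C1_on01 (T i) (T' i).
Hypothesis hpos : forall i x, I01 x -> 0 < T' i x.
Hypothesis hdisj : forall i j : 'I_n.+1, i != j -> T i @` I01o `&` T j @` I01o = set0.
Hypothesis hdiam : forall e : R, 0 < e -> exists N : nat, forall k, (N <= k)%N ->
     forall om : Sigma n, (diamE (compw T (sprefix om k) @` I01) < e%:E)%E.
Let g := geom T T'.

(** Among three intervals met by [U], the middle one, longer than r, would separate two points of
    [U] at distance at most r. *)
Lemma hits_le2 (U : set R) (r : R) (s : seq (seq 'I_n.+1)) k :
  uniq s -> (forall u, u \in s -> size u = k) ->
  (forall u, u \in s -> r < len T u) ->
  (forall u, u \in s -> exists2 x, U x & lo T u <= x <= hi T u) ->
  (forall x y, U x -> U y -> `|x - y| <= r) -> (size s <= 2)%N.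
Proof.
case: s => [|u1 [|u2 [|u3 s]]]// us hs hl hU hd; exfalso.
have i1 : u1 \in [:: u1, u2, u3 & s] by rewrite inE eqxx.
have i2 : u2 \in [:: u1, u2, u3 & s] by rewrite !inE eqxx orbT.
have i3 : u3 \in [:: u1, u2, u3 & s] by rewrite !inE eqxx !orbT.
move: us; rewrite /= !inE !negb_or => /andP[/and3P[n12 n13 _] /andP[/andP[n23 _] _]].
have s12 := words_separated hTmap hC1 hpos hdisj (etrans (hs _ i1) (esym (hs _ i2))) n12.
have s13 := words_separated hTmap hC1 hpos hdisj (etrans (hs _ i1) (esym (hs _ i3))) n13.
have s23 := words_separated hTmap hC1 hpos hdisj (etrans (hs _ i2) (esym (hs _ i3))) n23.
have [x1 U1 /andP[a1 b1]] := hU _ i1; have [x2 U2 /andP[a2 b2]] := hU _ i2.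
have [x3 U3 /andP[a3 b3]] := hU _ i3.
have := hl _ i1; have := hl _ i2; have := hl _ i3; rewrite /len => l3 l2 l1.
have := hd _ _ U1 U2; have := hd _ _ U1 U3; have := hd _ _ U2 U3.
rewrite !ler_norml => /andP[d1 d2] /andP[d3 d4] /andP[d5 d6].
by case: s12 => ?; case: s13 => ?; case: s23 => ?; lra.
Qed.

Variables (l : nat -> nat) (V : nat -> seq (seq 'I_n.+1)) (eps : nat -> R) (lam c t : R).
Hypothesis l_gt0 : forall j, (0 < l j)%N.
Hypothesis uniqV : forall j, uniq (V j).
Hypothesis sizeV : forall j w, w \in V j -> size w = l j.
Hypothesis eps_to0 : forall e : R, 0 < e -> exists J, forall j, (J <= j)%N -> eps j <= e.
Hypothesis l_small : forall e : R, 0 < e -> exists J, forall j, (J <= j)%N ->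
  (l j)%:R <= e * j%:R.
Hypothesis hVg : forall j w om, w \in V j -> cyl w om ->
  `|bsum g (l j) om - (l j)%:R * lam| <= (l j)%:R * eps j.
Hypothesis cardV : forall j, expR ((l j)%:R * (c - eps j)) <= (size (V j))%:R.
Hypotheses (lam0 : 0 < lam) (t0 : 0 < t) (tlam : t * lam < c).

Let V_neq0 j : (0 < size (V j))%N.
Proof. by rewrite -(ltr0n R); apply: lt_le_trans (cardV j); exact: expR_gt0. Qed.

Lemma card_level j : expR ((pos l j)%:R * c - err l eps j) <= (size (level V j))%:R.
Proof.
elim: j => [|j IH]; first by rewrite /pos /err !big_ord0 mul0r subrr expR0.
rewrite size_levelS natrM posS /err big_ord_recr/= -/(err l eps j) natrD.
have -> : ((pos l j)%:R + (l j)%:R) * c - (err l eps j + (l j)%:R * eps j) =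
   ((pos l j)%:R * c - err l eps j) + (l j)%:R * (c - eps j) by ring.
by rewrite expRD; apply: ler_pM; rewrite ?expR_ge0.
Qed.

Lemma moran_not_null : ~ null_set t (projPi T @` moran_set l V).
Proof.
(* This is the condition that yields t (1 + de) (lam + 2 de) <= c - de, once de^2 is bounded by
   de. *)
have [de [de0 de1 deA]] : exists de : R,
    [/\ 0 < de, de <= 1 & de * (t * (4 + lam) + 1) <= c - t * lam].
  have A0 : 0 < t * (4 + lam) + 1 by rewrite ltr_wpDl// mulr_ge0 ?addr_ge0// ltW.
  exists (Num.min 1 ((c - t * lam) / (t * (4 + lam) + 1))); split.
  - by rewrite lt_min ltr01 divr_gt0// subr_gt0.
  - by rewrite ge_min lexx.
  - by rewrite -ler_pdivlMr// ge_min lexx orbT.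
(* Rate of a lower bound for interval lengths: one [de] pays for the averages of [g], the other for
   the distortion. *)
pose be := lam + 2 * de; have beE : be = lam + 2 * de by [].
clearbody be.
have be0 : 0 < be by rewrite beE addr_gt0// mulr_gt0.
have hexp : t * ((1 + de) * be) <= c - de.
  have h : t * (de * de) <= t * de by rewrite ler_pM2l// ler_piMr// ltW.
  have -> : t * ((1 + de) * be) = t * lam + 2 * (t * de) + t * de * lam + 2 * (t * (de * de)).
    by rewrite beE; ring.
  have e1 : de * (t * (4 + lam) + 1) = 4 * (t * de) + t * de * lam + de by ring.
  rewrite e1 in deA; lra.
have [J1 h1] := err_small l_gt0 eps_to0 de0.
have [J2 h2] := l_small de0.
have [N3 h3] := len_distortion hTmap hC1 hpos hdiam de0.
pose J := (J1 + (J2 + N3))%N.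
have JJ1 j : (J <= j)%N -> (J1 <= j)%N by exact: leq_trans (leq_addr _ _).
have JJ2 j : (J <= j)%N -> (J2 <= j)%N.
  by apply: leq_trans; exact: leq_trans (leq_addr _ _) (leq_addl _ _).
have JN3 j : (J <= j)%N -> (N3 <= j)%N.
  by apply: leq_trans; exact: leq_trans (leq_addl _ _) (leq_addl _ _).
pose a j := expR (- ((pos l j)%:R * be)).
have a0 j : 0 < a j by exact: expR_gt0.
have len_level j u : (J <= j)%N -> u \in level V j -> a j <= len T u.
  move=> Jj uj; have su := size_level sizeV uj.
  have hu : cyl u (ext u) by exact: sprefix_ext.
  have hS := bsum_level sizeV hVg uj hu.
  have hJ : (pos l j >= j)%N by exact: pos_ge.
  have := h3 (pos l j) _ (ext u); rewrite -{2}su sprefix_ext => /(_ _).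
  have N3p : (N3 <= pos l j)%N by apply: leq_trans hJ; exact: JN3.
  move=> /(_ N3p) hlen.
  have he := h1 j (JJ1 j Jj).
  rewrite /a -[len T u]lnK ?posrE ?(len_gt0 hTmap hC1 hpos)// ler_expR.
  move: hS hlen; rewrite -/g !ler_norml beE; lra.
have [nu hnu] := moran_measure R l_gt0 uniqV sizeV V_neq0.
(* Sets of diameter at most d are smaller than the scale of generation [J], so they are compared
   only with later generations, where all estimates hold. *)
pose d := a J / 2; have d0 : 0 < d by rewrite divr_gt0.
(* The first term keeps [rho k] below d; the second makes the final total 4 eta at most 1/2. *)
pose eta := Num.min (d `^ t) (1 / 8).
have eta0 : 0 < eta by rewrite lt_min powR_gt0// divr_gt0.
move=> /(_ d eta d0 eta0)[U [Ucov Ud Usum]].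
(* [rho k] gives covering sets of diameter 0 a positive size at negligible cost. *)
pose rho k := (eta / (2 ^ k.+1)%:R) `^ t^-1.
have rhot k : rho k `^ t = eta / (2 ^ k.+1)%:R.
  rewrite /rho -powRrM mulVf ?gt_eqF// powRr1// divr_ge0//; exact: ltW.
have rho0 k : 0 < rho k by rewrite powR_gt0// divr_gt0// ltr0n expn_gt0.
have rhod k : rho k <= d.
  have -> : d = (d `^ t) `^ t^-1 by rewrite -powRrM mulfV ?gt_eqF// powRr1// ltW.
  apply: ge0_ler_powR; rewrite ?invr_ge0 ?nnegrE ?powR_ge0 ?divr_ge0 ?(ltW t0) ?(ltW eta0)//.
  apply: (@le_trans _ _ eta); last by rewrite ge_min lexx.
  by rewrite ler_pdivrMr ?ltr0n ?expn_gt0// ler_peMr ?ler1n ?expn_gt0// ltW.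
pose dm k := fine (diamE (U k)).
have dmE k : diamE (U k) = (dm k)%:E.
  rewrite /dm fineK// ge0_fin_numE ?diamE_ge0//.
  by apply: le_lt_trans (Ud k) _; rewrite ltry.
have dm0 k : 0 <= dm k by rewrite -lee_fin -dmE diamE_ge0.
have dmd k : dm k <= d by rewrite -lee_fin -dmE.
pose r k := Num.max (dm k) (rho k).
have r0 k : 0 < r k by rewrite lt_max rho0 orbT.
have rd k : r k <= d by rewrite ge_max dmd rhod.
have rt k : r k `^ t <= dm k `^ t + eta / (2 ^ k.+1)%:R.
  rewrite /r; case: (leP (dm k) (rho k)) => _; first by rewrite rhot lerDr powR_ge0.
  by rewrite lerDl divr_ge0// ltW.
have Udiam k x y : U k x -> U k y -> `|x - y| <= r k.
  move=> Ux Uy; rewrite le_max; apply/orP; left; rewrite -lee_fin -dmE.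
  by apply: ereal_sup_ubound; right; exists x, y.
have gen k : exists j, [/\ (J <= j)%N, r k < a j & a j.+1 <= r k].
  have ex : exists j, a j <= r k.
    (* Scales tend to 0, so there is a first one not exceeding [r k]; the generation just before it
       is the one to count in. *)
    have [K _ hK] : \forall q \near \oo, - ln (r k) / be < q%:R by exact: nbhs_infty_gtr.
    exists K; rewrite -[r k]lnK ?posrE// ler_expR.
    have /= := hK K (leqnn _); rewrite ltr_pdivrMr// => h.
    have : K%:R * be <= (pos l K)%:R * be.
      by rewrite ler_pM2r// ler_nat pos_ge.
    lra.
  have [j hj hmin] := ex_minnP ex.
  have Jj : (J < j)%N.
    rewrite ltnNge; apply/negP => jJ.
    have : a J <= a j.
      rewrite ler_expR lerN2 ler_pM2r// ler_nat -(subnKC jJ).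
      by elim: (J - j)%N => [|i IH]; rewrite ?addn0// addnS posS (leq_trans IH)// leq_addr.
    move=> h; have := le_trans h (le_trans hj (rd k)).
    by rewrite /d; have := a0 J; lra.
  case: j hj hmin Jj => // j hj hmin Jj; exists j; split => //.
  by rewrite ltNge; apply/negP => /hmin; rewrite ltnn.
have [jj hjj] := choice gen.
pose hit k (u : seq 'I_n.+1) := `[< exists2 x, U k x & lo T u <= x <= hi T u >].
pose hits k := [seq u <- level V (jj k) | hit k u].
have size_hits k : (size (hits k) <= 2)%N.
  have [Jk rk _] := hjj k.
  apply: (@hits_le2 (U k) (r k) _ (pos l (jj k))).
  - by rewrite filter_uniq// (uniq_level uniqV sizeV).
  - by move=> u; rewrite mem_filter => /andP[_ /(size_level sizeV)].
  - by move=> u; rewrite mem_filter => /andP[_ /(len_level _ _ Jk)]; exact: lt_le_trans.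
  - by move=> u; rewrite mem_filter => /andP[/asboolP].
  - exact: Udiam.
(* One word of the chosen generation has mass at most exp(- pos (c - de)), while [r k] is at least
   the next scale. The step to the next generation costs the factor 1 + de in the exponent, by
   [l_small]. *)
have mr k : (size (level V (jj k)))%:R^-1 <= r k `^ t.
  have [Jk _ ak] := hjj k.
  have p1 := h1 (jj k) (JJ1 _ Jk).
  have p2 := h2 (jj k) (JJ2 _ Jk).
  apply: (@le_trans _ _ (expR (- ((pos l (jj k))%:R * (c - de))))).
    rewrite expRN lef_pV2 ?posrE ?expR_gt0 ?ltr0n ?level_neq0//.
    by apply: le_trans (card_level _); rewrite ler_expR; lra.
  apply: (@le_trans _ _ (a (jj k).+1 `^ t)); last first.
    by apply: ge0_ler_powR => //; rewrite ?nnegrE; exact: ltW.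
  rewrite /powR gt_eqF// ler_expR /a expRK.
  have h4 : (pos l (jj k).+1)%:R <= (pos l (jj k))%:R * (1 + de).
    rewrite posS natrD mulrDr mulr1 lerD2l; apply: le_trans p2 _.
    by rewrite mulrC ler_pM2r// ler_nat pos_ge.
  have h5 : t * ((pos l (jj k).+1)%:R * be) <= t * ((pos l (jj k))%:R * (1 + de) * be).
    by rewrite ler_pM2l// ler_pM2r.
  have h6 : (pos l (jj k))%:R * (t * ((1 + de) * be)) <= (pos l (jj k))%:R * (c - de).
    by rewrite ler_wpM2l.
  lra.
(* Points off the Moran set leave it at some generation. Adding these [nu]-null complements makes
   the sets [C k] cover the whole space, and only cylinders are measured, never the sets [U k]. *)
pose bad k : set (SigmaM n) := ~` (\big[setU/set0]_(u <- level V k) cyl u).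
pose C k : set (SigmaM n) := (\big[setU/set0]_(u <- hits k) cyl u) `|` bad k.
have mU (s : seq (seq 'I_n.+1)) : measurable (\big[setU/set0]_(u <- s) cyl u : set (SigmaM n)).
  by apply: bigsetU_measurable => u _; exact: measurable_cyl.
have memU (s : seq (seq 'I_n.+1)) om :
    (\big[setU/set0]_(u <- s) cyl u : set (SigmaM n)) om <-> exists2 u, u \in s & cyl u om.
  elim: s => [|u s IH]; first by rewrite big_nil; split => // -[].
  rewrite big_cons; split=> [[h|/IH[v vs h]]|[v]].
  - by exists u => //; rewrite inE eqxx.
  - by exists v => //; rewrite inE vs orbT.
  - by rewrite inE => /predU1P[->|vs h]; [left|right; apply/IH; exists v].
have pr_level k : pr nu (\big[setU/set0]_(u <- level V k) cyl u) = 1.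
  suff h (s : seq (seq 'I_n.+1)) : uniq s -> {subset s <= level V k} ->
      pr nu (\big[setU/set0]_(u <- s) cyl u) = (size s)%:R / (size (level V k))%:R.
    rewrite h ?(uniq_level uniqV sizeV)// divff// pnatr_eq0 -lt0n level_neq0//.
  elim: s => [|u s IH]; first by rewrite big_nil pr0 mul0r.
  move=> /= /andP[us us'] hs; rewrite big_cons pr_setU//; last 2 first.
  - exact: measurable_cyl.
  - apply/seteqP; split => // om [h1' /memU[v vs h2']].
    have su := size_level sizeV (hs u (mem_head _ _)).
    have sv : size v = pos l k by apply: (size_level sizeV); apply: hs; rewrite inE vs orbT.
    by move: us; rewrite -h1' su -sv h2' vs.
  rewrite IH//; last by move=> v vs; apply: hs; rewrite inE vs orbT.
  rewrite (hnu k)//; last by apply: hs; exact: mem_head.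
  by rewrite -[(size s).+1]add1n natrD mulrDl mul1r.
have mC k : measurable (C k) by apply: measurableU => //; exact: measurableC.
have prC k : pr nu (C k) <= 2 * (dm k `^ t + eta / (2 ^ k.+1)%:R).
  apply: le_trans (le_pr_setU _ _ _) _ => //; first exact: measurableC.
  rewrite pr_setC// pr_level subrr addr0.
  apply: le_trans (le_pr_bigsetU _ _ _ (fun u => measurable_cyl u)) _.
  apply: (@le_trans _ _ (\sum_(u <- hits k) (size (level V (jj k)))%:R^-1)).
    rewrite big_seq [leRHS]big_seq; apply: ler_sum => u; rewrite mem_filter => /andP[_ uj].
    by rewrite (hnu (jj k)).
  rewrite big_const_seq count_predT iter_addr_0 -[_ *+ _]mulr_natl.
  apply: ler_pM => //; first by rewrite (ler_nat R _ 2).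
  exact: le_trans (mr k) (rt k).
have cov : \bigcup_k C k = setT.
  apply/seteqP; split => // om _.
  have [hom|/existsNP[k hk]] := pselect (moran_set l V om).
    have [k _ Uk] := Ucov _ (ex_intro2 _ _ om hom erefl).
    exists k => //; left; apply/memU; exists (sprefix om (pos l (jj k))); last exact: cyl_sprefix.
    rewrite mem_filter hom andbT; apply/asboolP; exists (projPi T om) => //.
    exact: projPi_between.
  exists k => //; right => /memU[u uk hu]; apply: hk.
  by rewrite -(size_level sizeV uk) hu.
have : (1 <= \sum_(0 <= k <oo) nu (C k))%E.
  rewrite -(probability_setT nu) -cov; apply: measure_sigma_subadditive => //.
  by rewrite cov.
apply/negP; rewrite -ltNge.
have sumle : (\sum_(0 <= k <oo) nu (C k) <= 2%:E * (eta%:E + eta%:E))%E.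
  apply: (@le_trans _ _ (\sum_(0 <= k <oo) (2%:E * ((dm k `^ t)%:E + (eta / (2 ^ k.+1)%:R)%:E)))%E).
    apply: lee_nneseries => // k _.
    by rewrite prE// -EFinD -EFinM lee_fin.
  rewrite nneseriesZl; last by move=> k _; rewrite -EFinD lee_fin addr_ge0 ?powR_ge0// divr_ge0// ltW.
  apply: lee_wpmul2l => //.
  apply: le_trans (epsilon_trick _ _ (ltW eta0)) _; first by move=> k; rewrite lee_fin powR_ge0.
  by rewrite leeD2r.
apply: le_lt_trans sumle _.
rewrite -EFinD -EFinM lte_fin.
have : eta <= 1 / 8 by rewrite ge_min lexx orbT.
lra.
Qed.

End LowerBound.

(** * A Moran set inside the level set *)

Section LevelSets.
Variables (R : realType) (n : nat) (T T' : 'I_n.+1 -> R -> R).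
Hypothesis hTmap : forall i x, I01 x -> I01 (T i x).
Hypothesis hC1 : forall i, C1_on01 (T i) (T' i).
Hypothesis hpos : forall i x, I01 x -> 0 < T' i x.
Hypothesis hdisj : forall i j : 'I_n.+1, i != j -> T i @` I01o `&` T j @` I01o = set0.
Hypothesis hdiam : forall e : R, 0 < e -> exists N : nat, forall k, (N <= k)%N ->
     forall om : Sigma n, (diamE (compw T (sprefix om k) @` I01) < e%:E)%E.
Let g := geom T T'.
Let ug : ucont g := ucont_geom hTmap hC1 hpos hdiam.

Lemma mem_tildeSigma om (lam : R) : 0 < lam ->
  (exists K, forall k, (K <= k)%N -> k%:R * lam <= bsum g k om) -> tildeSigma T T' om.
Proof.
move=> lam0 [K hK]; rewrite /tildeSigma /= limn_einf_lim.
pose u k := (birk g k om)%:E.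
have hsup := ereal_nondecreasing_cvgn (nondecreasing_einfs u).
rewrite (cvg_lim _ hsup)//; apply: (@lt_le_trans _ _ lam%:E); first by rewrite lte_fin.
apply: le_trans (_ : (einfs u K.+1 <= _)%E); last by apply: ereal_sup_ubound; exists K.+1.
apply: le_ereal_inf_tmp => _ [k /= Kk <-]; rewrite lee_fin /birk -/(bsum g k om).
rewrite ler_pdivlMl ?ltr0n ?(leq_ltn_trans _ Kk)//; apply: hK; exact: ltnW.
Qed.

Lemma mem_level_set (f : Sigma n -> R) om (alpha : R) :
  (forall e : R, 0 < e -> exists K, forall k, (K <= k)%N ->
    `|bsum f k om - k%:R * alpha| <= k%:R * e) -> level_set f alpha om.
Proof.
move=> h; apply/cvgrPdist_le => e e0; have [K hK] := h e e0.
exists K.+1 => // k /= Kk; have k0 : 0 < k%:R :> R by rewrite ltr0n (leq_ltn_trans _ Kk).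
rewrite distrC -(ler_pM2l k0) -{1}[k%:R](normr_nat R) -normrM.
have -> : k%:R * (birk f k om - alpha) = bsum f k om - k%:R * alpha.
  by rewrite mulrBr /birk -/(bsum f k om) mulrA divff ?mul1r// gt_eqF.
by apply: hK; exact: ltnW.
Qed.

(** Word sets of precision 1/(q+1) are given for every q with no control on their lengths; only the
    schedule of their use makes the lengths grow slowly. *)
Lemma level_not_null (f : Sigma n -> R) (mu : probability (SigmaM n) R) (c t : R) :
  ucont f -> shift_invariant mu -> 0 < mean mu g -> 0 < t -> t * mean mu g < c ->
  (forall e : R, 0 < e -> exists K, forall k, (K <= k)%N -> k%:R * (c - e) <= Hcyl mu k) ->
  ~ null_set t (projPi T @` (level_set f (mean mu f) `&` tildeSigma T T')).
Proof.
move=> uf inv lam0 t0 tlam hent hnull.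
have : forall q : nat, exists lW : nat * seq (seq 'I_n.+1), [/\ (0 < lW.1)%N, uniq lW.2,
    forall w, w \in lW.2 -> size w = lW.1,
    forall w om, w \in lW.2 -> cyl w om ->
      `|bsum f lW.1 om - lW.1%:R * mean mu f| <= lW.1%:R * q.+1%:R^-1 /\
      `|bsum g lW.1 om - lW.1%:R * mean mu g| <= lW.1%:R * q.+1%:R^-1 &
    expR (lW.1%:R * (c - q.+1%:R^-1)) <= (size lW.2)%:R].
  move=> q; have [|l [W hW]] := typical_words inv uf ug hent (e := q.+1%:R^-1).
    by rewrite invr_gt0.
  by exists (l, W).
move=> /choice[LW hLW].
(* At index j the finest admissible precision q is used, subject to q times the word length being at
   most j. So the length is at most j/q, and q tends to infinity since any fixed q becomes
   admissible. *)
have : forall j, exists q, (q * (LW q).1 <= j)%N /\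
    forall q', (q' <= j)%N -> (q' * (LW q').1 <= j)%N -> (q' <= q)%N.
  move=> j; pose P q := (q <= j)%N && (q * (LW q).1 <= j)%N.
  have exP : exists q, P q by exists 0%N.
  have bP q : P q -> (q <= j)%N by case/andP.
  have [q /andP[_ hq] hmax] := ex_maxnP exP bP.
  by exists q; split => // q' q1 q2; apply: hmax; rewrite /P q1.
move=> /choice[ka hka].
have ka_oo Q : exists J, forall j, (J <= j)%N -> (Q <= ka j)%N.
  exists (Q + Q * (LW Q).1)%N => j hj; apply: (hka j).2; lia.
pose l j := (LW (ka j)).1; pose V j := (LW (ka j)).2; pose eps j : R := (ka j).+1%:R^-1.
have inv_small (e : R) : 0 < e -> exists Q, forall q, (Q <= q)%N -> q.+1%:R^-1 <= e /\ 1 <= e * q%:R.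
  move=> e0; have [Q _ hQ] : \forall q \near \oo, e^-1 < q%:R by exact: nbhs_infty_gtr.
  exists Q => q /hQ /= h; split; last first.
    by rewrite -ler_pdivrMl// mulr1 ltW.
  rewrite -[e]invrK lef_pV2 ?posrE ?invr_gt0//.
  by apply/ltW/(lt_le_trans h); rewrite ler_nat leqnSn.
have l_gt0 j : (0 < l j)%N by case: (hLW (ka j)).
have uniqV j : uniq (V j) by case: (hLW (ka j)).
have sizeV j w : w \in V j -> size w = l j by case: (hLW (ka j)) => _ _ h _ _; exact: h.
have eps_to0 (e : R) : 0 < e -> exists J, forall j, (J <= j)%N -> eps j <= e.
  move=> /inv_small[Q hQ]; have [J hJ] := ka_oo Q.
  by exists J => j /hJ /hQ[].
have l_small (e : R) : 0 < e -> exists J, forall j, (J <= j)%N -> (l j)%:R <= e * j%:R.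
  move=> e0; have [Q hQ] := inv_small e e0; have [J hJ] := ka_oo Q.
  exists J => j /hJ /hQ[_ h].
  apply: (@le_trans _ _ (e * (ka j)%:R * (l j)%:R)); first by rewrite ler_peMl.
  by rewrite -mulrA -natrM ler_wpM2l ?(ltW e0)// ler_nat; case: (hka j).
have hVf j w om : w \in V j -> cyl w om ->
    `|bsum f (l j) om - (l j)%:R * mean mu f| <= (l j)%:R * eps j.
  by move=> hw ho; case: (hLW (ka j)) => _ _ _ h _; case: (h w om hw ho).
have hVg j w om : w \in V j -> cyl w om ->
    `|bsum g (l j) om - (l j)%:R * mean mu g| <= (l j)%:R * eps j.
  by move=> hw ho; case: (hLW (ka j)) => _ _ _ h _; case: (h w om hw ho).
have cardV j : expR ((l j)%:R * (c - eps j)) <= (size (V j))%:R by case: (hLW (ka j)).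
apply: (moran_not_null hTmap hC1 hpos hdisj hdiam l_gt0 uniqV sizeV eps_to0 l_small
  hVg cardV lam0 t0 tlam).
apply: null_set_sub hnull => _ [om hom <-]; exists om => //; split.
  by apply: mem_level_set; exact: (moran_average l_gt0 sizeV eps_to0 l_small hVf uf hom).
apply: (@mem_tildeSigma om (mean mu g / 2)); first by rewrite divr_gt0.
have [K hK] := moran_average l_gt0 sizeV eps_to0 l_small hVg ug hom (divr_gt0 lam0 (ltr0Sn R 1)).
by exists K => k /hK; rewrite ler_distl => /andP[h _]; lra.
Qed.

End LevelSets.

(** The entropy of N steps of a partition is at most that of cylinders of length N + l up to N e/4,
    and the fixed l is negligible against N. *)
Lemma Hcyl_ge_part_entropy (R : realType) n (mu : probability (SigmaM n) R) k
    (P : 'I_k -> set (SigmaM n)) (z : R) : shift_invariant mu -> is_partition P ->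
  z = lim ((fun N => part_entropy mu P N / N%:R) @ \oo) -> 0 < z ->
  forall e : R, 0 < e -> exists K, forall k, (K <= k)%N -> k%:R * (z - e) <= Hcyl mu k.
Proof.
move=> inv hP zE z0 e e0.
have cv : (fun N => part_entropy mu P N / N%:R) @ \oo --> z.
  rewrite zE; apply: contrapT => ncv.
  (* the [lim] of a divergent sequence is the junk value [point], here 0 *)
  by move: z0; rewrite zE (dvgP ncv) ltxx.
have e4 : 0 < e / 4 by rewrite divr_gt0.
have [l hl] := part_entropy_le_Hcyl inv hP e4.
have [N1 _ hN1] := proj1 (cvgrPdist_le _ _) cv _ e4.
have [N2 _ hN2] : \forall q \near \oo, l%:R * z / (e / 2) < q%:R.
  by apply: nbhs_infty_gtr.
exists (N1 + N2 + l).+1 => j hj.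
pose N := (j - l)%N; have jE : j = (N + l)%N by rewrite /N; lia.
have N0 : 0 < N%:R :> R by rewrite ltr0n /N; lia.
have h1 := hl N.
have := hN1 N; rewrite /= ler_distl => /(_ ltac:(rewrite /N; lia)) /andP[_].
rewrite -lerBlDr ler_pdivlMr// => h2.
have := hN2 j; rewrite /= ltr_pdivrMr ?divr_gt0// => /(_ ltac:(lia)) h3.
have jR : j%:R = N%:R + l%:R :> R by rewrite jE natrD.
have h4 : 0 <= l%:R * e by rewrite mulr_ge0// ltW.
rewrite jR in h3 *; rewrite [in leRHS]jE; lra.
Qed.

(* alphabet 'I_n.+1, i.e. m = n+1 maps T_0,...,T_n *)
Theorem theorem1 (R : realType) (n : nat) (T T' : 'I_n.+1 -> R -> R)
  (f : Sigma n -> R) (alpha : R)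
  (hTmap : forall i x, I01 x -> I01 (T i x))
  (hC1 : forall i, C1_on01 (T i) (T' i))
  (hpos : forall i x, I01 x -> 0 < T' i x)
  (hdisj : forall i j : 'I_n.+1, i != j -> T i @` I01o `&` T j @` I01o = set0)
  (hdiam : forall e : R, 0 < e -> exists N : nat, forall k, (N <= k)%N ->
     forall om : Sigma n, (diamE (compw T (sprefix om k) @` I01) < e%:E)%E)
  (hf : cont_Sigma f)
  (ha : (alpha_min f <= alpha%:E <= alpha_max f)%E) :
  hdim (projPi T @` (level_set f alpha `&` tildeSigma T T')) =
  ereal_sup ([set 0%E] `|`
    [set (ks_entropy mu * ((fine (lyap T T' mu))^-1)%:E)%E
    | mu in [set mu : probability (SigmaM n) R |
              shift_invariant mu /\ (\int[mu]_x (f x)%:E)%E = alpha%:E /\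
              (0 < lyap T T' mu)%E]]).
Proof.
have uf := cont_Sigma_ucont hf.
have ug := ucont_geom hTmap hC1 hpos hdiam.
have lyapE mu : lyap T T' mu = (mean mu (geom T T'))%:E by exact: meanE.
have hdim_ge0 E : (0 <= hdim E)%E.
  by apply: le_ereal_inf_tmp => _ [s [s0 _] <-]; rewrite lee_fin ltW.
(* The element 0 matters when no measure is admissible: the supremum of the empty set would be - oo,
   while a dimension is nonnegative. *)
set D := ereal_sup _.
have D0 : (0 <= D)%E by apply: ereal_sup_ubound; left.
apply/eqP; rewrite eq_le; apply/andP; split.
  case DE : D D0 => [r| |] // r0; last by rewrite leey.
  apply/lee_addgt0Pr => e e0; rewrite -EFinD.
  have s0 : 0 < r + e by rewrite ltr_wpDl// -lee_fin.
  apply: ereal_inf_lbound; exists (r + e) => //; split => //.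
  apply/null_setP; apply: (level_null hTmap hC1 hpos hdiam uf s0) => mu inv mf lam0 hH.
  (* A measure violating [no_state] for s = r + e would have entropy at least s times its exponent,
     so a quotient above the supremum r. *)
  have hks := ks_entropy_ge inv hH.
  have : (ks_entropy mu * ((fine (lyap T T' mu))^-1)%:E <= D)%E.
    apply: ereal_sup_ubound; right; exists mu => //; split => //.
    by rewrite (meanE mu uf) mf lyapE lte_fin.
  rewrite lyapE /= DE lee_pdivrMr// => h; have := le_trans hks h.
  by rewrite -EFinM lee_fin ler_pM2r// gerDl leNgt e0.
apply: ge_ereal_sup => _ [->|[mu [inv [mf lam0]] <-]]; first exact: hdim_ge0.
have mfa : mean mu f = alpha by rewrite /mean mf.
rewrite lyapE lte_fin in lam0.
apply: le_ereal_inf_tmp => _ [s [s0 hs] <-].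
rewrite lyapE /= lee_pdivrMr// -EFinM.
(* The entropy bound is checked one partition at a time, so the supremum need not be attained; a
   partition with rate above s times the exponent contradicts that the set is null in dimension
   s. *)
apply: ge_ereal_sup => _ [k [P [hP ->]]]; rewrite lee_fin leNgt; apply/negP => hz.
have z0 := lt_trans (mulr_gt0 s0 lam0) hz.
have hent := Hcyl_ge_part_entropy inv hP erefl z0.
apply: (level_not_null hTmap hC1 hpos hdisj hdiam uf inv lam0 s0 hz hent).
by rewrite mfa; apply/null_setP.
Qed.
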